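(* Assume that the transfer operator cocycle $(\mathcal L_\omega)_{\omega\in\Omega}$ is admissible, that the observable $g$ satisfies the regularity and fiberwise centering conditions, and that the asymptotic covariance matrix $\Sigma^2$ is positive definite. Then, for every bounded and continuous function $\phi:\mathbb R^d\to\mathbb R$ and $\mathbb P$-a.e. $\omega\in\Omega$, $$\lim_{n\to\infty}\int\phi\Big(\frac{S_ng(\omega,x)}{\sqrt n}\Big)\,d\mu_\omega(x)=\int\phi\,d\mathcal N(0,\Sigma^2),$$ where $\mathcal N(0,\Sigma^2)$ is the centered Gaussian law on $\mathbb R^d$ with covariance matrix $\Sigma^2$.
   Context: Base: $(\Omega,\mathcal F,\mathbb P)$ is a probability space, $\Omega$ a Borel subset of a separable complete metric space, and $\sigma:\Omega\to\Omega$ is a homeomorphism that is an invertible ergodic $\mathbb P$-preserving transformation. Variation: $(X,\mathcal G)$ is a measurable space with a probability measure $m$ and a functional $\mathrm{var}:L^1(X,m)\to[0,\infty]$ such that: (V1) $\mathrm{var}(th)=|t|\mathrm{var}(h)$; (V2) $\mathrm{var}(g+h)\le\mathrm{var}(g)+\mathrm{var}(h)$; (V3) $\|h\|_{L^\infty}\le C_{\mathrm{var}}(\|h\|_1+\mathrm{var}(h))$ for a constant $1\le C_{\mathrm{var}}<\infty$; (V4) for any $C>0$ the set $\{h:X\to\mathbb R:\|h\|_1+\mathrm{var}(h)\le C\}$ is $L^1(m)$-compact; (V5) $\mathrm{var}(1_X)<\infty$; (V6) $\{h:X\to\mathbb R_+:\|h\|_1=1,\ \mathrm{var}(h)<\infty\}$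 is $L^1(m)$-dense in $\{h:X\to\mathbb R_+:\|h\|_1=1\}$; (V7) if $\mathrm{ess\,inf} f>0$ then $\mathrm{var}(1/f)\le\mathrm{var}(f)/(\mathrm{ess\,inf} f)^2$; (V8) $\mathrm{var}(fg)\le\|f\|_{L^\infty}\mathrm{var}(g)+\|g\|_{L^\infty}\mathrm{var}(f)$; (V9) for $M>0$, measurable $f:X\to\overline B_{\mathbb R^d}(0,M)$ and $C^1$ $h:\overline B_{\mathbb R^d}(0,M)\to\mathbb C$, $\mathrm{var}(h\circ f)\le\sup\{\|Dh(P)\|:P\in\overline B_{\mathbb R^d}(0,M)\}\,\mathrm{var}(f)$, where for vector-valued $f$, $\mathrm{var}(f)=\max_i\mathrm{var}(f^i)$. $\mathcal B=\{h\in L^1(X,m):\mathrm{var}(h)<\infty\}$ (complex-valued functions) is a Banach space with norm $\|h\|_{\mathcal B}=\|h\|_1+\mathrm{var}(h)$. Cocycle: $T_\omega:X\to X$, $\omega\in\Omega$, are nonsingular ($m\circ T_\omega^{-1}\ll m$), $T_\omega^{(n)}=T_{\sigma^{n-1}\omega}\circ\cdots\circ T_\omega$. The transfer operator $\mathcal L_\omega$ is defined by $\int(\mathcal L_\omega\phi)\psi\,dm=\int\phi\,(\psi\circ T_\omega)\,dm$ ($\phi\in L^1,\psi\in L^\infty$), and $\mathcal L_\omega^{(n)}=\mathcal L_{\sigma^{n-1}\omega}\circ\cdots\circ\mathcal L_\omega$. Admissible means: (C1) $\omega\mapsto\mathcal L_\omega\in L(\mathcal B)$ is continuous on each of countably many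 Borel sets whose union is $\Omega$; (C2) there is $K>0$ with $\|\mathcal L_\omega f\|_{\mathcal B}\le K\|f\|_{\mathcal B}$ for all $f\in\mathcal B$ and a.e. $\omega$; (C3) there are $N\in\mathbb N$ and measurable $\alpha^N,\beta^N:\Omega\to(0,\infty)$ with $\int\log\alpha^N\,d\mathbb P<0$ and $\|\mathcal L_\omega^{(N)}f\|_{\mathcal B}\le\alpha^N(\omega)\|f\|_{\mathcal B}+\beta^N(\omega)\|f\|_1$ for all $f\in\mathcal B$, a.e. $\omega$; (C4) there are $K',\lambda>0$ with $\|\mathcal L_\omega^{(n)}f\|_{\mathcal B}\le K'e^{-\lambda n}\|f\|_{\mathcal B}$ for all $n\ge0$, $f\in\mathcal B$ with $\int f\,dm=0$, a.e. $\omega$; (C5) there are $N\in\mathbb N$, $c>0$ such that for each $a>0$ and all sufficiently large $n$, $\mathrm{ess\,inf}\,\mathcal L_\omega^{(Nn)}f\ge c\|f\|_1$ for a.e. $\omega$ and all $f\in\mathcal B$ with $f\ge0$, $\mathrm{var}(f)\le a\int f\,dm$. Invariant measure: $v^0:\Omega\times X\to\mathbb R^+$ is the unique measurable map with $v_\omega^0=v^0(\omega,\cdot)\in\mathcal B$, $\int v_\omega^0dm=1$, $\mathcal L_\omega v_\omega^0=v_{\sigma\omega}^0$ for a.e. $\omega$; $d\mu_\omega=v_\omega^0\,dm$. Observable: $g=(g^1,\dots,g^d):\Omega\times X\to\mathbb R^d$ is measurable. Regularity: $\|g\|_{L^\infty(\Omega\times X)}<\infty$ and $\mathrm{ess\,sup}_\omega\max_i\mathrm{var}(g^i(\omega,\cdot))<\infty$.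 Fiberwise centering: $\int g^i(\omega,\cdot)\,d\mu_\omega=0$ for a.e. $\omega$ and all $i$. $S_ng(\omega,x)=\sum_{i=0}^{n-1}g(\sigma^i\omega,T_\omega^{(i)}x)$. Covariance: $\Sigma^2$ is the positive semi-definite $d\times d$ matrix with $\Sigma^2=\lim_{n\to\infty}\frac1n\mathrm{Cov}_{\mu_\omega}(S_ng(\omega,\cdot))$ for a.e. $\omega$ (this limit exists). *)

(* Defs.v *)
From HB Require Import structures.
From mathcomp Require Import all_boot all_order all_algebra.
From mathcomp Require Import all_classical all_reals all_analysis.
From mathcomp Require Import measurable_realfun ess_sup_inf complex.

Set Implicit Arguments.
Unset Strict Implicit.
Unset Printing Implicit Defensive.

Import Order.TTheory GRing.Theory Num.Theory.
Import numFieldNormedType.Exports.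
Import ComplexField.

Local Open Scope classical_set_scope.
Local Open Scope ring_scope.
Local Open Scope complex_scope.

Local Notation Re := complex.Re.
Local Notation Im := complex.Im.

(* The classes of L^1(X, m) are represented by functions X -> R[i]; equality
   in L^1 is equality m-almost everywhere. *)
Section complex_functions.
Context {R : realType} {d : measure_display} {X : measurableType d}.
Variable m : {measure set X -> \bar R}.
Implicit Types (f : X -> R[i]) (u : X -> R).

Definition cmeasurable f :=
  measurable_fun [set: X] (fun x => Re (f x)) /\
  measurable_fun [set: X] (fun x => Im (f x)).

Definition cintegrable f :=
  m.-integrable [set: X] (fun x => (Re (f x))%:E) /\
  m.-integrable [set: X] (fun x => (Im (f x))%:E).

Definition cintegral f : R[i] :=
  (\int[m]_x Re (f x)) +i* (\int[m]_x Im (f x)).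

Definition L1norm f : \bar R := Lnorm m 1%E (fun x => (Normc.normc (f x))%:E).

Definition Loonorm f : \bar R := Lnorm m +oo%E (fun x => (Normc.normc (f x))%:E).

Definition of_real u : X -> R[i] := fun x => (u x)%:C.

End complex_functions.

Section L1_space.
Context {R : realType} {d : measure_display} {X : measurableType d}.
Variable m : {measure set X -> \bar R}.

Lemma cintegrable0 : cintegrable m (fun=> 0).
Proof. by split; exact: integrable0. Qed.

Lemma normc_ge0 (z : R[i]) : 0 <= Normc.normc z.
Proof. by case: z => a b /=; exact: sqrtr_ge0. Qed.

Lemma measurable_normc (f : X -> R[i]) : cmeasurable f ->
  measurable_fun [set: X] (fun x => Normc.normc (f x)).
Proof.
move=> [mr mi].
have -> : (fun x => Normc.normc (f x)) =
    Num.sqrt \o (fun x => Re (f x) ^+ 2 + Im (f x) ^+ 2).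
  by apply/funext => x /=; case: (f x).
apply: measurableT_comp.
  by apply: continuous_measurable_fun; exact: sqrt_continuous.
by apply: measurable_funD; exact: measurable_funX.
Qed.

Lemma cintegrable_measurable (f : X -> R[i]) : cintegrable m f -> cmeasurable f.
Proof.
move=> [/measurable_int mr /measurable_int mi].
by split; apply/measurable_EFinP.
Qed.

Lemma L1normE (f : X -> R[i]) :
  L1norm m f = (\int[m]_x (Normc.normc (f x))%:E)%E.
Proof.
rewrite /L1norm Lnorm1; apply: eq_integral => x _.
by rewrite gee0_abs// lee_fin normc_ge0.
Qed.

Lemma cmeasurableB (f g : X -> R[i]) : cmeasurable f -> cmeasurable g ->
  cmeasurable (fun x => f x - g x).
Proof.
move=> [fr fi] [gr gi]; split.
  have -> : (fun x => Re (f x - g x)) = (fun x => Re (f x) - Re (g x)).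
    by apply/funext => x; case: (f x) (g x) => ? ? [].
  exact: measurable_funB.
have -> : (fun x => Im (f x - g x)) = (fun x => Im (f x) - Im (g x)).
  by apply/funext => x; case: (f x) (g x) => ? ? [].
exact: measurable_funB.
Qed.

Lemma L1norm_triangle (f g h : X -> R[i]) :
  cmeasurable f -> cmeasurable g -> cmeasurable h ->
  (L1norm m (fun x => f x - h x)%R <=
   L1norm m (fun x => f x - g x)%R + L1norm m (fun x => g x - h x)%R)%E.
Proof.
move=> mf mg mh; rewrite !L1normE.
have mn (u v : X -> R[i]) : cmeasurable u -> cmeasurable v ->
    measurable_fun [set: X] (fun x => (Normc.normc (u x - v x))%:E).
  by move=> mu mv; exact/measurable_EFinP/measurable_normc/cmeasurableB.
rewrite -ge0_integralD//; first last.
- exact: mn.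
- by move=> x _; rewrite lee_fin normc_ge0.
- exact: mn.
- by move=> x _; rewrite lee_fin normc_ge0.
apply: ge0_le_integral => //.
- by move=> x _; rewrite lee_fin normc_ge0.
- exact: mn.
- by apply: emeasurable_funD; exact: mn.
- move=> x _; rewrite -EFinD lee_fin.
  have -> : f x - h x = (f x - g x) + (g x - h x) by rewrite addrA subrK.
  exact: le_normcD.
Qed.

(* The L^1 space as a topological space: the L^1 seminorm makes the integrable
   functions a pseudometric space whose Kolmogorov quotient is L^1(X, m). *)
Record L1fun := MkL1fun {
  L1val :> X -> R[i] ;
  L1valP : cintegrable m L1val }.

Definition L1ball (f : L1fun) (e : R) : set L1fun :=
  [set g : L1fun | (L1norm m (fun x => f x - g x)%R < e%:E)%E].

HB.instance Definition _ := gen_eqMixin L1fun.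
HB.instance Definition _ := gen_choiceMixin L1fun.
HB.instance Definition _ := isPointed.Build L1fun (MkL1fun cintegrable0).

Let L1ball_center (f : L1fun) (e : R) : 0 < e -> L1ball f e f.
Proof.
move=> e0; rewrite /L1ball /= L1normE.
under eq_integral do rewrite subrr Normc.normc0.
by rewrite integral0 lte_fin.
Qed.

Let L1ball_sym (f g : L1fun) (e : R) : L1ball f e g -> L1ball g e f.
Proof.
rewrite /L1ball /= !L1normE.
by under [X in _ -> (X < _)%E]eq_integral do rewrite -opprB normcN.
Qed.

Let L1ball_triangle (f g h : L1fun) (e1 e2 : R) :
  L1ball f e1 g -> L1ball g e2 h -> L1ball f (e1 + e2) h.
Proof.
rewrite /L1ball /= => fg gh; rewrite EFinD.
apply: le_lt_trans (lteD fg gh).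
by apply: L1norm_triangle; exact: cintegrable_measurable (L1valP _).
Qed.

Let L1ent : set_system (L1fun * L1fun) := entourage_ L1ball.

HB.instance Definition _ := hasNbhs.Build L1fun (nbhs_ L1ent).

Let L1nbhsE : @nbhs L1fun L1fun = nbhs_ L1ent. Proof. by []. Qed.

Let L1entE : L1ent = entourage_ L1ball. Proof. by []. Qed.

HB.instance Definition _ := @Nbhs_isPseudoMetric.Build R L1fun
  L1ent L1nbhsE L1ball L1ball_center L1ball_sym L1ball_triangle L1entE.

End L1_space.

Section Rd.
Context {R : realType} {d : nat}.
Implicit Types (v p : 'rV[R]_d) (h : 'rV[R]_d -> R[i]) (M : R).

(* R^d carries the sup norm, the library's norm on ['rV[R]_d]. It is the norm
   that fits the maximum in [var_vec] below: for d >= 2 and the Euclidean norm,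
   the composition rule of [is_variation] applied to f = (u, u) and
   h (x, y) = x + y would give 2 var u <= sqrt 2 var u. *)
Definition origin_ball M : set 'rV[R]_d := [set v | `|v| <= M].

(* C^1 on the closed ball in the sense of having a C^1 extension to an open
   neighbourhood; R[i] is not a normed R-module, hence the two components. *)
Definition C1_on_ball M h :=
  exists U : set 'rV[R]_d, [/\ open U, origin_ball M `<=` U &
    forall p, U p ->
      [/\ differentiable (fun q => Re (h q)) p,
          differentiable (fun q => Im (h q)) p &
          forall v,
            {for p, continuous (fun q => 'd (fun r => Re (h r)) q v)} /\
            {for p, continuous (fun q => 'd (fun r => Im (h r)) q v)}]].

(* operator norm of Dh(p) : R^d -> C *)
Definition Dnorm h p : \bar R :=
  ereal_sup [set (Normc.normc
      ('d (fun q => Re (h q)) p v +i* 'd (fun q => Im (h q)) p v))%:E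
    | v in origin_ball 1].

Definition pos_definite (S : 'M[R]_d) :=
  S^T = S /\ forall v, v != 0 -> 0 < (v *m S *m v^T) 0 0.

Definition borelRV := g_sigma_algebraType (@open 'rV[R]_d).

(* A law on R^d is N(0, S) iff each of its images under a nonzero linear form
   a is the law N(0, a S a^T) on R; [normal_prob] takes the standard
   deviation. *)
Definition centered_gaussian (S : 'M[R]_d) (nu : probability borelRV R) :=
  forall a : 'rV[R]_d, a != 0 -> forall A : set R, measurable A ->
    nu [set v : borelRV | A (((v : 'rV[R]_d) *m a^T) 0 0)] =
    normal_prob 0 (Num.sqrt ((a *m S *m a^T) 0 0)) A.

End Rd.

Section variation.
Context {R : realType} {d : measure_display} {X : measurableType d}.
Variables (m : probability X R) (var : (X -> R[i]) -> \bar R).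
Local Open Scope ereal_scope.

Definition Bnorm (f : X -> R[i]) : \bar R := L1norm m f + var f.

Definition inB (f : X -> R[i]) := cintegrable m f /\ var f < +oo.

Definition var_vec n (f : X -> 'rV[R]_n) : \bar R :=
  \big[maxe/0]_(i < n) var (of_real (fun x => f x 0%R i)).

Definition real_valued (f : X -> R[i]) := forall x, Im (f x) = 0%R.

Definition nonneg_valued (f : X -> R[i]) :=
  forall x, Im (f x) = 0%R /\ (0 <= Re (f x))%R.

Record is_variation (n : nat) : Prop := {
  var_ge0 : forall f, cintegrable m f -> 0 <= var f ;
  (* [var] is a functional on L^1, i.e. on classes *)
  var_ae : forall f g, cintegrable m f -> cintegrable m g ->
    {ae m, forall x, f x = g x} -> var f = var g ;
  var_scale : forall (t : R[i]) h, cintegrable m h ->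
    var (fun x => t * h x)%R = (Normc.normc t)%:E * var h ;
  var_add : forall g h, cintegrable m g -> cintegrable m h ->
    var (fun x => g x + h x)%R <= var g + var h ;
  var_Loo : exists2 Cvar : R, (1 <= Cvar)%R &
    forall h, cintegrable m h ->
      Loonorm m h <= Cvar%:E * (L1norm m h + var h) ;
  var_compact : forall C : R, (0 < C)%R ->
    compact [set h : L1fun m | real_valued h /\ L1norm m h + var h <= C%:E] ;
  var_one : var (fun=> 1%R) < +oo ;
  var_dense :
    [set h : L1fun m | nonneg_valued h /\ L1norm m h = 1] `<=`
    closure [set h : L1fun m |
      [/\ nonneg_valued h, L1norm m h = 1 & var h < +oo]] ;
  var_inv : forall f : X -> R, cintegrable m (of_real f) ->
    0 < ess_inf m (fun x => (f x)%:E) ->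
    var (of_real (fun x => (f x)^-1)%R) <=
    var (of_real f) * ((fine (ess_inf m (fun x => (f x)%:E)) ^+ 2)^-1)%:E ;
  var_mul : forall f g, cintegrable m f -> cintegrable m g ->
    cintegrable m (fun x => f x * g x)%R ->
    var (fun x => f x * g x)%R <= Loonorm m f * var g + Loonorm m g * var f ;
  var_comp : forall (M : R) (f : X -> 'rV[R]_n) (h : 'rV[R]_n -> R[i]),
    (0 < M)%R ->
    (forall i, measurable_fun [set: X] (fun x => f x 0%R i)) ->
    (forall x, origin_ball M (f x)) ->
    C1_on_ball M h ->
    var (fun x => h (f x)) <=
    ereal_sup [set Dnorm h p | p in origin_ball M] * var_vec f ;
  (* completeness of B *)
  var_banach : forall u : nat -> X -> R[i], (forall k, inB (u k)) ->
    (forall e : R, (0 < e)%R -> exists k0 : nat, forall k l : nat,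
      (k0 <= k)%N -> (k0 <= l)%N ->
      Bnorm (fun x => u k x - u l x)%R <= e%:E) ->
    exists2 f, inB f &
      Bnorm (fun x => u k x - f x)%R @[k --> \oo] --> 0 }.

Definition opnorm (D : (X -> R[i]) -> X -> R[i]) : \bar R :=
  ereal_sup [set Bnorm (D f) | f in [set f | inB f /\ Bnorm f <= 1]].

End variation.

(* Omega is, through the injection iota, a Borel subset of the separable
   complete metric space Y, and carries the induced topology
   [initial_topology iota]. *)
Section base.
Context {R : realType} {Y : metricType R} {dO : measure_display}
  {Omega : measurableType dO}.
Variables (P : probability Omega R) (iota : Omega -> Y)
  (sigma : Omega -> Omega).

Definition separable_complete :=
  (exists2 D : set Y, countable D & dense D) /\
  (forall F : set_system Y, ProperFilter F -> cauchy F ->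
    exists y : Y, F --> y).

Definition borel_subset :=
  [/\ injective iota,
      <<s (@open Y) >> (range iota) &
      <<s (@open (initial_topology iota)) >> `<=` @measurable dO Omega].

Definition homeomorphism := exists sigma' : Omega -> Omega,
  [/\ cancel sigma sigma', cancel sigma' sigma,
      continuous (sigma : initial_topology iota -> initial_topology iota) &
      continuous (sigma' : initial_topology iota -> initial_topology iota)].

Definition invertible_ergodic :=
  [/\ measurable_fun [set: Omega] sigma,
      exists sigma' : Omega -> Omega, [/\ cancel sigma sigma',
        cancel sigma' sigma & measurable_fun [set: Omega] sigma'],
      forall A, measurable A -> P (sigma @^-1` A) = P A &
      forall A, measurable A -> sigma @^-1` A = A ->
        P A = 0%E \/ P A = 1%E].

End base.

Arguments separable_complete {R} Y.

Section cocycle.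
Context {R : realType} {Y : metricType R} {dO dX : measure_display}
  {Omega : measurableType dO} {X : measurableType dX}.
Variables (P : probability Omega R) (iota : Omega -> Y)
  (sigma : Omega -> Omega) (m : probability X R).
Variable var : (X -> R[i]) -> \bar R.
Variables (T : Omega -> X -> X) (L : Omega -> (X -> R[i]) -> X -> R[i]).

Fixpoint iterT (n : nat) (w : Omega) : X -> X :=
  if n is k.+1 then T (iter k sigma w) \o iterT k w else id.

Fixpoint iterL (n : nat) (w : Omega) : (X -> R[i]) -> X -> R[i] :=
  if n is k.+1 then L (iter k sigma w) \o iterL k w else id.

Definition nonsingular (S : X -> X) :=
  measurable_fun [set: X] S /\ pushforward m S `<< m.

Definition transfer_operator (S : X -> X) (D : (X -> R[i]) -> X -> R[i]) :=
  forall phi, cintegrable m phi -> cintegrable m (D phi) /\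
    forall psi, cmeasurable psi -> (Loonorm m psi < +oo)%E ->
      cintegral m (fun x => D phi x * psi x) =
      cintegral m (fun x => phi x * psi (S x)).

Local Open Scope ereal_scope.

Definition continuous_cocycle :=
  (forall w, (forall f, inB m var f -> inB m var (L w f)) /\
             opnorm m var (L w) < +oo) /\
  exists A : nat -> set Omega,
    [/\ forall k, <<s (@open (initial_topology iota)) >> (A k),
        \bigcup_k A k = [set: Omega] &
        forall k (w0 : initial_topology iota), A k w0 ->
          opnorm m var (fun f x => L w f x - L w0 f x)%R
            @[w --> within (A k) (nbhs w0)] --> 0].

Definition bounded_cocycle := exists2 K : R, (0 < K)%R &
  {ae P, forall w, forall f, inB m var f ->
    Bnorm m var (L w f) <= K%:E * Bnorm m var f}.

(* The first integral condition says that the integral of log alpha exists in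
   [-oo, +oo[; without it the convention +oo - oo = -oo would intrude. *)
Definition lasota_yorke := exists (N : nat) (alpha beta : Omega -> R),
  [/\ (0 < N)%N,
      measurable_fun [set: Omega] alpha /\ measurable_fun [set: Omega] beta,
      (forall w, 0 < alpha w)%R /\ (forall w, 0 < beta w)%R,
      \int[P]_w (Num.max 0 (ln (alpha w)))%:E < +oo /\
      \int[P]_w (ln (alpha w))%:E < 0 &
      {ae P, forall w, forall f, inB m var f ->
        Bnorm m var (iterL N w f) <=
        (alpha w)%:E * Bnorm m var f + (beta w)%:E * L1norm m f}].

Definition uniform_decay := exists K lambda : R,
  [/\ (0 < K)%R, (0 < lambda)%R &
    {ae P, forall w, forall (n : nat) f, inB m var f -> cintegral m f = 0%R ->
      Bnorm m var (iterL n w f) <=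
      (K * expR (- lambda * n%:R))%:E * Bnorm m var f}].

(* iterL (N * n) w f is real almost everywhere when f is, hence the real part *)
Definition uniform_positivity := exists (N : nat) (c : R),
  [/\ (0 < N)%N, (0 < c)%R &
    forall a : R, (0 < a)%R -> exists n0 : nat, forall n : nat, (n0 <= n)%N ->
      {ae P, forall w, forall f : X -> R, inB m var (of_real f) ->
        (forall x, 0 <= f x)%R ->
        var (of_real f) <= a%:E * \int[m]_x (f x)%:E ->
        c%:E * L1norm m (of_real f) <=
        ess_inf m (fun x => (Re (iterL (N * n) w (of_real f) x))%:E)}].

Definition admissible :=
  [/\ continuous_cocycle, bounded_cocycle, lasota_yorke, uniform_decay &
      uniform_positivity].

Definition invariant_density (v : Omega * X -> R) :=
  [/\ measurable_fun [set: Omega * X] v, (forall p, 0 <= v p)%R &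
    {ae P, forall w, let vw := of_real (fun x => v (w, x)) in
      [/\ inB m var vw, \int[m]_x (v (w, x))%:E = 1 &
          {ae m, forall x,
            L w vw x = of_real (fun y => v (sigma w, y)) x}]}].

Definition has_density (v : Omega * X -> R) (mu : Omega -> probability X R) :=
  {ae P, forall w, forall A, measurable A ->
    mu w A = \int[m]_(x in A) (v (w, x))%:E}.

Section observable.
Context {n : nat}.
Variables (g : Omega * X -> 'rV[R]_n) (mu : Omega -> probability X R).

Definition regular_observable :=
  [/\ forall i, measurable_fun [set: Omega * X] (fun p => g p 0%R i),
      Lnorm (P \x m) +oo (fun p => (`|g p|)%:E) < +oo &
      ess_sup P (fun w => var_vec var (fun x => g (w, x))) < +oo].

Definition fiberwise_centered :=
  {ae P, forall w, forall i, \int[mu w]_x (g (w, x) 0%R i)%:E = 0}.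

Definition birkhoff_sum (k : nat) (w : Omega) (x : X) : 'rV[R]_n :=
  (\sum_(i < k) g (iter i sigma w, iterT i w x))%R.

Definition asymptotic_covariance (S : 'M[R]_n) :=
  {ae P, forall w, forall i j,
    (k%:R^-1)%:E * covariance (mu w)
        (fun x => birkhoff_sum k w x 0%R i) (fun x => birkhoff_sum k w x 0%R j)
      @[k --> \oo] --> (S i j)%:E}.

End observable.

End cocycle.

(* Main.v *)
Require Import Defs.
From HB Require Import structures.
From mathcomp Require Import all_boot all_order all_algebra.
From mathcomp Require Import all_classical all_reals all_analysis.
From mathcomp Require Import measurable_realfun ess_sup_inf complex ring.

Set Implicit Arguments.
Unset Strict Implicit.
Unset Printing Implicit Defensive.

Import Order.TTheory GRing.Theory Num.Theory.
Import numFieldNormedType.Exports.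
Import ComplexField.

(** The proof follows the characteristic functions along a single trajectory.
    Almost every [w] has an orbit at each point of which the almost sure
    hypotheses hold; for such a [w] there remain a sequence of maps [T j] with
    transfer operators [L j], densities [v j] and observables [g j], all with
    bounds independent of [j] ([cocycle_bounds], [observable_bounds],
    [density_bounded]).

    Fix a linear form [a], let [u j] be its value on [g j], and let [S k] be the
    [k]-th Birkhoff sum. The characteristic function [charf t k] of [S k] in the
    direction [a] is the integral of the density [twisted t k] that arises from
    [v 0] by multiplying with [expi (t * u j)] and applying [L j] in turn. As the
    products of the [L j] contract the functions of mean zero exponentially,
    [twisted t k] differs from [charf t k * v k] by [O(t)], and by [O(t ^ 2)]
    after a correction of first order in [t] that involves the correlations of
    the past with the present ([rem1_decays], [rem2_decays]). So one step
    multiplies [charf] by [1 - t ^ 2 * halfvar_incr k] up to [O(t ^ 3)]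
    ([charf_step]). For [t = 1 / sqrt k] the errors of [k] steps add up to
    [O(1 / sqrt k)], and the product is the exponential of minus the sum of the
    [halfvar_incr], divided by [k]. By an exact identity ([sum_halfvar_incr]) this
    sum is half the variance of [S k] in the direction [a]; hence the convergence
    of the normalized covariances gives that of the characteristic functions to
    [expR (- (a Sigma2 a^T) / 2)] ([charf_cvg]), which is the Gaussian one by
    Stein's identity ([normal_prob_integral_cos]).

    The smallness in [t] comes from the rule for the variation of a composition:
    [expi (t * u j) - 1] and its next Taylor remainder have norms [O(t)] and
    [O(t ^ 2)] uniformly in [j] ([Bbound_linear_form_ae]).

    Finally, a bounded continuous function is approximated by a trigonometric
    polynomial with an error [e * (1 + |x| ^ 2)] ([trig_approx]). The second
    moments of [S k / sqrt k] are bounded, so convergence for cosines implies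
    weak convergence ([weak_convergence_of_cos]). *)

Local Open Scope classical_set_scope.
Local Open Scope ring_scope.
Local Open Scope complex_scope.

Local Notation Re := complex.Re.
Local Notation Im := complex.Im.
Local Notation normc := Normc.normc.

Ltac nonneg := repeat first
  [ done | exact: ltW | exact: normc_ge0 | exact: expR_ge0 | apply: addr_ge0
  | apply: mulr_ge0 | apply: exprn_ge0 | rewrite invr_ge0 ].

(** * Integration of complex functions *)

Section complex_numbers.
Context {R : realType}.
Implicit Types z w : R[i].

Lemma ReD z w : Re (z + w) = Re z + Re w. Proof. by case: z w => ? ? []. Qed.
Lemma ImD z w : Im (z + w) = Im z + Im w. Proof. by case: z w => ? ? []. Qed.
Lemma ReM z w : Re (z * w) = Re z * Re w - Im z * Im w.
Proof. by case: z w => ? ? []. Qed.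
Lemma ImM z w : Im (z * w) = Re z * Im w + Im z * Re w.
Proof. by case: z w => ? ? []. Qed.
Lemma normc_real (a : R) : normc a%:C = `|a|.
Proof. by rewrite /normc /= expr0n addr0 sqrtr_sqr. Qed.

Lemma normcE z : normc z = Num.sqrt (Re z ^+ 2 + Im z ^+ 2).
Proof. by case: z. Qed.

Lemma sqr_normc z : normc z ^+ 2 = Re z ^+ 2 + Im z ^+ 2.
Proof. by rewrite normcE sqr_sqrtr// addr_ge0// sqr_ge0. Qed.

Lemma normRe_le z : `|Re z| <= normc z.
Proof. by rewrite normcE -[leLHS]sqrtr_sqr ler_wsqrtr// lerDl sqr_ge0. Qed.

Lemma normIm_le z : `|Im z| <= normc z.
Proof. by rewrite normcE -[leLHS]sqrtr_sqr ler_wsqrtr// lerDr sqr_ge0. Qed.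

Lemma normc_le z : normc z <= `|Re z| + `|Im z|.
Proof.
rewrite -ler_sqr ?nnegrE ?normc_ge0 ?addr_ge0// sqr_normc.
by rewrite -(real_normK (num_real (Re z))) -(real_normK (num_real (Im z))) sqrrD
  addrAC lerDl mulrn_wge0// mulr_ge0.
Qed.

End complex_numbers.

Section real_ae.
Context {R : realType} {d : measure_display} {X : measurableType d}.
Variable m : {measure set X -> \bar R}.

Lemma ae_le_integrable (f g : X -> R) : measurable_fun [set: X] f ->
  m.-integrable [set: X] (EFin \o g) -> {ae m, forall x, `|f x| <= g x} ->
  m.-integrable [set: X] (EFin \o f).
Proof.
move=> mf /integrableP[mg ig] fg; apply/integrableP; split; first exact/measurable_EFinP.
apply: le_lt_trans ig; apply: ae_ge0_le_integral => //.
- by apply: measurableT_comp => //; exact/measurable_EFinP.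
- by apply: measurableT_comp.
- by apply: filterS fg => x fgx _; rewrite lee_fin (le_trans fgx)// ler_norm.
Qed.

Lemma ae_eq_Rintegral (f g : X -> R) : measurable_fun [set: X] f ->
  measurable_fun [set: X] g -> {ae m, forall x, f x = g x} ->
  \int[m]_x f x = \int[m]_x g x.
Proof.
move=> mf mg fg; congr fine; apply: ae_eq_integral => //; try exact/measurable_EFinP.
by apply: filterS fg => x -> _.
Qed.

Lemma ae_le_Rintegral (f g : X -> R) : m.-integrable [set: X] (EFin \o f) ->
  m.-integrable [set: X] (EFin \o g) -> {ae m, forall x, f x <= g x} ->
  \int[m]_x f x <= \int[m]_x g x.
Proof.
move=> fi gi fg; rewrite -subr_ge0 -RintegralB//.
have mf : measurable_fun [set: X] f by apply/measurable_EFinP; exact: measurable_int fi.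
have mg : measurable_fun [set: X] g by apply/measurable_EFinP; exact: measurable_int gi.
rewrite (@ae_eq_Rintegral _ (fun x => `|g x - f x|)).
- by apply: Rintegral_ge0.
- exact: measurable_funB.
- by apply: measurableT_comp => //; exact: measurable_funB.
- by apply: filterS fg => x fgx; rewrite ger0_norm// subr_ge0.
Qed.

Lemma integrable_addr (f g : X -> R) : m.-integrable [set: X] (EFin \o f) ->
  m.-integrable [set: X] (EFin \o g) ->
  m.-integrable [set: X] (EFin \o (fun x => f x + g x)).
Proof. by move=> fi gi; have := integrableD measurableT fi gi. Qed.

Lemma integrable_mull (c : R) (f : X -> R) : m.-integrable [set: X] (EFin \o f) ->
  m.-integrable [set: X] (EFin \o (fun x => c * f x)).
Proof. by move=> fi; have := integrableZl measurableT c fi. Qed.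

Lemma Rintegral_sum (I : Type) (r : seq I) (f : I -> X -> R) :
  (forall i, m.-integrable [set: X] (EFin \o f i)) ->
  m.-integrable [set: X] (EFin \o (fun x => \sum_(i <- r) f i x)) /\
  \int[m]_x (\sum_(i <- r) f i x) = \sum_(i <- r) \int[m]_x f i x.
Proof.
move=> fi; elim: r => [|i r [IH1 IH2]].
  have E : (fun x => \sum_(i <- [::]) f i x) = (fun=> 0) by apply/funext => x; rewrite big_nil.
  rewrite E big_nil Rintegral_cst// mul0r; split => //; exact: integrable0.
have E : (fun x => \sum_(j <- i :: r) f j x) = (fun x => f i x + \sum_(j <- r) f j x).
  by apply/funext => x; rewrite big_cons.
by rewrite E big_cons -IH2 RintegralD//; split => //; exact: integrable_addr.
Qed.

End real_ae.

Lemma integrable_ae_bounded {R : realType} {d : measure_display}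
    {X : measurableType d} (m : probability X R) (f : X -> R) (c : R) :
  measurable_fun [set: X] f -> {ae m, forall x, `|f x| <= c} ->
  m.-integrable [set: X] (EFin \o f).
Proof.
move=> mf fc; apply: (@ae_le_integrable _ _ _ _ _ (fun=> c)) => //.
exact: finite_measure_integrable_cst.
Qed.

Section complex_integral.
Context {R : realType} {d : measure_display} {X : measurableType d}.
Variable m : {measure set X -> \bar R}.
Implicit Types f g : X -> R[i].
Local Notation cintegrable := (cintegrable m).
Local Notation cintegral := (cintegral m).
Local Notation L1norm := (L1norm m).

Lemma cmeasurableD f g : cmeasurable f -> cmeasurable g ->
  cmeasurable (fun x => f x + g x).
Proof.
move=> [fr fi] [gr gi]; split.
  by under eq_fun do rewrite ReD; exact: measurable_funD.
by under eq_fun do rewrite ImD; exact: measurable_funD.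
Qed.

Lemma cmeasurableM f g : cmeasurable f -> cmeasurable g ->
  cmeasurable (fun x => f x * g x).
Proof.
move=> [fr fi] [gr gi]; split.
  under eq_fun do rewrite ReM.
  by apply: measurable_funB; exact: measurable_funM.
under eq_fun do rewrite ImM.
by apply: measurable_funD; exact: measurable_funM.
Qed.

Lemma cmeasurable_cst (c : R[i]) : cmeasurable (fun _ : X => c).
Proof. by split; exact: measurable_cst. Qed.

Lemma cmeasurable_real (u : X -> R) : measurable_fun [set: X] u ->
  cmeasurable (of_real u).
Proof. by move=> mu; split => //=; exact: measurable_cst. Qed.

Lemma integrable_normc f : cintegrable f ->
  m.-integrable [set: X] (fun x => (normc (f x))%:E).
Proof.
move=> [ir ii]; apply: (@ae_le_integrable _ _ _ _ _ (fun x => `|Re (f x)| + `|Im (f x)|)).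
- exact/measurable_normc/(cintegrable_measurable (conj ir ii)).
- by apply: integrable_addr; exact: integrable_norm.
- by apply: aeW => x; rewrite ger0_norm ?normc_ge0// normc_le.
Qed.

Lemma ae_le_cintegrable f (g : X -> R) : cmeasurable f ->
  m.-integrable [set: X] (EFin \o g) -> {ae m, forall x, normc (f x) <= g x} ->
  cintegrable f.
Proof.
move=> [fr fi] ig fg; split; apply: (ae_le_integrable _ ig) => //;
  apply: filterS fg => x; apply: le_trans.
  exact: normRe_le.
exact: normIm_le.
Qed.

Lemma L1norm_fin f : cintegrable f -> L1norm f = (\int[m]_x normc (f x))%:E.
Proof.
by move=> fi; rewrite L1normE /Rintegral fineK// integrable_fin_num//; exact: integrable_normc.
Qed.

Lemma cintegrableD f g : cintegrable f -> cintegrable g ->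
  cintegrable (fun x => f x + g x).
Proof.
move=> [fr fi] [gr gi]; split.
  by under eq_fun do rewrite ReD; exact: integrable_addr.
by under eq_fun do rewrite ImD; exact: integrable_addr.
Qed.

Lemma cintegralD f g : cintegrable f -> cintegrable g ->
  cintegral (fun x => f x + g x) = cintegral f + cintegral g.
Proof.
move=> [fr fi] [gr gi]; rewrite /cintegral /=; congr (_ +i* _).
  by under eq_Rintegral do rewrite ReD; rewrite RintegralD.
by under eq_Rintegral do rewrite ImD; rewrite RintegralD.
Qed.

Lemma cintegrable_bounded f g (M : R) : cintegrable f -> cmeasurable g ->
  {ae m, forall x, normc (g x) <= M} -> cintegrable (fun x => f x * g x).
Proof.
move=> fi mg gM.
apply: (@ae_le_cintegrable _ (fun x => normc (f x) * M)).
- by apply: cmeasurableM => //; exact: cintegrable_measurable fi.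
- by under eq_fun do rewrite mulrC; exact/integrable_mull/integrable_normc.
- by apply: filterS gM => x gx; rewrite Normc.normcM ler_wpM2l ?normc_ge0.
Qed.

Lemma cintegrableZ (c : R[i]) f : cintegrable f -> cintegrable (fun x => c * f x).
Proof.
move=> fi; under eq_fun do rewrite mulrC.
by apply: (@cintegrable_bounded _ _ (normc c)) => //; exact: aeW.
Qed.

Lemma cintegralZ (c : R[i]) f : cintegrable f ->
  cintegral (fun x => c * f x) = c * cintegral f.
Proof.
move=> [fr fi]; rewrite /cintegral; case: c => a b /=.
have Z k (h : X -> R) : m.-integrable [set: X] (fun x => (h x)%:E) ->
    m.-integrable [set: X] (EFin \o (fun x => k * h x)).
  exact: integrable_mull.
congr (_ +i* _).
  under eq_Rintegral do rewrite ReM /=.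
  by rewrite RintegralB ?RintegralZl//; exact: Z.
under eq_Rintegral do rewrite ImM /=.
by rewrite RintegralD ?RintegralZl//; exact: Z.
Qed.

Lemma cintegrableB f g : cintegrable f -> cintegrable g ->
  cintegrable (fun x => f x - g x).
Proof.
move=> fi gi; under eq_fun do rewrite -mulN1r.
by apply: cintegrableD => //; exact: cintegrableZ.
Qed.

Lemma cintegralB f g : cintegrable f -> cintegrable g ->
  cintegral (fun x => f x - g x) = cintegral f - cintegral g.
Proof.
move=> fi gi; under eq_fun do rewrite -mulN1r.
by rewrite cintegralD ?cintegralZ ?mulN1r//; exact: cintegrableZ.
Qed.

Lemma cintegral_ae f g : cmeasurable f -> cmeasurable g ->
  {ae m, forall x, f x = g x} -> cintegral f = cintegral g.
Proof.
move=> [fr fi] [gr gi] fg; rewrite /cintegral; congr (_ +i* _).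
  by apply: ae_eq_Rintegral => //; apply: filterS fg => x ->.
by apply: ae_eq_Rintegral => //; apply: filterS fg => x ->.
Qed.

(** Rotating by the conjugate of the value of the integral turns the modulus of
    that value into the integral of a real part. *)
Lemma normc_cintegral f : cintegrable f ->
  normc (cintegral f) <= \int[m]_x normc (f x).
Proof.
move=> fi; set z := cintegral f.
have [z0|z0] := leP (normc z) 0.
  by rewrite (le_trans z0)// Rintegral_ge0// => x _; exact: normc_ge0.
rewrite -(ler_pM2l z0) -expr2 sqr_normc.
have -> : Re z ^+ 2 + Im z ^+ 2 = Re (cintegral (fun x => z^* * f x)).
  by rewrite cintegralZ// -/z ReM; case: z {z0} => a b /=; ring.
have ifz : cintegrable (fun x => z^* * f x) by exact: cintegrableZ.
rewrite -RintegralZl//; last exact: integrable_normc.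
apply: le_Rintegral => //; first exact: ifz.1.
  exact/integrable_mull/integrable_normc.
move=> x _; rewrite (le_trans (ler_norm _))// (le_trans (normRe_le _))// Normc.normcM.
by rewrite ler_wpM2r ?normc_ge0//; case: (z) => a b /=; rewrite sqrrN.
Qed.

Lemma ae_le_L1norm f (g : X -> R) : cmeasurable f ->
  m.-integrable [set: X] (EFin \o g) -> {ae m, forall x, normc (f x) <= g x} ->
  \int[m]_x normc (f x) <= \int[m]_x g x.
Proof.
move=> mf ig fg; apply: ae_le_Rintegral => //.
exact/integrable_normc/(ae_le_cintegrable mf ig).
Qed.

End complex_integral.

(** * Transfer operators and the norm of the space of bounded variation *)

Section duality.
Context {R : realType} {d : measure_display} {X : measurableType d}.
Variable m : probability X R.
Implicit Types f g h psi : X -> R[i].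
Local Notation cintegrable := (cintegrable m).
Local Notation cintegral := (cintegral m).
Local Notation L1norm := (L1norm m).

Lemma ae_bounded_Loonorm psi (M : R) : {ae m, forall x, normc (psi x) <= M} ->
  (Loonorm m psi <= M%:E)%E.
Proof.
move=> psiM; rewrite /Loonorm unlock ifT; last by rewrite [X in (_ < X)%E](probability_setT m) lte01.
apply/ess_supP; apply: filterS psiM => x; rewrite /= lee_fin ger0_norm//.
exact: normc_ge0.
Qed.

Lemma Loonorm_ae psi (M : R) : (Loonorm m psi <= M%:E)%E ->
  {ae m, forall x, normc (psi x) <= M}.
Proof.
rewrite /Loonorm unlock ifT; last by rewrite [X in (_ < X)%E](probability_setT m) lte01.
move=> /ess_supP; apply: filterS => x; rewrite /= lee_fin ger0_norm//.
exact: normc_ge0.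
Qed.

(** The indicator functions already separate integrable functions. *)
Lemma cintegral_separates f g : cintegrable f -> cintegrable g ->
  (forall psi, cmeasurable psi -> (Loonorm m psi < +oo)%E ->
    cintegral (fun x => f x * psi x) = cintegral (fun x => g x * psi x)) ->
  {ae m, forall x, f x = g x}.
Proof.
move=> fi gi fg.
have ind A : measurable A -> cintegral (fun x => f x * (\1_A x)%:C) =
    cintegral (fun x => g x * (\1_A x)%:C).
  move=> mA; apply: fg; first exact: (cmeasurable_real (measurable_indic mA)).
  apply: (@le_lt_trans _ _ 1%:E); last by rewrite ltry.
  apply: ae_bounded_Loonorm; apply: aeW => x.
  by rewrite normc_real ger0_norm ?indicE// lern1 leq_b1.
have key (p : X -> R) A : measurable A -> m.-integrable [set: X] (EFin \o p) ->
    (\int[m]_(x in A) (p x)%:E)%E = (\int[m]_x (p x * \1_A x))%:E.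
  move=> mA ip; rewrite /Rintegral fineK; last first.
    apply: integrable_fin_num => //.
    have := (integrable_mkcond (EFin \o p) mA).1
      (integrableS measurableT mA (@subsetT _ A) ip).
    rewrite (_ : _ \_ A = EFin \o (fun x => p x * \1_A x))//.
    apply/funext => x; rewrite patchE /= indicE.
    by case: (x \in A); rewrite ?mulr1 ?mulr0.
  rewrite [LHS]integral_mkcond; apply: eq_integral => x _.
  by rewrite patchE indicE; case: (x \in A); rewrite ?mulr1 ?mulr0.
have eRe A h : Re (cintegral (fun x => h x * (\1_A x)%:C)) =
    \int[m]_x (Re (h x) * \1_A x).
  by apply: eq_Rintegral => x _; rewrite ReM /= mulr0 subr0.
have eIm A h : Im (cintegral (fun x => h x * (\1_A x)%:C)) =
    \int[m]_x (Im (h x) * \1_A x).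
  by apply: eq_Rintegral => x _; rewrite ImM /= mulr0 add0r.
have hRe : ae_eq m [set: X] (fun x => (Re (f x))%:E) (fun x => (Re (g x))%:E).
  apply: integral_ae_eq => //; first exact: fi.1.
    exact: measurable_int gi.1.
  move=> A _ mA; rewrite (key (fun x => Re (f x)) _ mA fi.1) (key (fun x => Re (g x)) _ mA gi.1).
  by rewrite -!eRe (ind A mA).
have hIm : ae_eq m [set: X] (fun x => (Im (f x))%:E) (fun x => (Im (g x))%:E).
  apply: integral_ae_eq => //; first exact: fi.2.
    exact: measurable_int gi.2.
  move=> A _ mA; rewrite (key (fun x => Im (f x)) _ mA fi.2) (key (fun x => Im (g x)) _ mA gi.2).
  by rewrite -!eIm (ind A mA).
apply: filterS2 hRe hIm => x /(_ I)[fgr] /(_ I)[fgi].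
by case: (f x) (g x) fgr fgi => a b [a' b'] /= -> ->.
Qed.

End duality.

Section transfer_operators.
Context {R : realType} {d : measure_display} {X : measurableType d}.
Variable m : probability X R.
Variables (S : X -> X) (D : (X -> R[i]) -> X -> R[i]).
Hypothesis D_transfer : transfer_operator m S D.
Hypothesis S_nonsingular : nonsingular m S.
Implicit Types f g h psi : X -> R[i].
Local Notation cintegrable := (cintegrable m).
Local Notation cintegral := (cintegral m).

Lemma transfer_integrable f : cintegrable f -> cintegrable (D f).
Proof. by move=> /D_transfer[]. Qed.

Lemma transfer_duality f psi (M : R) : cintegrable f -> cmeasurable psi ->
  {ae m, forall x, normc (psi x) <= M} ->
  cintegral (fun x => D f x * psi x) = cintegral (fun x => f x * psi (S x)).
Proof.
move=> /D_transfer[_ Df] mpsi psiM; apply: Df => //.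
by apply: le_lt_trans (ae_bounded_Loonorm psiM) _; rewrite ltry.
Qed.

Lemma transfer_integral f : cintegrable f -> cintegral (D f) = cintegral f.
Proof.
move=> fi; have := @transfer_duality f (fun=> 1) 1 fi.
have E h : (fun x => h x * 1) = h by apply/funext => x; rewrite mulr1.
rewrite !E; apply; first exact: cmeasurable_cst.
by apply: aeW => x; rewrite Normc.normc1.
Qed.

Lemma ae_preimage (Q : X -> Prop) : {ae m, forall x, Q x} -> {ae m, forall x, Q (S x)}.
Proof.
case: S_nonsingular => mS /null_content_dominatesP dom [N [mN N0 QN]].
exists (S @^-1` N); split.
- by rewrite -[X in measurable X]setTI; exact: mS.
- exact: dom.
- by move=> x /= Qx; exact: QN.
Qed.

Lemma cmeasurable_comp f : cmeasurable f -> cmeasurable (fun x => f (S x)).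
Proof.
case: S_nonsingular => mS _ [fr fi]; split.
  exact: (measurableT_comp fr mS).
exact: (measurableT_comp fi mS).
Qed.

Let bounded_comp psi : cmeasurable psi -> (Loonorm m psi < +oo)%E ->
  exists M : R, [/\ {ae m, forall x, normc (psi x) <= M},
    {ae m, forall x, normc (psi (S x)) <= M} & cmeasurable (fun x => psi (S x))].
Proof.
move=> mpsi psioo; exists (fine (Loonorm m psi)).
have psiM : {ae m, forall x, normc (psi x) <= fine (Loonorm m psi)}.
  apply: Loonorm_ae; rewrite fineK// ge0_fin_numE//; exact: Lnorm_ge0.
split => //; last exact: cmeasurable_comp.
exact: (@ae_preimage (fun x => normc (psi x) <= _)).
Qed.

Lemma transfer_ae f g : cintegrable f -> cintegrable g ->
  {ae m, forall x, f x = g x} -> {ae m, forall x, D f x = D g x}.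
Proof.
move=> fi gi fg; apply: cintegral_separates; try exact: transfer_integrable.
move=> psi mpsi psioo; have [M [psiM psiSM mS]] := bounded_comp mpsi psioo.
rewrite !(transfer_duality _ mpsi psiM)//; apply: cintegral_ae.
- by apply: cmeasurableM => //; exact: cintegrable_measurable fi.
- by apply: cmeasurableM => //; exact: cintegrable_measurable gi.
- by apply: filterS fg => x ->.
Qed.

Lemma transfer_lin (a b : R[i]) f g : cintegrable f -> cintegrable g ->
  {ae m, forall x, D (fun y => a * f y + b * g y) x = a * D f x + b * D g x}.
Proof.
move=> fi gi.
have Df := transfer_integrable fi; have Dg := transfer_integrable gi.
have afi : cintegrable (fun y => a * f y) by exact: cintegrableZ.
have bgi : cintegrable (fun y => b * g y) by exact: cintegrableZ.
apply: cintegral_separates.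
- by apply: transfer_integrable; exact: cintegrableD.
- by apply: cintegrableD; exact: cintegrableZ.
move=> psi mpsi psioo; have [M [psiM psiSM mS]] := bounded_comp mpsi psioo.
rewrite (transfer_duality _ mpsi psiM); last exact: cintegrableD.
under eq_fun do rewrite mulrDl -!mulrA.
rewrite cintegralD ?cintegralZ; try by [exact: cintegrable_bounded mS psiSM|
  apply: cintegrableZ; exact: cintegrable_bounded mS psiSM].
under [in RHS]eq_fun do rewrite mulrDl -!mulrA.
rewrite cintegralD ?cintegralZ; try by [exact: cintegrable_bounded mpsi psiM|
  apply: cintegrableZ; exact: cintegrable_bounded mpsi psiM].
by rewrite !(transfer_duality _ mpsi psiM).
Qed.

Lemma transferD f g : cintegrable f -> cintegrable g ->
  {ae m, forall x, D (fun y => f y + g y) x = D f x + D g x}.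
Proof.
move=> fi gi; have := transfer_lin 1 1 fi gi.
have -> : (fun y => 1 * f y + 1 * g y) = (fun y => f y + g y).
  by apply/funext => y; rewrite !mul1r.
by apply: filterS => x ->; rewrite !mul1r.
Qed.

Lemma transferZ a f : cintegrable f ->
  {ae m, forall x, D (fun y => a * f y) x = a * D f x}.
Proof.
move=> fi; have := transfer_lin a 0 fi fi.
have -> : (fun y => a * f y + 0 * f y) = (fun y => a * f y).
  by apply/funext => y; rewrite mul0r addr0.
by apply: filterS => x ->; rewrite mul0r addr0.
Qed.

Lemma transferB f g : cintegrable f -> cintegrable g ->
  {ae m, forall x, D (fun y => f y - g y) x = D f x - D g x}.
Proof.
move=> fi gi; have := transfer_lin 1 (-1) fi gi.
have -> : (fun y => 1 * f y + -1 * g y) = (fun y => f y - g y).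
  by apply/funext => y; rewrite mul1r mulN1r.
by apply: filterS => x ->; rewrite mul1r mulN1r.
Qed.

End transfer_operators.

Section variation_norm.
Context {R : realType} {d : measure_display} {X : measurableType d}.
Variables (m : probability X R) (var : (X -> R[i]) -> \bar R) (n : nat).
Hypothesis V : is_variation m var n.
Implicit Types (f g h : X -> R[i]) (a b c : R).
Local Notation cintegrable := (cintegrable m).
Local Notation cintegral := (cintegral m).
Local Notation L1norm := (L1norm m).

(** Norm bounds are carried as a real parameter, which keeps the extended
    reals out of the estimates. *)
Definition Bbound c f := cintegrable f /\ (Bnorm m var f <= c%:E)%E.

Lemma L1norm_ge0 f : (0 <= L1norm f)%E.
Proof. by rewrite L1normE integral_ge0// => x _; rewrite lee_fin normc_ge0. Qed.

Lemma Bbound_L1 c f : Bbound c f -> \int[m]_x normc (f x) <= c.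
Proof.
move=> [fi fc]; rewrite -lee_fin -L1norm_fin//; apply: le_trans fc.
by rewrite /Bnorm leeDl// (var_ge0 V).
Qed.

Lemma Bbound_var c f : Bbound c f -> (var f <= c%:E)%E.
Proof.
by move=> [fi fc]; apply: le_trans fc; rewrite /Bnorm leeDr// L1norm_ge0.
Qed.

Lemma Bbound_ge0 c f : Bbound c f -> 0 <= c.
Proof.
by move/Bbound_L1; apply: le_trans; apply: Rintegral_ge0 => x _; exact: normc_ge0.
Qed.

Lemma Bbound_le c c' f : c <= c' -> Bbound c f -> Bbound c' f.
Proof. by move=> cc [fi fc]; split => //; rewrite (le_trans fc)// lee_fin. Qed.

Lemma Bbound_inB c f : Bbound c f -> inB m var f.
Proof.
move=> fc; split; first exact: fc.1.
by rewrite (le_lt_trans (Bbound_var fc))// ltry.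
Qed.

Lemma inB_Bbound f : inB m var f -> exists c, Bbound c f.
Proof.
move=> [fi vf]; exists (fine (Bnorm m var f)); split => //.
have v0 : (0 <= var f)%E by exact: (var_ge0 V).
by rewrite fineK// /Bnorm L1norm_fin// fin_numD /= ge0_fin_numE.
Qed.

Lemma Bbound_intro a b f : cintegrable f -> \int[m]_x normc (f x) <= a ->
  (var f <= b%:E)%E -> Bbound (a + b) f.
Proof.
by move=> fi fa fb; split => //; rewrite /Bnorm L1norm_fin// EFinD leeD.
Qed.

Lemma Bbound_cintegral c f : Bbound c f -> normc (cintegral f) <= c.
Proof.
by move=> fc; rewrite (le_trans (normc_cintegral fc.1))//; exact: Bbound_L1.
Qed.

Lemma L1norm_ae f g : cmeasurable f -> cmeasurable g ->
  {ae m, forall x, f x = g x} -> \int[m]_x normc (f x) = \int[m]_x normc (g x).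
Proof.
move=> mf mg fg; apply: ae_eq_Rintegral; try exact: measurable_normc.
by apply: filterS fg => x ->.
Qed.

Lemma Bbound_ae c f g : cintegrable g -> {ae m, forall x, f x = g x} ->
  Bbound c f -> Bbound c g.
Proof.
move=> gi fg [fi]; rewrite /Bbound /Bnorm (var_ae V fi gi)// !L1norm_fin//.
have [mf mg] := (cintegrable_measurable fi, cintegrable_measurable gi).
by rewrite (L1norm_ae mf mg fg).
Qed.

Lemma BboundD a b f g : Bbound a f -> Bbound b g ->
  Bbound (a + b) (fun x => f x + g x).
Proof.
move=> fa gb; have [[fi fB] [gi gB]] := (fa, gb).
have fgi : cintegrable (fun x => f x + g x) by exact: cintegrableD.
split => //; rewrite EFinD; apply: le_trans (leeD fB gB).
rewrite /Bnorm addeACA leeD//; last exact: (var_add V).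
rewrite !L1norm_fin// -EFinD lee_fin -RintegralD//; try exact: integrable_normc.
apply: le_Rintegral => //; first exact: integrable_normc.
  by apply: integrable_addr; exact: integrable_normc.
by move=> x _; exact: le_normcD.
Qed.

Lemma BboundZ (t : R[i]) c f : Bbound c f -> Bbound (normc t * c) (fun x => t * f x).
Proof.
move=> [fi fB]; split; first exact: cintegrableZ.
rewrite /Bnorm (var_scale V)// L1norm_fin; last exact: cintegrableZ.
under eq_Rintegral do rewrite Normc.normcM.
rewrite RintegralZl//; last exact: integrable_normc.
rewrite EFinM -L1norm_fin// -ge0_muleDr ?L1norm_ge0//; last exact: (var_ge0 V).
by rewrite EFinM lee_wpmul2l// lee_fin normc_ge0.
Qed.

Lemma BboundB a b f g : Bbound a f -> Bbound b g ->
  Bbound (a + b) (fun x => f x - g x).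
Proof.
move=> fa gb; under eq_fun do rewrite -mulN1r.
apply: BboundD => //; rewrite -[b]mul1r.
by have := BboundZ (-1) gb; rewrite normcN Normc.normc1.
Qed.

Lemma Bbound0 c : 0 <= c -> Bbound c (fun=> 0).
Proof.
move=> c0; apply: (Bbound_le c0); have -> : (0 : R) = 0 + 0 by rewrite addr0.
apply: Bbound_intro; first exact: cintegrable0.
  by under eq_Rintegral do rewrite Normc.normc0; rewrite Rintegral_cst// mul0r.
have := var_scale V 0 (cintegrable0 m); rewrite Normc.normc0 mul0e.
by under eq_fun do rewrite mulr0; move=> ->.
Qed.

End variation_norm.

Section banach_algebra.
Context {R : realType} {d : measure_display} {X : measurableType d}.
Variables (m : probability X R) (var : (X -> R[i]) -> \bar R) (n : nat).
Hypothesis V : is_variation m var n.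
Variable Cv : R.
Hypothesis Cv1 : 1 <= Cv.
Hypothesis CvP : forall h, cintegrable m h ->
  (Loonorm m h <= Cv%:E * (L1norm m h + var h))%E.
Implicit Types (f g h : X -> R[i]) (a b c : R).
Local Notation Bbound := (Bbound m var).

Lemma Bbound_Loo c f : Bbound c f -> (Loonorm m f <= (Cv * c)%:E)%E.
Proof.
move=> [fi fc]; apply: (le_trans (CvP fi)); rewrite EFinM lee_pmul2l// lte_fin.
exact: lt_le_trans Cv1.
Qed.

Lemma BboundM a b f g : Bbound a f -> Bbound b g ->
  Bbound (3 * Cv * a * b) (fun x => f x * g x).
Proof.
move=> fa gb.
have a0 := Bbound_ge0 V fa; have b0 := Bbound_ge0 V gb.
have Cv0 : 0 <= Cv by exact: le_trans Cv1.
have gM := Loonorm_ae (Bbound_Loo gb).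
have mg := cintegrable_measurable gb.1.
have fgi : cintegrable m (fun x => f x * g x) by exact: cintegrable_bounded fa.1 mg gM.
have -> : 3 * Cv * a * b = Cv * b * a + (Cv * a * b + Cv * b * a) by ring.
apply: Bbound_intro => //.
  apply: (@le_trans _ _ (\int[m]_x (Cv * b * normc (f x)))).
    apply: (@ae_le_L1norm _ _ _ _ (fun x => f x * g x)); first exact: cintegrable_measurable fgi.
      by apply: integrable_mull; apply: integrable_normc; exact: fa.1.
    by apply: filterS gM => x gx; rewrite Normc.normcM mulrC ler_wpM2r// normc_ge0.
  rewrite RintegralZl//; last by apply: integrable_normc; exact: fa.1.
  by rewrite ler_wpM2l ?mulr_ge0//; exact: (Bbound_L1 V).
apply: (le_trans (var_mul V fa.1 gb.1 fgi)); rewrite EFinD; apply: leeD.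
  rewrite EFinM lee_pmul//.
  - exact: Lnorm_ge0.
  - exact: (var_ge0 V gb.1).
  - exact: Bbound_Loo.
  - exact: (Bbound_var gb).
rewrite EFinM lee_pmul//.
- exact: Lnorm_ge0.
- exact: (var_ge0 V fa.1).
- exact: Bbound_Loo.
- exact: (Bbound_var fa).
Qed.

End banach_algebra.

(** * The complex exponential on the imaginary axis *)

Section mean_value.
Context {R : realType}.

Lemma mean_value_bound (f df : R -> R) (x b : R) :
  (forall y : R, is_derive y (1:R) f (df y)) ->
  (forall y, `|y| <= `|x| -> `|df y| <= b) -> `|f x - f 0| <= b * `|x|.
Proof.
move=> fdf dfb.
have fc : continuous f.
  by move=> y; apply/differentiable_continuous/derivable1_diffP; have [] := fdf y.
have [x0|x0] := leP 0 x.
  have [] := @MVT_segment _ f df 0 x x0 (fun y _ => fdf y).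
    exact: continuous_subspaceT.
  move=> c; rewrite in_itv /= => /andP[c0 cx] ->; rewrite subr0 normrM.
  by rewrite ler_wpM2r// dfb// !ger0_norm.
have [] := @MVT_segment _ f df x 0 (ltW x0) (fun y _ => fdf y).
  exact: continuous_subspaceT.
move=> c; rewrite in_itv /= => /andP[cx c0] e.
rewrite distrC e sub0r normrM normrN.
by rewrite ler_wpM2r// dfb// ler0_norm// ler0_norm ?lerN2// ltW.
Qed.

Lemma cos_sub1_le (x : R) : `|cos x - 1| <= `|x|.
Proof.
rewrite -[leRHS]mul1r -[1 in X in `|X|]cos0.
by apply: (mean_value_bound (fun y => is_derive_cos y)) => y _; rewrite normrN sin_max.
Qed.

Lemma normr_sin_le (x : R) : `|sin x| <= `|x|.
Proof.
have := @mean_value_bound sin cos x 1 (fun y => is_derive_sin y).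
by rewrite sin0 subr0 mul1r; apply => y _; exact: cos_max.
Qed.

Lemma cos_sub1_le_sqr (x : R) : `|cos x - 1| <= `|x| ^+ 2.
Proof.
rewrite expr2 -[1 in X in `|X|]cos0.
apply: (mean_value_bound (fun y => is_derive_cos y)) => y yx.
by rewrite normrN (le_trans _ yx)// normr_sin_le.
Qed.

Let is_derive_sinB (y : R) : is_derive y (1:R) (fun z => sin z - z) (cos y - 1).
Proof. by apply: is_deriveB. Qed.

Lemma sin_sub_le_sqr (x : R) : `|sin x - x| <= `|x| ^+ 2.
Proof.
have := @mean_value_bound _ _ x `|x| is_derive_sinB.
rewrite sin0 subr0 subr0 expr2; apply => y yx.
by rewrite (le_trans _ yx)// cos_sub1_le.
Qed.

Lemma sin_sub_le_cube (x : R) : `|sin x - x| <= `|x| ^+ 3.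
Proof.
have := @mean_value_bound _ _ x (`|x| ^+ 2) is_derive_sinB.
rewrite sin0 subr0 subr0 -exprSr; apply => y yx.
by rewrite (le_trans (cos_sub1_le_sqr _))// lerXn2r// nnegrE.
Qed.

Lemma cos_taylor2_le (x : R) : `|cos x - 1 + x ^+ 2 / 2| <= `|x| ^+ 3.
Proof.
have d (y : R) : is_derive y (1:R) (fun z => cos z - 1 + z ^+ 2 / 2) (- (sin y - y)).
  apply: is_derive_eq.
  by rewrite /GRing.scale/= !mulr1; field.
have := @mean_value_bound _ _ x (`|x| ^+ 2) d.
rewrite cos0 subrr expr0n/= mul0r addr0 subr0 -exprSr; apply => y yx.
by rewrite normrN (le_trans (sin_sub_le_sqr _))// lerXn2r// nnegrE.
Qed.

End mean_value.

Section expi.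
Context {R : realType}.
Implicit Types a b : R.

Definition expi a : R[i] := cos a +i* sin a.

Lemma normc_expi a : normc (expi a) = 1.
Proof. by rewrite /= cos2Dsin2 sqrtr1. Qed.

Lemma expiD a b : expi (a + b) = expi a * expi b.
Proof.
rewrite /expi cosD sinD.
by apply/eqP; rewrite eq_complex /= eqxx /= [sin a * _]mulrC [cos a * sin b]mulrC
  [sin b * _]mulrC addrC [cos b * _]mulrC.
Qed.

Lemma expi0 : expi 0 = 1.
Proof. by rewrite /expi cos0 sin0. Qed.

Lemma cmeasurable_expi {d : measure_display} {X : measurableType d} (f : X -> R) :
  measurable_fun [set: X] f -> cmeasurable (fun x => expi (f x)).
Proof.
move=> mf; split.
  apply: (measurableT_comp _ mf); apply: continuous_measurable_fun.
  exact: continuous_cos.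
apply: (measurableT_comp _ mf); apply: continuous_measurable_fun.
exact: continuous_sin.
Qed.

(** The remainders of order one and two of the Taylor expansion of [expi]. *)
Definition expi1 a : R[i] := expi a - 1.
Definition expi2 a : R[i] := expi1 a - 'i * a%:C.

Lemma normc_expi1 a : normc (expi1 a) <= 2 * `|a|.
Proof.
rewrite (le_trans (normc_le _))//= mulr_natl mulr2n lerD//.
  exact: cos_sub1_le.
by rewrite subr0 normr_sin_le.
Qed.

Lemma normc_expi2 a : normc (expi2 a) <= 2 * `|a| ^+ 2.
Proof.
rewrite (le_trans (normc_le _))//= mulr_natl mulr2n lerD//.
  by rewrite !(mul0r, mul1r, mulr0, subr0) cos_sub1_le_sqr.
by rewrite !(mul0r, mul1r, mulr0, subr0, add0r) sin_sub_le_sqr.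
Qed.

Lemma normc_expi3 a : normc (expi2 a + (a ^+ 2 / 2)%:C) <= 2 * `|a| ^+ 3.
Proof.
rewrite (le_trans (normc_le _))//= mulr_natl mulr2n lerD//.
  by rewrite !(mul0r, mul1r, mulr0, subr0) cos_taylor2_le.
by rewrite !(mul0r, mul1r, mulr0, subr0, add0r, addr0) sin_sub_le_cube.
Qed.

End expi.

(** * Exponentially contracting sequences of transfer operators *)

Section sequential_operators.
Context {X : Type} {F : Type}.

(** The recursion splits off the operator that is applied first, which is the one
    that one-step estimates act on. *)
Fixpoint itL (L : nat -> F -> F) (k j : nat) : F -> F :=
  if k is k'.+1 then itL L k' j.+1 \o L j else id.

Fixpoint itT (T : nat -> X -> X) (n : nat) : X -> X :=
  if n is n'.+1 then T n' \o itT T n' else id.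

End sequential_operators.

Section contraction.
Context {R : realType} {d : measure_display} {X : measurableType d}.
Variables (m : probability X R) (var : (X -> R[i]) -> \bar R) (n : nat).
Hypothesis V : is_variation m var n.
Variables (T : nat -> X -> X) (L : nat -> (X -> R[i]) -> X -> R[i]).
Hypothesis T_nonsingular : forall j, nonsingular m (T j).
Hypothesis L_transfer : forall j, transfer_operator m (T j) (L j).
Variables K q : R.
Hypotheses (K1 : 1 <= K) (q0 : 0 <= q) (q1 : q < 1).
Local Notation Bbound := (Bbound m var).
Local Notation cintegrable := (cintegrable m).
Local Notation cintegral := (cintegral m).
Hypothesis L_bound : forall j c f, Bbound c f -> Bbound (K * c) (L j f).
Hypothesis L_decay : forall j k c f, Bbound c f -> cintegral f = 0 ->
  Bbound (K * q ^+ k * c) (itL L k j f).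
Implicit Types (f g h : X -> R[i]) (c : R).

Lemma itL_integrable k j f : cintegrable f -> cintegrable (itL L k j f).
Proof.
elim: k j f => //= k IH j f fi; apply: IH.
exact: (transfer_integrable (L_transfer j)).
Qed.

Lemma itL_ae k j f g : cintegrable f -> cintegrable g ->
  {ae m, forall x, f x = g x} -> {ae m, forall x, itL L k j f x = itL L k j g x}.
Proof.
elim: k j f g => //= k IH j f g fi gi fg; apply: IH.
- exact: (transfer_integrable (L_transfer j)).
- exact: (transfer_integrable (L_transfer j)).
- exact: (transfer_ae (L_transfer j) (T_nonsingular j)).
Qed.

Lemma itLD k j f g : cintegrable f -> cintegrable g ->
  {ae m, forall x, itL L k j (fun y => f y + g y) x = itL L k j f x + itL L k j g x}.
Proof.
elim: k j f g => /= [|k IH] j f g fi gi; first exact: aeW.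
have Lf := transfer_integrable (L_transfer j) fi.
have Lg := transfer_integrable (L_transfer j) gi.
have Lfg := transfer_integrable (L_transfer j) (cintegrableD fi gi).
apply: filterS2 (IH j.+1 _ _ Lf Lg) (itL_ae k j.+1 Lfg (cintegrableD Lf Lg) _).
  by move=> x <- ->.
exact: (transferD (L_transfer j) (T_nonsingular j)).
Qed.

(** A norm adapted to the decay: for it a single operator already contracts,
    so that one-step recursions can be iterated without losing constants. *)
Definition decays j c f := forall k, Bbound (c * q ^+ k) (itL L k j f).

Lemma decays_Bbound j c f : decays j c f -> Bbound c f.
Proof. by move=> /(_ 0); rewrite expr0 mulr1. Qed.

Lemma decays_mean0 j c f : Bbound c f -> cintegral f = 0 -> decays j (K * c) f.
Proof. by move=> fc f0 k; rewrite mulrAC; exact: L_decay. Qed.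

Lemma decays_le j c c' f : c <= c' -> decays j c f -> decays j c' f.
Proof.
by move=> cc fc k; apply: Bbound_le (fc k); rewrite ler_wpM2r// exprn_ge0.
Qed.

Lemma decays0 j c : 0 <= c -> decays j c (fun=> 0).
Proof.
move=> c0; apply: (@decays_le _ (K * (K^-1 * c))).
  by rewrite mulrA mulfV ?mul1r// gt_eqF// (lt_le_trans ltr01).
apply: decays_mean0; first apply: (Bbound0 V).
  by rewrite mulr_ge0// invr_ge0 (le_trans ler01).
by rewrite /cintegral /= Rintegral_cst// mul0r.
Qed.

(** The defect [g] has mean zero, hence it decays at the same rate. *)
Lemma decays_step j c e f g h : decays j c f -> Bbound e g -> cintegral g = 0 ->
  cintegrable h -> {ae m, forall x, h x = L j f x + g x} ->
  decays j.+1 (q * c + K * e) h.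
Proof.
move=> fc ge g0 hi hfg k.
have fi := (decays_Bbound fc).1.
have Lf := transfer_integrable (L_transfer j) fi.
have sumB : Bbound ((q * c + K * e) * q ^+ k)
    (fun x => itL L k j.+1 (L j f) x + itL L k j.+1 g x).
  rewrite mulrDl; apply: (BboundD V); last exact: decays_mean0.
  by have := fc k.+1; rewrite exprS mulrA (mulrC c).
apply: (Bbound_ae V _ _ sumB); first exact: itL_integrable.
have fgi := cintegrableD Lf ge.1.
apply: filterS2 (itLD k j.+1 Lf ge.1) (itL_ae k j.+1 hi fgi hfg) => x.
by move=> <- ->.
Qed.

(** A bound [rho] that absorbs the defects, for which [K * e <= (1 - q) * rho],
    propagates; the bound on a defect may use the one on the current term. *)
Lemma decays_seq (rho e : R) (g h : nat -> X -> R[i]) : q * rho + K * e <= rho ->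
  decays 0 rho (h 0) -> (forall j, cintegrable (h j)) ->
  (forall j, decays j rho (h j) -> Bbound e (g j)) ->
  (forall j, cintegral (g j) = 0) ->
  (forall j, {ae m, forall x, h j.+1 x = L j (h j) x + g j x}) ->
  forall j, decays j rho (h j).
Proof.
move=> rhoe h0 hi ge g0 hS; elim=> // j IH.
by apply: (decays_le rhoe); apply: decays_step IH (ge j IH) (g0 j) (hi _) (hS j).
Qed.

(** The functions [v j - 1] have mean zero and satisfy the recursion of
    [decays_seq], whose defects [L j 1 - 1] are bounded. *)
Lemma density_bounded (v : nat -> X -> R[i]) (c o : R) :
  Bbound c (v 0) -> Bbound o (fun=> 1) -> (forall j, cintegrable (v j)) ->
  (forall j, cintegral (v j) = 1) ->
  (forall j, {ae m, forall x, L j (v j) x = v j.+1 x}) ->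
  exists C, forall j, Bbound C (v j).
Proof.
move=> vc o1 vi v1 Lv.
have i1 : cintegral (fun=> 1) = 1.
  have mT : fine (m [set: X]) = 1 by rewrite (probability_setT m).
  by rewrite /Defs.cintegral /= !Rintegral_cst// mT !mulr1.
have c0 := Bbound_ge0 V vc; have o0 := Bbound_ge0 V o1.
have K0 : 0 <= K by exact: le_trans K1.
pose e := K * o + o; pose rho := K * (c + o) + K * e / (1 - q).
have q1' : 0 < 1 - q by rewrite subr_gt0.
have L1i j : cintegrable (L j (fun=> 1)).
  exact: (transfer_integrable (L_transfer j) o1.1).
have dec : forall j, decays j rho (fun x => v j x - 1).
  apply: (@decays_seq rho e (fun j x => L j (fun=> 1) x - 1)).
  - rewrite -subr_ge0; have -> : rho - (q * rho + K * e) = (1 - q) * (K * (c + o)).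
      by rewrite /rho; field; rewrite gt_eqF.
    by nonneg.
  - apply: (@decays_le _ (K * (c + o))).
      by rewrite lerDl; nonneg.
    apply: decays_mean0; first exact: (BboundB V).
    by rewrite cintegralB ?v1 ?i1 ?subrr//; exact: o1.1.
  - by move=> j; apply: cintegrableB => //; exact: o1.1.
  - by move=> j _; apply: (BboundB V) => //; exact: L_bound.
  - move=> j; rewrite cintegralB ?i1//; last exact: o1.1.
    by rewrite (transfer_integral (L_transfer j) o1.1) i1 subrr.
  - move=> j; have LB := transferB (L_transfer j) (T_nonsingular j) (vi j) o1.1.
    by apply: filterS2 LB (Lv j) => x -> ->; rewrite addrA subrK.
exists (rho + o) => j.
have := BboundD V (decays_Bbound (dec j)) o1.
by under eq_fun do rewrite subrK.
Qed.

End contraction.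

(** * Densities transported along a sequence of maps *)

Section nonsingular_maps.
Context {R : realType} {d : measure_display} {X : measurableType d}.
Variable m : probability X R.

Lemma nonsingular_id : nonsingular m id.
Proof.
split; first exact: measurable_id.
by apply/null_content_dominatesP => A mA.
Qed.

Lemma nonsingular_comp (S1 S2 : X -> X) :
  nonsingular m S1 -> nonsingular m S2 -> nonsingular m (S2 \o S1).
Proof.
move=> [m1 /null_content_dominatesP d1] [m2 /null_content_dominatesP d2].
split; first exact: measurableT_comp.
apply/null_content_dominatesP => A mA A0.
apply: (d1 (S2 @^-1` A)); last exact: d2.
by rewrite -[X in measurable X]setTI; exact: m2.
Qed.

Lemma itT_nonsingular (T : nat -> X -> X) : (forall j, nonsingular m (T j)) ->
  forall k, nonsingular m (itT T k).
Proof.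
move=> TnS; elim => [|k IH]; first exact: nonsingular_id.
exact: nonsingular_comp.
Qed.

End nonsingular_maps.

Section transported_densities.
Context {R : realType} {d : measure_display} {X : measurableType d}.
Variable (m : probability X R).
Variables (T : nat -> X -> X) (L : nat -> (X -> R[i]) -> X -> R[i]).
Hypothesis T_nonsingular : forall j, nonsingular m (T j).
Hypothesis L_transfer : forall j, transfer_operator m (T j) (L j).
Local Notation cintegrable := (cintegrable m).
Local Notation cintegral := (cintegral m).
Variable v0 : X -> R[i].
Hypothesis v0i : cintegrable v0.
Implicit Types (F G Phi Psi psi : X -> R[i]).

(** [F] is the density of the image under the [k]-th iterate of the complex
    measure [Phi * v0 * m]. *)
Definition transports (k : nat) Phi F :=
  [/\ cintegrable F, cmeasurable Phi, exists M : R, {ae m, forall x, normc (Phi x) <= M} &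
    forall psi (M : R), cmeasurable psi -> {ae m, forall x, normc (psi x) <= M} ->
      cintegral (fun x => F x * psi x) =
      cintegral (fun x => v0 x * Phi x * psi (itT T k x))].

Lemma transports0 : transports 0 (fun=> 1) v0.
Proof.
split => //; first by exists 1; apply: aeW => x; rewrite Normc.normc1.
by move=> psi M _ _; congr cintegral; apply/funext => x; rewrite mulr1.
Qed.

Lemma transports_step k Phi F : transports k Phi F -> transports k.+1 Phi (L k F).
Proof.
move=> [iF mPhi bPhi FE]; split => //; first exact: (transfer_integrable (L_transfer k)).
move=> psi M mpsi psiM; rewrite (transfer_duality (L_transfer k) iF mpsi psiM).
rewrite (FE (psi \o T k) M)//.
  exact: (cmeasurable_comp (T_nonsingular k)).
exact: (ae_preimage (T_nonsingular k) psiM).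
Qed.

Lemma transports_ae k Phi F G : cintegrable G -> {ae m, forall x, F x = G x} ->
  transports k Phi F -> transports k Phi G.
Proof.
move=> iG FG [iF mPhi bPhi FE]; split => // psi M mpsi psiM.
rewrite -(FE psi M)//; apply: cintegral_ae.
- by apply: cmeasurableM => //; exact: cintegrable_measurable iG.
- by apply: cmeasurableM => //; exact: cintegrable_measurable iF.
- by apply: filterS FG => x ->.
Qed.

Lemma transports_mul k Phi F G (M : R) : cmeasurable G ->
  {ae m, forall x, normc (G x) <= M} -> transports k Phi F ->
  transports k (fun x => Phi x * G (itT T k x)) (fun x => G x * F x).
Proof.
move=> mG GM [iF mPhi [N bPhi] FE].
have nS := itT_nonsingular T_nonsingular k.
have mGS := cmeasurable_comp nS mG; have GSM := ae_preimage nS GM.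
split.
- by under eq_fun do rewrite mulrC; exact: cintegrable_bounded iF mG GM.
- exact: cmeasurableM.
- exists (N * M); apply: filterS2 bPhi GSM => x PN GS.
  by rewrite Normc.normcM ler_pM ?normc_ge0.
- move=> psi M' mpsi psiM'.
  have := FE (fun x => G x * psi x) (M * M') (cmeasurableM mG mpsi).
  have GpM : {ae m, forall x, normc (G x * psi x) <= M * M'}.
    apply: filterS2 GM psiM' => x PN GS.
    by rewrite Normc.normcM ler_pM ?normc_ge0.
  move=> /(_ GpM) E.
  transitivity (cintegral (fun x => F x * (G x * psi x))).
    by congr cintegral; apply/funext => x; ring.
  by rewrite E; congr cintegral; apply/funext => x; ring.
Qed.

Lemma transportsD k Phi F Psi G : transports k Phi F -> transports k Psi G ->
  transports k (fun x => Phi x + Psi x) (fun x => F x + G x).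
Proof.
move=> [iF mPhi [M PhiM] FE] [iG mPsi [N PsiN] GE].
have nS := itT_nonsingular T_nonsingular k.
split.
- exact: cintegrableD.
- exact: cmeasurableD.
- exists (M + N); apply: filterS2 PhiM PsiN => x PM PN.
  by rewrite (le_trans (le_normcD _ _))// lerD.
- move=> psi M' mpsi psiM'.
  have pS := ae_preimage nS psiM'; have mpS := cmeasurable_comp nS mpsi.
  transitivity (cintegral (fun x => F x * psi x + G x * psi x)).
    by congr cintegral; apply/funext => x; rewrite mulrDl.
  rewrite cintegralD; try exact: cintegrable_bounded mpsi psiM'.
  rewrite (FE _ _ mpsi psiM') (GE _ _ mpsi psiM').
  rewrite -cintegralD; first last.
  + by apply: cintegrable_bounded mpS pS; exact: cintegrable_bounded v0i mPsi PsiN.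
  + by apply: cintegrable_bounded mpS pS; exact: cintegrable_bounded v0i mPhi PhiM.
  + by congr cintegral; apply/funext => x; ring.
Qed.

Lemma transports_integral k Phi F : transports k Phi F ->
  cintegral F = cintegral (fun x => v0 x * Phi x).
Proof.
move=> [_ _ _ /(_ (fun=> 1) 1 (cmeasurable_cst 1))].
have b : {ae m, forall x : X, normc (1 : R[i]) <= 1}.
  by apply: aeW => x; rewrite Normc.normc1.
move=> /(_ b).
have E h : (fun x => h x * (1 : R[i])) = h by apply/funext => x; rewrite mulr1.
by rewrite !E.
Qed.

End transported_densities.

Lemma transports_density {R : realType} {d : measure_display} {X : measurableType d}
    (m : probability X R) (T : nat -> X -> X) (L : nat -> (X -> R[i]) -> X -> R[i])
    (v : nat -> X -> R[i]) :
  (forall j, nonsingular m (T j)) -> (forall j, transfer_operator m (T j) (L j)) ->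
  (forall j, cintegrable m (v j)) ->
  (forall j, {ae m, forall x, L j (v j) x = v j.+1 x}) ->
  forall k, transports m T (v 0) k (fun=> 1) (v k).
Proof.
move=> TnS LT vi Lv; elim=> [|k IH]; first exact: (transports0 T (vi 0)).
apply: (transports_ae (vi _) (Lv k)).
exact: (transports_step TnS LT IH).
Qed.

(** * The characteristic function along one trajectory *)

Section product_of_small_steps.
Context {R : realType}.

Lemma expR_taylor1 (x : R) : `|expR x - 1 - x| <= expR `|x| * `|x| ^+ 2.
Proof.
have ex y : `|y| <= `|x| -> `|expR y - 1| <= expR `|x| * `|y|.
  move=> yx; have := @mean_value_bound _ expR expR y (expR `|x|) (fun z => is_derive_expR z).
  rewrite expR0; apply.
  move=> z zy; rewrite ger0_norm ?expR_ge0// ler_expR.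
  by rewrite (le_trans (ler_norm z))// (le_trans zy).
have d (y : R) : is_derive y (1 : R) (fun z : R => expR z - 1 - z) (expR y - 1).
  by apply: is_derive_eq; rewrite subr0.
have := @mean_value_bound _ _ _ x (expR `|x| * `|x|) d.
rewrite expR0 subrr subr0 subr0 expr2 mulrA; apply => y yx.
by rewrite (le_trans (ex _ yx))// ler_wpM2l// expR_ge0.
Qed.

(** Multiplying by the inverse of the expected product makes the errors of the
    single steps add up. *)
Lemma near_exp_product (lam : nat -> R[i]) (a : nat -> R) (A C t : R) (n : nat) :
  0 <= A -> 0 <= C -> 0 <= t <= 1 -> t ^+ 2 * n%:R <= 1 -> lam 0 = 1 ->
  (forall k, normc (lam k) <= 1) -> (forall k, `|a k| <= A) ->
  (forall k, normc (lam k.+1 - lam k + t%:C ^+ 2 * lam k * (a k)%:C) <= C * t ^+ 3) ->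
  normc (lam n - (expR (- (t ^+ 2 * \sum_(j < n) a j)))%:C) <=
  n%:R * t ^+ 3 * (expR A * expR A * (C + expR A * A ^+ 2)).
Proof.
move=> A0 C0 /andP[t0 t1] tn lam0 lam1 aA step.
pose S k := t ^+ 2 * \sum_(j < k) a j.
have SA k : (k <= n)%N -> `|S k| <= A.
  move=> kn; rewrite normrM ger0_norm ?exprn_ge0//.
  apply: (@le_trans _ _ (t ^+ 2 * (k%:R * A))).
    rewrite ler_wpM2l ?exprn_ge0// (le_trans (ler_norm_sum _ _ _))//.
    have -> : k%:R * A = \sum_(j < k) A by rewrite sumr_const card_ord mulr_natl.
    by apply: ler_sum => j _.
  rewrite mulrA -[leRHS]mul1r ler_wpM2r// (le_trans _ tn)// ler_wpM2l ?exprn_ge0//.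
  by rewrite ler_nat.
pose D := expR A * (C + expR A * A ^+ 2).
have D0 : 0 <= D by rewrite /D; nonneg.
pose nu k := lam k * (expR (S k))%:C.
have nuP k : (k <= n)%N -> normc (nu k - 1) <= k%:R * (t ^+ 3 * D).
  elim: k => [|k IH] kn.
    by rewrite /nu /S big_ord0 mulr0 expR0 lam0 mul1r subrr Normc.normc0 mul0r.
  have -> : nu k.+1 - 1 = (nu k - 1) + (nu k.+1 - nu k) by ring.
  rewrite -natr1 mulrDl mul1r (le_trans (le_normcD _ _))// lerD ?IH 1?ltnW//.
  pose x := - (t ^+ 2 * a k).
  have -> : nu k.+1 - nu k = (expR (S k.+1))%:C *
      ((lam k.+1 - lam k + t%:C ^+ 2 * lam k * (a k)%:C) -
       lam k * (expR x - 1 - x)%:C).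
    have -> : nu k = lam k * ((expR (S k.+1))%:C * (expR x)%:C).
      rewrite /nu -rmorphM /= -expRD; congr (_ * (expR _)%:C).
      by rewrite /S big_ord_recr /= /x; ring.
    rewrite /nu !rmorphB rmorph1 /x rmorphN rmorphM rmorphXn /=; ring.
  rewrite Normc.normcM normc_real ger0_norm ?expR_ge0//.
  rewrite (_ : t ^+ 3 * D = expR A * (C * t ^+ 3 + t ^+ 3 * (expR A * A ^+ 2))); last first.
    by rewrite /D; ring.
  rewrite ler_pM ?expR_ge0 ?normc_ge0//.
    by rewrite ler_expR (le_trans (ler_norm _))// SA.
  rewrite (le_trans (le_normcD _ _))// normcN lerD//.
  rewrite Normc.normcM normc_real -[leRHS]mul1r ler_pM ?normc_ge0//.
  apply: (le_trans (expR_taylor1 x)).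
  have xA : `|x| <= t ^+ 2 * A.
    by rewrite /x normrN normrM ger0_norm ?exprn_ge0// ler_wpM2l ?exprn_ge0.
  have xA' : `|x| <= A by rewrite (le_trans xA)// ler_piMl// exprn_ile1.
  rewrite [leRHS]mulrCA ler_pM ?expR_ge0 ?exprn_ge0//.
  - by rewrite ler_expR.
  - apply: (@le_trans _ _ ((t ^+ 2 * A) ^+ 2)).
      by rewrite lerXn2r ?nnegrE// mulr_ge0// exprn_ge0.
    rewrite exprMn ler_wpM2r ?exprn_ge0// -exprM.
    by rewrite (exprD t 3 1) ler_piMr// exprn_ge0.
have -> : lam n - (expR (- S n))%:C = (expR (- S n))%:C * (nu n - 1).
  by rewrite /nu mulrBr mulr1 mulrCA -rmorphM /= -expRD addNr expR0 mulr1.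
rewrite Normc.normcM normc_real ger0_norm ?expR_ge0//.
have -> : n%:R * t ^+ 3 * (expR A * expR A * (C + expR A * A ^+ 2)) =
  expR A * (n%:R * (t ^+ 3 * D)) by rewrite /D; ring.
rewrite ler_pM ?expR_ge0 ?normc_ge0 ?nuP//.
by rewrite ler_expR (le_trans (ler_norm _))// normrN SA.
Qed.

End product_of_small_steps.

Section one_trajectory.
Context {R : realType} {d : measure_display} {X : measurableType d}.
Variables (m : probability X R) (var : (X -> R[i]) -> \bar R) (n : nat).
Hypothesis V : is_variation m var n.
Variable Cv : R.
Hypothesis Cv1 : 1 <= Cv.
Hypothesis CvP : forall h, cintegrable m h ->
  (Loonorm m h <= Cv%:E * (L1norm m h + var h))%E.
Variables (T : nat -> X -> X) (L : nat -> (X -> R[i]) -> X -> R[i]).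
Hypothesis T_nonsingular : forall j, nonsingular m (T j).
Hypothesis L_transfer : forall j, transfer_operator m (T j) (L j).
Variables K q : R.
Hypotheses (K1 : 1 <= K) (q0 : 0 <= q) (q1 : q < 1).
Local Notation Bbound := (Bbound m var).
Local Notation cintegrable := (cintegrable m).
Local Notation cintegral := (cintegral m).
Local Notation decays := (decays m var L q).
Hypothesis L_bound : forall j c f, Bbound c f -> Bbound (K * c) (L j f).
Hypothesis L_decay : forall j k c f, Bbound c f -> cintegral f = 0 ->
  Bbound (K * q ^+ k * c) (itL L k j f).
Variables (v u : nat -> X -> R) (Vb U E : R).
Local Notation vc j := (of_real (v j)).
Local Notation uc j := (of_real (u j)).
Hypothesis v_ge0 : forall x, 0 <= v 0 x.
Hypothesis vB : forall j, Bbound Vb (vc j).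
Hypothesis v1 : forall j, cintegral (vc j) = 1.
Hypothesis Lv : forall j, {ae m, forall x, L j (vc j) x = vc j.+1 x}.
Hypothesis uB : forall j, Bbound U (uc j).
Hypothesis uv0 : forall j, cintegral (fun x => uc j x * vc j x) = 0.
Hypothesis expi1B : forall j (t : R), 0 <= t <= 1 ->
  Bbound (E * t) (fun x => expi1 (t * u j x)).
Hypothesis expi2B : forall j (t : R), 0 <= t <= 1 ->
  Bbound (E * t ^+ 2) (fun x => expi2 (t * u j x)).

Local Notation B := (3 * Cv).

Let K0 : 0 <= K. Proof. exact: le_trans K1. Qed.
Let B0 : 0 <= B. Proof. by rewrite mulr_ge0// (le_trans _ Cv1). Qed.
Let Vb0 : 0 <= Vb. Proof. exact: (Bbound_ge0 V (vB 0)). Qed.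
Let U0 : 0 <= U. Proof. exact: (Bbound_ge0 V (uB 0)). Qed.
Let E0 : 0 <= E.
Proof.
by have := Bbound_ge0 V (expi1B 0 (t := 1) _); rewrite mulr1; apply; rewrite lexx ler01.
Qed.
Let q1' : 0 < 1 - q. Proof. by rewrite subr_gt0. Qed.

Let mu_ j : measurable_fun [set: X] (u j).
Proof. exact: (cintegrable_measurable (uB j).1).1. Qed.

Let u_bounded j : {ae m, forall x, `|u j x| <= Cv * U}.
Proof.
apply: filterS (Loonorm_ae (Bbound_Loo Cv1 CvP (uB j))) => x.
by rewrite /of_real normc_real.
Qed.

Let uc_bounded j : {ae m, forall x, normc (uc j x) <= Cv * U}.
Proof. by apply: filterS (u_bounded j) => x; rewrite normc_real. Qed.

Fixpoint bsum (k : nat) (x : X) : R :=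
  if k is k'.+1 then bsum k' x + u k' (itT T k' x) else 0.

(** The density of the [k]-th image of [bsum k * v 0 * m]. *)
Fixpoint drift (k : nat) : X -> R[i] :=
  if k is k'.+1 then L k' (fun x => drift k' x + uc k' x * vc k' x)
  else fun=> 0.

(** The density of the [k]-th image of [expi (t * bsum k) * v 0 * m]. *)
Fixpoint twisted (t : R) (k : nat) : X -> R[i] :=
  if k is k'.+1 then L k' (fun x => expi (t * u k' x) * twisted t k' x)
  else vc 0.

Definition charf t k := cintegral (twisted t k).

(** Half the increment of the second moment of [bsum]: half the variance of
    [u k] and its covariance with the past. *)
Definition halfvar_incr k :=
  cintegral (fun x => vc k x * (uc k x * uc k x)) / 2 +
  cintegral (fun x => drift k x * uc k x).

Let transports_v k : transports m T (vc 0) k (fun=> 1) (vc k).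
Proof.
exact: (transports_density T_nonsingular L_transfer (fun j => (vB j).1) Lv).
Qed.

Let mexpi j (t : R) : cmeasurable (fun x => expi (t * u j x)).
Proof. by apply: cmeasurable_expi; exact: measurable_funM. Qed.

Lemma transports_twisted t k :
  transports m T (vc 0) k (fun x => expi (t * bsum k x)) (twisted t k).
Proof.
elim: k => [|k IH] /=.
  under eq_fun do rewrite mulr0 expi0.
  exact: (transports0 T (vB 0).1).
apply: (transports_step T_nonsingular L_transfer).
under eq_fun do rewrite mulrDr expiD.
apply: (transports_mul T_nonsingular (mexpi k t) (M := 1)) => //.
by apply: aeW => x; rewrite normc_expi.
Qed.

Lemma transports_drift k : transports m T (vc 0) k (fun x => (bsum k x)%:C) (drift k).
Proof.
elim: k => [|k IH] /=.
  split; [exact: cintegrable0|exact: cmeasurable_cst| |].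
    by exists 0; apply: aeW => x; rewrite normc_real normr0.
  move=> psi M _ _; congr cintegral; apply/funext => x.
  by rewrite mul0r mulr0 mul0r.
apply: (transports_step T_nonsingular L_transfer).
under eq_fun do rewrite rmorphD /= -[X in _ + X]mul1r.
apply: (transportsD T_nonsingular (vB 0).1 IH).
exact: (transports_mul T_nonsingular (cintegrable_measurable (uB k).1)
  (uc_bounded k) (transports_v k)).
Qed.

(** Expanding the square of [bsum l + u l] and transporting each term along the
    first [l] maps. Only this identity connects the exponent in the limit of
    [charf] with the asymptotic covariance. *)
Lemma sum_halfvar_incr k :
  \sum_(j < k) halfvar_incr j =
  ((\int[m]_x (v 0 x * bsum k x ^+ 2)) / 2)%:C.
Proof.
pose sc k x := (bsum k x)%:C.
have toC l : cintegral (fun x => vc 0 x * (sc l x * sc l x)) =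
    (\int[m]_x (v 0 x * bsum l x ^+ 2))%:C.
  rewrite /Defs.cintegral; congr (_ +i* _).
    by apply: eq_Rintegral => x _; rewrite !ReM /= !mulr0 !mul0r !subr0 expr2.
  rewrite -[RHS](mul0r (fine (m [set: X]))) -Rintegral_cst//.
  by apply: eq_Rintegral => x _; rewrite !ImM /= !(mulr0, mul0r, addr0).
have step l : cintegral (fun x => vc 0 x * (sc l.+1 x * sc l.+1 x)) =
    cintegral (fun x => vc 0 x * (sc l x * sc l x)) + 2 * halfvar_incr l.
  have nS := itT_nonsingular T_nonsingular l.
  have [_ ms [M sM] driftE] := transports_drift l.
  have [_ _ _ vE] := transports_v l.
  have muc := cintegrable_measurable (uB l).1.
  have ub := uc_bounded l.
  have u2b : {ae m, forall x, normc (uc l x * uc l x) <= Cv * U * (Cv * U)}.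
    by apply: filterS ub => x ux; rewrite Normc.normcM ler_pM ?normc_ge0.
  have i0 := (vB 0).1.
  have mS := cmeasurable_comp nS muc; have bS := ae_preimage nS ub.
  have ss : cintegrable (fun x => vc 0 x * sc l x * sc l x).
    exact: (cintegrable_bounded (cintegrable_bounded i0 ms sM) ms sM).
  have su : cintegrable (fun x => vc 0 x * sc l x * uc l (itT T l x)).
    exact: (cintegrable_bounded (cintegrable_bounded i0 ms sM) mS bS).
  have uu : cintegrable (fun x => vc 0 x * uc l (itT T l x) * uc l (itT T l x)).
    exact: (cintegrable_bounded (cintegrable_bounded i0 mS bS) mS bS).
  rewrite /halfvar_incr (driftE _ _ muc ub) (vE _ _ (cmeasurableM muc muc) u2b).
  rewrite mulrDr mulrCA mulfV ?mulr1; last by rewrite pnatr_eq0.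
  rewrite -cintegralZ// [X in _ + (X + _)](_ : _ = cintegral
    (fun x => vc 0 x * uc l (itT T l x) * uc l (itT T l x))); last first.
    by congr cintegral; apply/funext => x; rewrite mulr1 mulrA.
  rewrite [X in X + _](_ : _ = cintegral (fun x => vc 0 x * sc l x * sc l x)); last first.
    by congr cintegral; apply/funext => x; rewrite mulrA.
  have su2 := cintegrableZ 2 su.
  rewrite -!cintegralD//; last exact: (cintegrableD uu su2).
  congr cintegral; apply/funext => x; rewrite /sc /of_real /= !rmorphD /=; ring.
elim: k => [|k IH].
  rewrite big_ord0; have := toC 0; under eq_fun do rewrite /sc /= mulr0 mulr0.
  by rewrite /Defs.cintegral /= Rintegral_cst// mul0r => -[<-]; rewrite mul0r.
have /eqP := step k; rewrite !toC addrC -subr_eq => /eqP.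
rewrite big_ord_recr /= IH => e; apply: (@mulfI _ 2); first by rewrite pnatr_eq0.
rewrite mulrDr -e -!rmorphB -[2](rmorphMn (real_complex R) 2 1) -!rmorphM -!rmorphD /=.
by congr (_%:C); field.
Qed.

Lemma normc_charf_le1 t k : normc (charf t k) <= 1.
Proof.
rewrite /charf (transports_integral (transports_twisted t k)).
have [_ mPhi _ _] := transports_twisted t k.
have bPhi : {ae m, forall x, normc (expi (t * bsum k x)) <= 1}.
  by apply: aeW => x; rewrite normc_expi.
apply: (le_trans (normc_cintegral (cintegrable_bounded (vB 0).1 mPhi bPhi))).
under eq_Rintegral do rewrite Normc.normcM normc_expi mulr1 normc_real ger0_norm//.
by have := v1 0; rewrite /Defs.cintegral /= => -[->].
Qed.

Let uvB j : Bbound (B * U * Vb) (fun x => uc j x * vc j x).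
Proof. exact: (BboundM V Cv1 CvP). Qed.

Let twisted_int t k : cintegrable (twisted t k).
Proof. by have [] := transports_twisted t k. Qed.

Let drift_int k : cintegrable (drift k).
Proof. by have [] := transports_drift k. Qed.

Lemma cintegral_drift k : cintegral (drift k) = 0.
Proof.
elim: k => [|k IH] /=; first by rewrite /Defs.cintegral /= Rintegral_cst// mul0r.
rewrite (transfer_integral (L_transfer k)); last exact: cintegrableD (uvB k).1.
by rewrite cintegralD ?IH ?uv0 ?addr0//; exact: (uvB k).1.
Qed.

(** As [u j] is centered, [drift] is driven by functions of mean zero; the
    correlations with the past therefore stay bounded. *)
Lemma drift_decays : exists2 W, 0 <= W & forall j, decays j W (drift j).
Proof.
pose e := K * (B * U * Vb); pose W := K * e / (1 - q).
have W0 : 0 <= W by rewrite /W /e; nonneg.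
exists W => //; apply: (decays_seq V T_nonsingular L_transfer q0 L_decay
  (e := e) (g := fun j => L j (fun x => uc j x * vc j x))) => //.
- by rewrite -subr_ge0 (_ : _ - _ = 0)// /W; field; rewrite gt_eqF.
- exact: (decays0 V K1 q0 L_decay).
- by move=> j _; exact: L_bound.
- by move=> j; rewrite (transfer_integral (L_transfer j) (uvB j).1).
- by move=> j; exact: (transferD (L_transfer j) (T_nonsingular j) _ (uvB j).1).
Qed.

(** Subtracting from [L k h] the multiple of the invariant density with the same
    integral leaves a function of mean zero. *)
Definition centered_image k h x : R[i] := L k h x - cintegral h * vc k.+1 x.

Let cintegral_centered k h : cintegrable h -> cintegral (centered_image k h) = 0.
Proof.
move=> hi; rewrite /centered_image cintegralB; last first.
- by apply: cintegrableZ; exact: (vB k.+1).1.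
- exact: (transfer_integrable (L_transfer k) hi).
rewrite (transfer_integral (L_transfer k) hi) cintegralZ ?v1 ?mulr1 ?subrr//.
exact: (vB k.+1).1.
Qed.

Let centered_imageB k c h : Bbound c h -> Bbound ((K + Vb) * c) (centered_image k h).
Proof.
move=> hc; have c0 := Bbound_ge0 V hc.
rewrite mulrDl; apply: (BboundB V); first exact: L_bound.
apply: Bbound_le (BboundZ V (cintegral h) (vB k.+1)).
by rewrite mulrC ler_wpM2l//; exact: (Bbound_cintegral V hc).
Qed.

Let L_sub3 k (a b : R[i]) f g h : cintegrable f -> cintegrable g -> cintegrable h ->
  {ae m, forall x, L k (fun y => f y - a * g y - b * h y) x =
    L k f x - a * L k g x - b * L k h x}.
Proof.
move=> fi gi hi; have tr := (L_transfer k, T_nonsingular k).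
have agi := cintegrableZ a gi; have bhi := cintegrableZ b hi.
have e1 := transferB tr.1 tr.2 (cintegrableB fi agi) bhi.
have e2 := transferB tr.1 tr.2 fi agi.
have e3 := transferZ tr.1 tr.2 a gi; have e4 := transferZ tr.1 tr.2 b hi.
have e5 : {ae m, forall x, L k (fun y => f y - a * g y - b * h y) x =
    L k f x - L k (fun y => a * g y) x - b * L k h x}.
  by apply: filterS3 e1 e2 e4 => x -> -> ->.
by apply: filterS2 e5 e3 => x -> ->.
Qed.

Let expi1_bounded t k : {ae m, forall x, normc (expi1 (t * u k x)) <= 2}.
Proof.
apply: aeW => x; rewrite (le_trans (le_normcD _ _))// normcN normc_expi.
by rewrite Normc.normc1.
Qed.

Let mexpi1 t k : cmeasurable (fun x => expi1 (t * u k x)).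
Proof. by apply: cmeasurableB; [exact: mexpi|exact: cmeasurable_cst]. Qed.

(** The effect on [twisted] of the factor [expi (t * u k)]. *)
Definition kick t k x : R[i] := expi1 (t * u k x) * twisted t k x.

Let kick_int t k : cintegrable (kick t k).
Proof.
rewrite /kick; under eq_fun do rewrite mulrC.
exact: (cintegrable_bounded (twisted_int t k) (mexpi1 t k) (expi1_bounded t k)).
Qed.

Let expi_twisted t k :
  (fun x => expi (t * u k x) * twisted t k x) = (fun x => twisted t k x + kick t k x).
Proof. by apply/funext => x; rewrite /kick /expi1 mulrBl mul1r addrC subrK. Qed.

Let expi_twisted_int t k : cintegrable (fun x => expi (t * u k x) * twisted t k x).
Proof. by rewrite expi_twisted; exact: cintegrableD. Qed.

Lemma charf_increment t k : charf t k.+1 - charf t k = cintegral (kick t k).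
Proof.
rewrite /charf /= (transfer_integral (L_transfer k))// expi_twisted cintegralD//.
by rewrite addrC addKr.
Qed.

(** The deviations of [twisted] from its approximations of order zero and one in
    [t]. Both have mean zero, hence obey a contracting recursion. *)
Definition rem1 t k x := twisted t k x - charf t k * vc k x.

Definition rem2 t k x := rem1 t k x - 'i * t%:C * charf t k * drift k x.

Let rem1_int t k : cintegrable (rem1 t k).
Proof. by apply: cintegrableB => //; apply: cintegrableZ; exact: (vB k).1. Qed.

Let rem2_int t k : cintegrable (rem2 t k).
Proof. by apply: cintegrableB => //; exact: cintegrableZ. Qed.

Let rem1_step t k : {ae m, forall x, rem1 t k.+1 x =
  L k (rem1 t k) x + centered_image k (kick t k) x}.
Proof.
have := transferD (L_transfer k) (T_nonsingular k) (rem1_int t k) (kick_int t k).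
have -> : (fun y => rem1 t k y + kick t k y) = (fun y =>
    expi (t * u k y) * twisted t k y - charf t k * vc k y - 0 * vc k y).
  by apply/funext => y; rewrite /rem1 (congr1 (fun h => h y) (expi_twisted t k)) /=; ring.
have := L_sub3 k (charf t k) 0 (expi_twisted_int t k) (vB k).1 (vB k).1.
apply: filterS3 (Lv k) => x e1 e2; rewrite e2 e1 => e3.
by rewrite /centered_image addrA -e3 -charf_increment /rem1 /=; ring.
Qed.

(** The part of [kick] that [rem2] does not account for; its terms of first order
    in [t] cancel, see [kick2E]. *)
Definition kick2 t k x := kick t k x -
  'i * t%:C * charf t k.+1 * (drift k x + uc k x * vc k x) +
  'i * t%:C * charf t k * drift k x.

Let kick2_int t k : cintegrable (kick2 t k).
Proof.
apply: cintegrableD; last exact: cintegrableZ.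
by apply: cintegrableB => //; apply: cintegrableZ; exact: cintegrableD (uvB k).1.
Qed.

Let cintegral_kick2 t k : cintegral (kick2 t k) = cintegral (kick t k).
Proof.
have duv : cintegrable (fun x => drift k x + uc k x * vc k x).
  exact: cintegrableD (uvB k).1.
have aduv := cintegrableZ ('i * t%:C * charf t k.+1) duv.
have bd := cintegrableZ ('i * t%:C * charf t k) (drift_int k).
rewrite /kick2 cintegralD//; last exact: (cintegrableB (kick_int t k) aduv).
rewrite cintegralB// !cintegralZ// cintegralD//; last exact: (uvB k).1.
by rewrite uv0 cintegral_drift; ring.
Qed.

Let rem2_step t k : {ae m, forall x, rem2 t k.+1 x =
  L k (rem2 t k) x + centered_image k (kick2 t k) x}.
Proof.
have duv : cintegrable (fun x => drift k x + uc k x * vc k x).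
  exact: cintegrableD (uvB k).1.
have := transferD (L_transfer k) (T_nonsingular k) (rem2_int t k) (kick2_int t k).
have -> : (fun y => rem2 t k y + kick2 t k y) = (fun y =>
    expi (t * u k y) * twisted t k y - charf t k * vc k y -
    'i * t%:C * charf t k.+1 * (drift k y + uc k y * vc k y)).
  apply/funext => y; rewrite /rem2 /rem1 /kick2.
  by rewrite (congr1 (fun h => h y) (expi_twisted t k)) /=; ring.
have := L_sub3 k (charf t k) ('i * t%:C * charf t k.+1) (expi_twisted_int t k)
  (vB k).1 duv.
apply: filterS3 (Lv k) => x e1 e2; rewrite e2 e1 => e3.
by rewrite /centered_image addrA -e3 cintegral_kick2 -charf_increment /rem2 /rem1 /=; ring.
Qed.

Let charf_vcB t k : Bbound Vb (fun x => charf t k * vc k x).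
Proof.
apply: Bbound_le (BboundZ V (charf t k) (vB k)).
by rewrite -[leRHS]mul1r ler_wpM2r// normc_charf_le1.
Qed.

Let kickB (t : R) k rho : 0 <= t <= 1 -> Bbound rho (rem1 t k) ->
  Bbound (B * (E * t) * (Vb + rho)) (kick t k).
Proof.
move=> t01 r1; apply: (BboundM V Cv1 CvP); first exact: expi1B.
have := BboundD V (charf_vcB t k) r1.
by congr Bbound; apply/funext => x; rewrite /rem1 addrC subrK.
Qed.

(** The defect in the recursion of [rem1] is [O(t)] and contains [rem1] itself
    with a factor [O(t)], so that the recursion contracts for small [t]. *)
Lemma rem1_decays : exists rho t0 : R, [/\ 0 <= rho, 0 < t0 <= 1 &
  forall t, 0 <= t <= t0 -> forall k, decays k (rho * t) (rem1 t k)].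
Proof.
pose G := K * (K + Vb) * B * E; pose rho := 2 * G * Vb / (1 - q).
have G0 : 0 <= G by rewrite /G; nonneg.
have rho0 : 0 <= rho by rewrite /rho; nonneg.
(* this threshold makes the feedback of the remainder on itself smaller than
   half of the contraction gap *)
pose t0 := (1 - q) / (2 * G + 1).
have d0 : 0 < 2 * G + 1 by rewrite ltr_wpDl// mulr_ge0.
have t00 : 0 < t0 by rewrite divr_gt0.
have t01 : t0 <= 1.
  rewrite ler_pdivrMr// mul1r; apply: (@le_trans _ _ 1).
    by rewrite lerBlDr lerDl.
  by rewrite lerDr mulr_ge0.
exists rho, t0; split=> //; first by rewrite t00.
move=> t /andP[t0' tt0] k; have t1 : 0 <= t <= 1 by rewrite t0' (le_trans tt0).
have Gt : 2 * G * t <= 1 - q.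
  apply: (@le_trans _ _ ((2 * G + 1) * t)).
    by rewrite [leRHS]mulrDl mul1r lerDl.
  by rewrite mulrC -ler_pdivlMr.
apply: (decays_seq V T_nonsingular L_transfer q0 L_decay
  (e := (K + Vb) * (B * (E * t) * (Vb + rho * t)))
  (g := fun j => centered_image j (kick t j))).
- rewrite -subr_ge0.
  have -> : rho * t - (q * (rho * t) + K * ((K + Vb) * (B * (E * t) * (Vb + rho * t)))) =
      (1 - q) * rho * t - G * t * Vb - G * t * (rho * t) by rewrite /G; ring.
  have -> : (1 - q) * rho = 2 * G * Vb by rewrite /rho; field; rewrite gt_eqF.
  have -> : 2 * G * Vb * t - G * t * Vb - G * t * (rho * t) =
     (2 * G * Vb * t - 2 * G * t * (rho * t)) / 2 by field.
  rewrite divr_ge0// subr_ge0.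
  have -> : 2 * G * Vb * t = (1 - q) * (rho * t).
    by rewrite /rho; field; rewrite gt_eqF.
  by rewrite ler_wpM2r// mulr_ge0.
- have -> : rem1 t 0 = fun=> 0.
    by apply/funext => x; rewrite /rem1 /charf /= v1 mul1r subrr.
  by apply: (decays0 V K1 q0 L_decay); rewrite mulr_ge0.
- exact: rem1_int.
- by move=> j /decays_Bbound r1; exact: (centered_imageB j (kickB t1 r1)).
- by move=> j; exact: cintegral_centered.
- exact: rem1_step.
Qed.

Let kick2E t k x : kick2 t k x =
  charf t k * (expi2 (t * u k x) * vc k x) + expi1 (t * u k x) * rem1 t k x -
  'i * t%:C * cintegral (kick t k) * (drift k x + uc k x * vc k x).
Proof.
rewrite /kick2 -charf_increment /kick /rem1 /expi2 /of_real rmorphM /=; ring.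
Qed.

Let normc_i (t : R) : 0 <= t -> normc ('i * t%:C) = t.
Proof.
by move=> t0; rewrite Normc.normcM normc_real ger0_norm//= expr0n expr1n add0r sqrtr1 mul1r.
Qed.

Lemma rem2_decays : exists rho t0 : R, [/\ 0 <= rho, 0 < t0 <= 1 &
  forall t, 0 <= t <= t0 -> forall k, decays k (rho * t ^+ 2) (rem2 t k)].
Proof.
have [r1 [t0 [r10 /andP[t00 t01] r1P]]] := rem1_decays.
have [W W0 WP] := drift_decays.
pose D := B * E * (Vb + r1).
pose c := B * E * Vb + B * E * r1 + D * (W + B * U * Vb).
have D0 : 0 <= D by rewrite /D; nonneg.
have c0 : 0 <= c by rewrite /c; nonneg.
pose rho := K * (K + Vb) * c / (1 - q).
have rho0 : 0 <= rho by rewrite /rho; nonneg.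
exists rho, t0; split=> //; first by rewrite t00.
move=> t tt0 k; have /andP[t0' tt0'] := tt0.
have t1 : t <= 1 by exact: le_trans t01.
have t01' : 0 <= t <= 1 by rewrite t0'.
have kick2B j : Bbound (c * t ^+ 2) (kick2 t j).
  have r1j := decays_Bbound (r1P t tt0 j).
  have kB := kickB t01' r1j.
  have b1 := BboundZ V (charf t j) (BboundM V Cv1 CvP (expi2B j t01') (vB j)).
  have b2 := BboundM V Cv1 CvP (expi1B j t01') r1j.
  have b3 := BboundZ V ('i * t%:C * cintegral (kick t j))
    (BboundD V (decays_Bbound (WP j)) (uvB j)).
  have := BboundB V (BboundD V b1 b2) b3.
  have -> : (fun x => charf t j * (expi2 (t * u j x) * vc j x) +
      expi1 (t * u j x) * rem1 t j x - 'i * t%:C * cintegral (kick t j) *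
      (drift j x + uc j x * vc j x)) = kick2 t j.
    by apply/funext => x; rewrite kick2E.
  apply: Bbound_le.
  have -> : c * t ^+ 2 = B * E * Vb * t ^+ 2 + B * E * r1 * t ^+ 2 +
     t * (D * t) * (W + B * U * Vb) by rewrite /c; ring.
  rewrite !lerD//.
  - apply: (@le_trans _ _ (1 * (B * (E * t ^+ 2) * Vb))).
      by rewrite ler_wpM2r ?normc_charf_le1//; nonneg.
    by have -> : 1 * (B * (E * t ^+ 2) * Vb) = B * E * Vb * t ^+ 2 by ring.
  - by have -> : B * (E * t) * (r1 * t) = B * E * r1 * t ^+ 2 by ring.
  - rewrite ler_wpM2r//; first by nonneg.
    rewrite Normc.normcM normc_i// ler_wpM2l//.
    apply: (le_trans (Bbound_cintegral V kB)).
    have -> : B * (E * t) * (Vb + r1 * t) = B * E * t * (Vb + r1 * t) by ring.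
    have -> : D * t = B * E * t * (Vb + r1) by rewrite /D; ring.
    rewrite ler_wpM2l//; first by nonneg.
    by rewrite lerD2l ler_piMr.
apply: (decays_seq V T_nonsingular L_transfer q0 L_decay
  (e := (K + Vb) * (c * t ^+ 2)) (g := fun j => centered_image j (kick2 t j))).
- rewrite -subr_ge0 (_ : _ - _ = 0)//.
  by rewrite /rho; field; rewrite gt_eqF.
- have -> : rem2 t 0 = fun=> 0.
    by apply/funext => x; rewrite /rem2 /rem1 /charf /= v1 mul1r subrr mulr0 subr0.
  by apply: (decays0 V K1 q0 L_decay); nonneg.
- exact: rem2_int.
- by move=> j _; exact: (centered_imageB j (kick2B j)).
- by move=> j; exact: cintegral_centered.
- exact: rem2_step.
Qed.

Let kick_expand t k x : kick t k x =
  charf t k * (vc k x * (expi2 (t * u k x) + ((t * u k x) ^+ 2 / 2)%:C)) +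
  expi2 (t * u k x) * rem1 t k x + 'i * t%:C * (uc k x * rem2 t k x) +
  'i * t%:C * charf t k * (uc k x * vc k x) -
  t%:C ^+ 2 * charf t k * (vc k x * (uc k x * uc k x) / 2 + drift k x * uc k x).
Proof.
have tw : twisted t k x = charf t k * vc k x + rem1 t k x by rewrite /rem1; ring.
have r1 : rem1 t k x = rem2 t k x + 'i * t%:C * charf t k * drift k x.
  by rewrite /rem2 subrK.
have e1 : expi1 (t * u k x) = expi2 (t * u k x) + 'i * (t%:C * uc k x).
  by rewrite /expi2 /of_real -rmorphM subrK.
have h : ((t * u k x) ^+ 2 / 2)%:C = t%:C ^+ 2 * (uc k x * uc k x) / 2 :> R[i].
  by rewrite /of_real !rmorphM fmorphV rmorph_nat /=; ring.
have alg (z eta l y w a b tt : R[i]) : z * z = -1 ->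
    (eta + z * (tt * a)) * (l * y + (b + z * tt * l * w)) =
    l * (y * (eta + tt ^+ 2 * (a * a) / 2)) + eta * (b + z * tt * l * w) +
    z * tt * (a * b) + z * tt * l * (a * y) - tt ^+ 2 * l * (y * (a * a) / 2 + w * a).
  move=> zz; apply/eqP; rewrite -subr_eq0; apply/eqP.
  transitivity ((z * z + 1) * tt ^+ 2 * l * a * w); first by field.
  by rewrite zz addNr !mul0r.
by rewrite /kick tw e1 h r1; apply: alg; rewrite -expr2 sqr_i.
Qed.

Let half_real : (2 : R[i])^-1 = (2^-1 : R)%:C.
Proof. by rewrite fmorphV rmorph_nat. Qed.

(** Integrating [kick_expand]: the term of first order in [t] vanishes because
    [u k] is centered, and the terms with a remainder are [O(t ^ 3)]. *)
Lemma charf_step : exists C t0 : R, [/\ 0 <= C, 0 < t0 <= 1 &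
  forall t, 0 <= t <= t0 -> forall k,
  normc (charf t k.+1 - charf t k + t%:C ^+ 2 * charf t k * halfvar_incr k) <=
  C * t ^+ 3].
Proof.
have [r1 [ta [r10 /andP[ta0 ta1] r1P]]] := rem1_decays.
have [r2 [tb [r20 /andP[tb0 tb1] r2P]]] := rem2_decays.
have Cv0 : 0 <= Cv by exact: le_trans Cv1.
pose M3 := 2 * (Cv * U) ^+ 3 * Vb.
have M30 : 0 <= M3 by rewrite /M3; nonneg.
exists (M3 + B * E * r1 + B * U * r2), (Num.min ta tb); split.
- by nonneg.
- by rewrite lt_min ta0 tb0 ge_min ta1.
move=> t /andP[t0]; rewrite le_min => /andP[tta ttb] k.
have r1k := decays_Bbound (r1P t (introT andP (conj t0 tta)) k).
have r2k := decays_Bbound (r2P t (introT andP (conj t0 ttb)) k).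
have t01 : 0 <= t <= 1 by rewrite t0 (le_trans tta).
have e2r1 := BboundM V Cv1 CvP (expi2B k t01) r1k.
have ur2 := BboundM V Cv1 CvP (uB k) r2k.
have uuB := BboundM V Cv1 CvP (uB k) (uB k).
have vuu := BboundM V Cv1 CvP (vB k) uuB.
have mk : cmeasurable (fun x => expi2 (t * u k x) + ((t * u k x) ^+ 2 / 2)%:C).
  apply: cmeasurableD; first exact: (cintegrable_measurable (expi2B k t01).1).
  apply: (cmeasurable_real (u := fun x => (t * u k x) ^+ 2 / 2)).
  by apply: measurable_funM => //; apply: measurable_funX; exact: measurable_funM.
have bk : {ae m, forall x, normc (expi2 (t * u k x) + ((t * u k x) ^+ 2 / 2)%:C) <=
    2 * (Cv * U) ^+ 3 * t ^+ 3}.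
  apply: filterS (u_bounded k) => x ux; apply: (le_trans (normc_expi3 _)).
  rewrite -mulrA ler_wpM2l// normrM exprMn mulrC (ger0_norm t0) ler_wpM2r ?exprn_ge0//.
  by rewrite lerXn2r ?nnegrE ?mulr_ge0.
have ik := cintegrable_bounded (vB k).1 mk bk.
have nk : normc (cintegral (fun x => vc k x *
    (expi2 (t * u k x) + ((t * u k x) ^+ 2 / 2)%:C))) <= M3 * t ^+ 3.
  apply: (le_trans (normc_cintegral ik)).
  apply: (@le_trans _ _ (\int[m]_x (2 * (Cv * U) ^+ 3 * t ^+ 3 * normc (vc k x)))).
    apply: (ae_le_L1norm (cintegrable_measurable ik)).
      exact/integrable_mull/integrable_normc/(vB k).1.
    apply: filterS bk => x bkx; rewrite Normc.normcM [leRHS]mulrC.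
    by rewrite ler_wpM2l// normc_ge0.
  rewrite RintegralZl//; last exact/integrable_normc/(vB k).1.
  rewrite (_ : M3 * t ^+ 3 = 2 * (Cv * U) ^+ 3 * t ^+ 3 * Vb); last by rewrite /M3; ring.
  rewrite ler_wpM2l//; first by nonneg.
  exact: (Bbound_L1 V (vB k)).
have du : cintegrable (fun x => drift k x * uc k x).
  exact: (cintegrable_bounded (drift_int k) (cintegrable_measurable (uB k).1)
    (uc_bounded k)).
have i1 := cintegrableZ (charf t k) ik.
have i2 := e2r1.1.
have i3 := cintegrableZ ('i * t%:C) ur2.1.
have i4 := cintegrableZ ('i * t%:C * charf t k) (uvB k).1.
have half5 : (fun x => vc k x * (uc k x * uc k x) / 2) =
    (fun x => 2^-1 * (vc k x * (uc k x * uc k x))).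
  by apply/funext => x; exact: mulrC.
have i5 : cintegrable (fun x => vc k x * (uc k x * uc k x) / 2).
  by rewrite half5; exact: (cintegrableZ 2^-1 vuu.1).
have i56 := cintegrableZ (t%:C ^+ 2 * charf t k) (cintegrableD i5 du).
have E5 : cintegral (fun x => vc k x * (uc k x * uc k x) / 2) =
    cintegral (fun x => vc k x * (uc k x * uc k x)) / 2.
  by rewrite half5 (cintegralZ 2^-1 vuu.1) mulrC.
rewrite charf_increment (funext (kick_expand t k)).
rewrite cintegralB//; last first.
  by apply: cintegrableD => //; apply: cintegrableD => //; exact: cintegrableD.
rewrite cintegralD//; last by apply: cintegrableD => //; exact: cintegrableD.
rewrite cintegralD//; last by exact: cintegrableD.
rewrite cintegralD// (cintegralZ _ ik) (cintegralZ _ ur2.1) (cintegralZ _ (uvB k).1).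
rewrite (cintegralZ _ (cintegrableD i5 du)).
rewrite cintegralD// E5 uv0 mulr0 addr0 subrK.
apply: (le_trans (le_normcD _ _)).
have -> : (M3 + B * E * r1 + B * U * r2) * t ^+ 3 =
  (M3 * t ^+ 3 + B * (E * t ^+ 2) * (r1 * t)) + t * (B * U * (r2 * t ^+ 2)) by ring.
apply: lerD; last first.
  rewrite Normc.normcM normc_i// ler_wpM2l//; exact: (Bbound_cintegral V ur2).
apply: (le_trans (le_normcD _ _)); apply: lerD; last exact: (Bbound_cintegral V e2r1).
rewrite Normc.normcM -[leRHS]mul1r ler_pM ?normc_ge0//; exact: normc_charf_le1.
Qed.

Lemma halfvar_incr_bounded : exists2 A, 0 <= A & forall k, normc (halfvar_incr k) <= A.
Proof.
have [W W0 WP] := drift_decays.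
exists (B * Vb * (B * U * U) / 2 + B * W * U); first by nonneg.
move=> k; rewrite /halfvar_incr (le_trans (le_normcD _ _))// lerD//.
  rewrite Normc.normcM half_real normc_real ger0_norm ?invr_ge0// ler_wpM2r ?invr_ge0//.
  exact: (Bbound_cintegral V (BboundM V Cv1 CvP (vB k) (BboundM V Cv1 CvP (uB k) (uB k)))).
exact: (Bbound_cintegral V (BboundM V Cv1 CvP (decays_Bbound (WP k)) (uB k))).
Qed.

Lemma halfvar_incr_real k : halfvar_incr k = (Re (halfvar_incr k))%:C.
Proof.
have := sum_halfvar_incr k.+1; rewrite big_ord_recr /= sum_halfvar_incr => e.
by apply/eqP; rewrite eq_complex /= eqxx /=; move/(congr1 (@complex.Im R)): e;
  rewrite ImD /= add0r => ->.
Qed.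

Lemma charf0 t : charf t 0 = 1. Proof. exact: v1. Qed.

(** For [t = 1 / sqrt k] one has [t ^ 2 * k = 1] and [k * t ^ 3 = t], so the
    exponent is half the normalized second moment and the accumulated error
    tends to zero. *)
Lemma charf_cvg (s2 : R) :
  k%:R^-1 * \int[m]_x (v 0 x * bsum k x ^+ 2) @[k --> \oo] --> s2 ->
  normc (charf (Num.sqrt k%:R)^-1 k - (expR (- (s2 / 2)))%:C) @[k --> \oo] --> (0 : R).
Proof.
move=> s2P; have [C [t0 [C0 /andP[t00 t01] step]]] := charf_step.
have [A A0 AP] := halfvar_incr_bounded.
pose M := expR A * expR A * (C + expR A * A ^+ 2).
pose x k := k%:R^-1 * \int[m]_x (v 0 x * bsum k x ^+ 2).
pose tau k : R := (Num.sqrt k%:R)^-1.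
have tau_cvg : tau k @[k --> \oo] --> (0 : R).
  have -> : tau = Num.sqrt \o (fun k => k%:R^-1).
    by apply/funext => k; rewrite /tau /= sqrtrV// ler0n.
  rewrite -[X in _ --> X](@sqrtr0 R); apply: continuous_cvg; first exact: sqrt_continuous.
  by rewrite gtr0_cvgV0; [exact: cvgr_idn|near=> k; rewrite ltr0n; near: k; exact: nbhs_infty_gt].
have ex : `|expR (- (x k / 2)) - expR (- (s2 / 2))| @[k --> \oo] --> (0 : R).
  rewrite -[X in _ --> X](@normr0 _ R); apply: cvg_norm.
  rewrite -(subrr (expR (- (s2 / 2)))); apply: cvgB; last exact: cvg_cst.
  apply: continuous_cvg; first exact: continuous_expR.
  by apply: cvgN; apply: cvgMl.
have ub : tau k * M + `|expR (- (x k / 2)) - expR (- (s2 / 2))| @[k --> \oo] --> (0 : R).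
  by rewrite -[X in _ --> X]addr0 -[X in _ --> X + _](mul0r M); apply: cvgD => //; apply: cvgMl.
apply: (squeeze_cvgr _ (cvg_cst 0) ub); near=> k.
rewrite normc_ge0 andTb.
have k0 : (0 < k)%N by near: k; exact: nbhs_infty_gt.
have kR0 : (0 : R) < k%:R by rewrite ltr0n.
have tau0 : 0 <= tau k by rewrite invr_ge0 sqrtr_ge0.
have taut0 : tau k <= t0.
  near: k; apply: (cvgr_le _ tau_cvg); exact: t00.
have tau2 : tau k ^+ 2 = k%:R^-1 by rewrite exprVn sqr_sqrtr// ler0n.
have tauk : tau k ^+ 2 * k%:R = 1 by rewrite tau2 mulVf// gt_eqF.
have t01' : 0 <= tau k <= 1 by rewrite tau0 (le_trans taut0).
have aA j : `|Re (halfvar_incr j)| <= A.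
  exact: le_trans (normRe_le _) (AP j).
have step' j : normc (charf (tau k) j.+1 - charf (tau k) j +
    (tau k)%:C ^+ 2 * charf (tau k) j * (Re (halfvar_incr j))%:C) <= C * tau k ^+ 3.
  by rewrite -halfvar_incr_real; apply: step; rewrite tau0.
have := near_exp_product A0 C0 t01' _ (charf0 _) (normc_charf_le1 _) aA step'.
move=> /(_ k); rewrite tauk lexx => /(_ isT).
have -> : tau k ^+ 2 * \sum_(j < k) Re (halfvar_incr j) = x k / 2.
  have -> : \sum_(j < k) Re (halfvar_incr j) = Re (\sum_(j < k) halfvar_incr j).
    by elim: (k) => [|l IH]; rewrite ?big_ord0// !big_ord_recr /= ReD IH.
  by rewrite sum_halfvar_incr tau2 mulrA.
have -> : k%:R * tau k ^+ 3 = tau k by rewrite exprS mulrCA [_ * tau k ^+ 2]mulrC tauk mulr1.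
move=> le1; rewrite -/(tau k).
have -> : charf (tau k) k - (expR (- (s2 / 2)))%:C =
    (charf (tau k) k - (expR (- (x k / 2)))%:C) +
    (expR (- (x k / 2)) - expR (- (s2 / 2)))%:C by rewrite rmorphB /=; ring.
rewrite (le_trans (le_normcD _ _))// lerD//.
by rewrite normc_real.
Unshelve. all: by end_near. Qed.

End one_trajectory.

(** * Measures with a density *)

Section density.
Context {R : realType} {d : measure_display} {X : measurableType d}.
Variables (m : {sigma_finite_measure set X -> \bar R}).
Variables (nu : {finite_measure set X -> \bar R}) (p : X -> R).
Hypothesis mp : measurable_fun [set: X] p.
Hypothesis p_ge0 : forall x, 0 <= p x.
Hypothesis nuE : forall A, measurable A -> (nu A = \int[m]_(x in A) (p x)%:E)%E.

Let pi : m.-integrable [set: X] (EFin \o p).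
Proof.
apply/integrableP; split; first exact/measurable_EFinP.
under eq_integral do rewrite gee0_abs ?lee_fin//=.
by rewrite -nuE// fin_num_fun_lty.
Qed.

Let nu_dominated : nu `<< m.
Proof.
apply/null_content_dominatesP => A mA A0; rewrite nuE//.
by apply: null_set_integral => //; apply: measurable_funTS; exact/measurable_EFinP.
Qed.

Let RN_ae : ae_eq m [set: X] (Radon_Nikodym_SigmaFinite.f nu m) (EFin \o p).
Proof.
apply: integral_ae_eq => //.
- exact: Radon_Nikodym_SigmaFinite.f_integrable.
- exact/measurable_EFinP.
- by move=> A AE mA; rewrite -Radon_Nikodym_SigmaFinite.f_integral// nuE.
Qed.

Lemma ge0_integral_density (f : X -> R) : measurable_fun [set: X] f ->
  (forall x, 0 <= f x) ->
  (\int[nu]_x (f x)%:E = \int[m]_x (f x * p x)%:E)%E.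
Proof.
move=> mf f0.
have mfE : measurable_fun [set: X] (EFin \o f) by exact/measurable_EFinP.
rewrite -(Radon_Nikodym_SigmaFinite.change_of_variables nu_dominated (f := EFin \o f))//.
apply: ae_eq_integral => //.
- apply: emeasurable_funM => //.
  exact: measurable_int (Radon_Nikodym_SigmaFinite.f_integrable nu_dominated).
- by apply/measurable_EFinP; exact: measurable_funM.
- by apply: filterS RN_ae => x /[apply] ->.
Qed.

Lemma integrable_density (f : X -> R) : measurable_fun [set: X] f ->
  nu.-integrable [set: X] (EFin \o f) <-> m.-integrable [set: X] (EFin \o (fun x => f x * p x)).
Proof.
move=> mf.
have E : (\int[nu]_x `|(EFin \o f) x| = \int[m]_x `|(EFin \o (fun x => f x * p x)%R) x|)%E.
  have -> : (\int[nu]_x `|(EFin \o f) x| = \int[nu]_x (`|f x|)%:E)%E by [].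
  rewrite ge0_integral_density//; last exact: measurableT_comp.
  by apply: eq_integral => x _; rewrite /= normrM (ger0_norm (p_ge0 x)).
have mfp : measurable_fun [set: X] (EFin \o (fun x => f x * p x)).
  by apply/measurable_EFinP; exact: measurable_funM.
have mf' : measurable_fun [set: X] (EFin \o f) by exact/measurable_EFinP.
split => /integrableP[_ i]; apply/integrableP; split => //; first by rewrite -E.
by rewrite E.
Qed.

Lemma Rintegral_density (f : X -> R) : nu.-integrable [set: X] (EFin \o f) ->
  \int[nu]_x f x = \int[m]_x (f x * p x).
Proof.
move=> fi.
have mf : measurable_fun [set: X] f by apply/measurable_EFinP; exact: measurable_int fi.
have m1 : measurable_fun [set: X] (f^\+)%R by exact: measurable_funrpos.
have m2 : measurable_fun [set: X] (f^\-)%R by exact: measurable_funrneg.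
have i1 : nu.-integrable [set: X] (EFin \o f^\+) by exact: integrable_funrpos.
have i2 : nu.-integrable [set: X] (EFin \o f^\-) by exact: integrable_funrneg.
have fE x : f x = f^\+ x - f^\- x by rewrite -[in LHS](funrposBneg f).
under eq_Rintegral do rewrite fE.
rewrite RintegralB// /Rintegral !ge0_integral_density//.
rewrite -/(Rintegral m setT (fun x => f^\+ x * p x)) -/(Rintegral m setT (fun x => f^\- x * p x)).
rewrite -RintegralB//; try by apply/integrable_density.
by apply: eq_Rintegral => x _; rewrite -mulrBl -fE.
Qed.

End density.

(** * The characteristic function of the normal law *)

Section improper_integral.
Context {R : realType}.
Local Notation leb := (@lebesgue_measure R).

Lemma integral_derive_vanishing (H h : R -> R) : (forall x : R, is_derive x (1:R) H (h x)) ->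
  continuous h -> leb.-integrable [set: R] (EFin \o h) ->
  H n%:R @[n --> \oo] --> (0 : R) -> H (- n%:R) @[n --> \oo] --> (0 : R) ->
  \int[leb]_x h x = 0.
Proof.
move=> dH ch ih Hn HNn.
have mh : measurable_fun [set: R] h by exact: continuous_measurable_fun.
have cH : continuous H.
  by move=> y; apply/differentiable_continuous/derivable1_diffP; have [] := dH y.
pose I n : set R := `[(- n%:R), n%:R]%classic.
pose f_ n (x : R) : \bar R := (h x * \1_(I n) x)%:E.
have f_le n x : (`|f_ n x| <= `|(h x)%:E|)%E.
  rewrite /f_ /= lee_fin normrM ler_piMr// ger0_norm ?indicE//.
  by rewrite lern1 leq_b1.
have mI n : measurable (I n) by exact: measurable_itv.
have intf n : (\int[leb]_x f_ n x = \int[leb]_(x in I n) (h x)%:E)%E.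
  rewrite [RHS]integral_mkcond; apply: eq_integral => x _.
  by rewrite /f_ patchE indicE; case: (x \in I n); rewrite ?mulr1 ?mulr0.
have FTC n : (\int[leb]_x f_ n.+1 x = (H n.+1%:R - H (- n.+1%:R))%:E)%E.
  rewrite intf EFinB; apply: continuous_FTC2.
  - by rewrite (@lt_le_trans _ _ 0)// oppr_lt0.
  - exact: continuous_subspaceT.
  - split.
    + by move=> y _; have [] := dH y.
    + by apply: cvg_at_right_filter; exact: cH.
    + by apply: cvg_at_left_filter; exact: cH.
  - by move=> y _; rewrite derive1E; have [_ ->] := dH y.
have mf n : measurable_fun [set: R] (f_ n).
  by apply/measurable_EFinP; apply: measurable_funM => //; exact: measurable_indic.
have mhE : measurable_fun [set: R] (EFin \o h) by exact/measurable_EFinP.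
have f_cvg : {ae leb, forall x, [set: R] x -> f_ ^~ x @ \oo --> (EFin \o h) x}.
  apply: aeW => x _; apply: cvg_near_cst; near=> n.
  rewrite /f_ /= indicE mem_set ?mulr1// /I /= in_itv /= -ler_norml.
  by near: n; exact: nbhs_infty_ger.
have f_dom : {ae leb, forall x n, [set: R] x -> (`|f_ n x| <= (abse \o (EFin \o h)) x)%E}.
  by apply: aeW => x n _; exact: f_le.
have c0 : (\int[leb]_x f_ n x)%E @[n --> \oo] --> 0%:E.
  rewrite -(cvg_shiftS (fun n => \int[leb]_x f_ n x)%E).
  under eq_fun do rewrite FTC.
  apply: cvg_EFin; first exact: nearW.
  rewrite -(subr0 0); apply: cvgB.
    by rewrite (cvg_shiftS (fun n => H n%:R)).
  by rewrite (cvg_shiftS (fun n => H (- n%:R))).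
have [_ _ c1] := @dominated_convergence _ _ _ leb setT measurableT f_ (EFin \o h)
  (abse \o (EFin \o h)) mf mhE f_cvg (integrable_abse ih) f_dom.
by rewrite /Rintegral (cvg_unique _ c1 c0).
Unshelve. all: by end_near. Qed.

End improper_integral.

Section quadratic_derivative.
Context {R : realType}.

(** An error bound quadratic in [h] survives integration, so that an integral can
    be differentiated in a parameter by integrating a Taylor estimate. *)
Lemma quadratic_is_derive (F : R -> R) (t D C : R) :
  (forall h, `|F (t + h) - F t - h * D| <= C * h ^+ 2) -> is_derive t (1 : R) F D.
Proof.
move=> FD.
have C0 : 0 <= C by have := FD 1; rewrite expr1n mulr1; apply: le_trans.
have cv : h^-1 *: (F (h *: 1 + t) - F t) @[h --> 0^'] --> D.
  apply/cvgrPdist_le => e e0; near=> h.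
  have h0 : h != 0 by near: h; exact: nbhs_dnbhs_neq.
  rewrite /GRing.scale /= mulr1 [h + t]addrC.
  have -> : D - h^-1 * (F (t + h) - F t) = - (h^-1 * (F (t + h) - F t - h * D)).
    by field.
  rewrite normrN normrM normfV ler_pdivrMl ?normr_gt0// (le_trans (FD h))//.
  rewrite -(real_normK (num_real h)) expr2 mulrA mulrC ler_wpM2l//.
  apply: (@le_trans _ _ (`|h| * (C + 1))); first by rewrite mulrC ler_wpM2l// lerDl.
  rewrite -ler_pdivlMr; last by rewrite ltr_wpDl.
  by near: h; apply: dnbhs0_le; rewrite divr_gt0// ltr_wpDl.
apply: DeriveDef; first by apply/cvg_ex; exists D.
by rewrite /derive; apply: cvg_lim.
Unshelve. all: by end_near. Qed.

End quadratic_derivative.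

Section normal_charf.
Context {R : realType}.
Variables (s c : R).
Hypothesis s0 : s != 0.
Local Notation leb := (@lebesgue_measure R).
Local Notation p := (normal_pdf 0 s).

Let pE x : p x = normal_peak s * expR (- x ^+ 2 / (s ^+ 2 *+ 2)).
Proof. by rewrite normal_pdfE// /normal_fun subr0. Qed.

Let p_derive (x : R) : is_derive x (1 : R) p (- (x / s ^+ 2) * p x).
Proof.
have d1 : is_derive x (1 : R) (fun y : R => - y ^+ 2 / (s ^+ 2 *+ 2)) (- (x / s ^+ 2)).
  apply: is_derive_eq.
  by rewrite /GRing.scale /=; field; rewrite s0.
have d2 := is_derive1_comp (is_derive_expR _) d1.
have -> : p = (fun y => normal_peak s * expR (- y ^+ 2 / (s ^+ 2 *+ 2))).
  by apply/funext => y; rewrite pE.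
apply: is_derive_eq.
by rewrite /GRing.scale /=; ring.
Qed.

Let p_ge0 (x : R) : 0 <= p x. Proof. exact: normal_pdf_ge0. Qed.

Let mp : measurable_fun [set: R] p. Proof. exact: measurable_normal_pdf. Qed.

Let k0 : 0 <= normal_peak s. Proof. exact: normal_peak_ge0. Qed.

(** One half of the exponent absorbs the square. *)
Let sqr_p_le (x : R) : x ^+ 2 * p x <=
  4 * s ^+ 2 * normal_peak s * expR (- (x ^+ 2 / (4 * s ^+ 2))).
Proof.
set y := x ^+ 2 / (4 * s ^+ 2).
have -> : p x = normal_peak s * (expR (- y) * expR (- y)).
  by rewrite pE -expRD; congr (_ * expR _); rewrite /y; field; rewrite s0.
have -> : x ^+ 2 = 4 * s ^+ 2 * y by rewrite /y; field; rewrite s0.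
have ye : y * expR (- y) <= 1.
  rewrite expRN -ler_pdivlMr ?invr_gt0 ?expR_gt0// invrK mul1r.
  by rewrite (le_trans _ (expR_ge1Dx y))// lerDr.
have -> : 4 * s ^+ 2 * y * (normal_peak s * (expR (- y) * expR (- y))) =
  4 * s ^+ 2 * normal_peak s * (y * expR (- y)) * expR (- y) by ring.
rewrite ler_wpM2r ?expR_ge0// ler_piMr//.
by rewrite mulr_ge0// mulr_ge0// sqr_ge0.
Qed.

Let ip : leb.-integrable [set: R] (EFin \o p).
Proof. exact: integrable_normal_pdf. Qed.

Let ix2p : leb.-integrable [set: R] (EFin \o (fun x => x ^+ 2 * p x)).
Proof.
pose s' := s * Num.sqrt 2.
have s'2 : s' ^+ 2 = 2 * s ^+ 2 by rewrite exprMn sqr_sqrtr// mulrC.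
have s'0 : s' != 0 by rewrite mulf_neq0// sqrtr_eq0 -ltNge.
have k'0 : 0 < normal_peak s' by exact: normal_peak_gt0.
pose C := 4 * s ^+ 2 * normal_peak s / normal_peak s'.
apply: (@ae_le_integrable _ _ _ leb _ (fun x => C * normal_pdf 0 s' x)).
- by apply: measurable_funM => //; exact: exprn_measurable.
- by apply: integrable_mull; exact: integrable_normal_pdf.
- apply: aeW => x; rewrite ger0_norm; last by rewrite mulr_ge0// sqr_ge0.
  apply: (le_trans (sqr_p_le x)); rewrite (normal_pdfE _ s'0) /normal_fun subr0 /C s'2.
  rewrite [leRHS]mulrA divfK ?gt_eqF//.
  rewrite (_ : - x ^+ 2 / (2 * s ^+ 2 *+ 2) = - (x ^+ 2 / (4 * s ^+ 2)))//.
  by field; rewrite s0.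
Qed.

Let ibp (f : R -> R) : measurable_fun [set: R] f -> (forall x, `|f x| <= 1 + x ^+ 2) ->
  leb.-integrable [set: R] (EFin \o (fun x => f x * p x)).
Proof.
move=> mf fb; apply: (@ae_le_integrable _ _ _ leb _ (fun x => p x + x ^+ 2 * p x)).
- exact: measurable_funM.
- exact: integrable_addr.
- apply: aeW => x; rewrite normrM (ger0_norm (p_ge0 x)).
  by rewrite -[X in _ <= X + _]mul1r -mulrDl ler_wpM2r.
Qed.

Let le1D (x a : R) : `|a| <= 1 -> `|a| <= 1 + x ^+ 2.
Proof. by move=> /le_trans; apply; rewrite lerDl sqr_ge0. Qed.

Let ler1D (x a : R) : `|a| <= 1 -> `|x * a| <= 1 + x ^+ 2.
Proof.
move=> a1; rewrite normrM (@le_trans _ _ `|x|)// ?ler_piMr//.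
rewrite -(real_normK (num_real x)); have [x1|/ltW x1] := leP `|x| 1.
  by rewrite (le_trans x1)// lerDl sqr_ge0.
by rewrite (@le_trans _ _ (`|x| ^+ 2)) ?lerDr// expr2 ler_peMr.
Qed.

Let mlin (t : R) : measurable_fun [set: R] (fun x => t * x + c).
Proof. by apply: measurable_funD => //; exact: measurable_funM. Qed.

Let mcos (t : R) : measurable_fun [set: R] (fun x => cos (t * x + c)).
Proof. exact: (cmeasurable_expi (mlin t)).1. Qed.

Let msin (t : R) : measurable_fun [set: R] (fun x => sin (t * x + c)).
Proof. exact: (cmeasurable_expi (mlin t)).2. Qed.

Let F (t : R) := \int[leb]_x (cos (t * x + c) * p x).
Let G (t : R) := \int[leb]_x (x * sin (t * x + c) * p x).

Let iF (t : R) : leb.-integrable [set: R] (EFin \o (fun x => cos (t * x + c) * p x)).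
Proof. by apply: ibp => // x; rewrite le1D// cos_max. Qed.

Let iG (t : R) : leb.-integrable [set: R] (EFin \o (fun x => x * sin (t * x + c) * p x)).
Proof.
apply: ibp => [|x]; first by apply: measurable_funM.
by rewrite ler1D// sin_max.
Qed.

Let cos_taylor (a b : R) : `|cos (a + b) - cos a + b * sin a| <= 2 * b ^+ 2.
Proof.
have -> : cos (a + b) - cos a + b * sin a = cos a * (cos b - 1) - sin a * (sin b - b).
  by rewrite cosD; ring.
rewrite (le_trans (ler_normB _ _))// !normrM mulr_natl mulr2n.
rewrite -(real_normK (num_real b)) lerD// -[leRHS]mul1r ler_pM//.
- exact: cos_max.
- exact: cos_sub1_le_sqr.
- exact: sin_max.
- exact: sin_sub_le_sqr.
Qed.

Let F_derive (t : R) : is_derive t (1 : R) F (- G t).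
Proof.
apply: (@quadratic_is_derive _ _ _ _ (2 * \int[leb]_x (x ^+ 2 * p x))) => h.
rewrite mulrN opprK.
have -> : h * G t = \int[leb]_x (h * (x * sin (t * x + c) * p x)).
  by rewrite RintegralZl//; exact: iG.
have -> : F (t + h) - F t =
    \int[leb]_x (cos ((t + h) * x + c) * p x - cos (t * x + c) * p x).
  by rewrite RintegralB//; exact: iF.
have iB : leb.-integrable [set: R] (EFin \o (fun x =>
    cos ((t + h) * x + c) * p x - cos (t * x + c) * p x)).
  have := integrableB measurableT (iF (t + h)) (iF t); exact.
have iZ := integrable_mull h (iG t).
rewrite -RintegralD//.
apply: (le_trans (le_normr_Rintegral _ _)) => //; first exact: integrable_addr.
rewrite mulrC mulrA -RintegralZl//.
apply: le_Rintegral => //.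
- by apply: integrable_norm; exact: integrable_addr.
- exact: integrable_mull.
move=> x _.
have -> : cos ((t + h) * x + c) * p x - cos (t * x + c) * p x +
    h * (x * sin (t * x + c) * p x) =
  (cos (t * x + c + h * x) - cos (t * x + c) + h * x * sin (t * x + c)) * p x.
  rewrite (_ : (t + h) * x + c = t * x + c + h * x); ring.
rewrite normrM (ger0_norm (p_ge0 x)).
have -> : h ^+ 2 * 2 * (x ^+ 2 * p x) = 2 * (h * x) ^+ 2 * p x by ring.
by rewrite ler_wpM2r// cos_taylor.
Qed.

Let p_cvg0 (e : R) : `|e| = 1 -> p (e * n%:R) @[n --> \oo] --> (0 : R).
Proof.
move=> e1; pose M := 4 * s ^+ 2 * normal_peak s.
have M0 : 0 <= M by rewrite mulr_ge0// mulr_ge0// sqr_ge0.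
have ub : M * n%:R^-1 @[n --> \oo] --> (0 : R).
  rewrite -[X in _ --> X](mulr0 M); apply: cvgMl_tmp.
  by rewrite gtr0_cvgV0; [exact: cvgr_idn|near=> k; rewrite ltr0n; near: k; exact: nbhs_infty_gt].
apply: (squeeze_cvgr _ (cvg_cst 0) ub); near=> k.
have k1 : (1 : R) <= k%:R by rewrite ler1n; near: k; exact: nbhs_infty_gt.
have k0' : (0 : R) < k%:R by exact: lt_le_trans k1.
rewrite p_ge0 andTb ler_pdivlMr//.
apply: (@le_trans _ _ ((e * k%:R) ^+ 2 * p (e * k%:R))).
  rewrite mulrC ler_wpM2r// exprMn -(real_normK (num_real e)) e1 expr1n mul1r.
  by rewrite expr2 ler_peMr// ltW.
apply: (le_trans (sqr_p_le _)); rewrite -[leRHS]mulr1 ler_wpM2l//.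
have s2 : 0 <= 4 * s ^+ 2 by rewrite mulr_ge0// sqr_ge0.
by rewrite -[leRHS]expR0 ler_expR oppr_le0 divr_ge0// sqr_ge0.
Unshelve. all: by end_near. Qed.

(** Stein's identity: integration by parts against the normal density. *)
Let G_F (t : R) : G t = s ^+ 2 * t * F t.
Proof.
pose H x := sin (t * x + c) * p x.
have dH (x : R) : is_derive x (1 : R) H
    (t * (cos (t * x + c) * p x) + - (s ^- 2) * (x * sin (t * x + c) * p x)).
  have d1 : is_derive x (1 : R) (fun y : R => t * y + c) t.
    by apply: is_derive_eq; rewrite /GRing.scale /= !mulr1 addr0.
  have d2 := is_derive1_comp (is_derive_sin _) d1.
  apply: (is_derive_eq (is_deriveM d2 (p_derive x))).
  by rewrite /GRing.scale /=; field; rewrite s0.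
have iH1 := integrable_mull t (iF t); have iH2 := integrable_mull (- (s ^- 2)) (iG t).
have Hp x : `|H x| <= p x.
  by rewrite /H normrM (ger0_norm (p_ge0 x)) ler_piMl// sin_max.
have H0 (e : R) : `|e| = 1 -> H (e * n%:R) @[n --> \oo] --> (0 : R).
  move=> /p_cvg0 pe; apply: norm_cvg0; apply: (squeeze_cvgr _ (cvg_cst 0) pe).
  by apply: nearW => k; rewrite normr_ge0 Hp.
have e : \int[leb]_x (t * (cos (t * x + c) * p x) +
    - (s ^- 2) * (x * sin (t * x + c) * p x)) = 0.
  apply: (integral_derive_vanishing dH).
  - have cp : continuous p by exact: continuous_normal_pdf.
    have cl : continuous (fun x : R => t * x + c).
      by move=> x; apply: cvgD; [apply: cvgMr; exact: cvg_id|exact: cvg_cst].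
    have ccos : continuous (fun x : R => cos (t * x + c)).
      by move=> x; apply: (cvg_comp _ _ (cl x)); exact: continuous_cos.
    have csin : continuous (fun x : R => sin (t * x + c)).
      by move=> x; apply: (cvg_comp _ _ (cl x)); exact: continuous_sin.
    move=> x; apply: cvgD; apply: cvgM; [exact: cvg_cst|apply: cvgM|exact: cvg_cst|].
    + exact: ccos.
    + exact: cp.
    + apply: cvgM; last exact: cp.
      by apply: cvgM; [exact: cvg_id|exact: csin].
  - exact: integrable_addr.
  - by have := H0 1 (normr1 _); under eq_fun do rewrite mul1r.
  - by have := H0 (-1) (normrN1 _); under eq_fun do rewrite mulN1r.
move: e; rewrite RintegralD//.
have -> : \int[leb]_x (t * (cos (t * x + c) * p x)) = t * F t.
  by rewrite RintegralZl//; exact: iF.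
have -> : \int[leb]_x (- s ^- 2 * (x * sin (t * x + c) * p x)) = - s ^- 2 * G t.
  by rewrite RintegralZl//; exact: iG.
rewrite mulNr => /eqP; rewrite subr_eq0 => /eqP tF.
by rewrite -mulrA tF mulVKf// sqrf_eq0.
Qed.

Let intp : \int[leb]_x p x = 1.
Proof. by rewrite /Rintegral integral_normal_pdf. Qed.

(** By Stein's identity [F] solves the linear equation [F' = - s ^ 2 * t * F]. *)
Let F_exp (t : R) : F t = cos c * expR (- (s ^+ 2 * t ^+ 2 / 2)).
Proof.
pose E (t : R) := F t * expR (s ^+ 2 * t ^+ 2 / 2).
have dE (x : R) : is_derive x (1 : R) E 0.
  have d1 : is_derive x (1 : R) (fun y : R => s ^+ 2 * y ^+ 2 / 2) (s ^+ 2 * x).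
    by apply: is_derive_eq; rewrite /GRing.scale /=; field.
  have d2 := is_derive1_comp (is_derive_expR _) d1.
  apply: (is_derive_eq (is_deriveM (F_derive x) d2)).
  by rewrite G_F /GRing.scale /=; ring.
have := @is_derive_0_is_cst _ E t 0 dE.
have F0 : F 0 = cos c.
  rewrite /F; under eq_Rintegral do rewrite mul0r add0r.
  by rewrite RintegralZl// intp mulr1.
rewrite /E F0 expr0n mulr0 mul0r expR0 mulr1 => <-.
by rewrite -[RHS]mulrA -expRD subrr expR0 mulr1.
Qed.

Lemma normal_prob_integral_cos :
  \int[normal_prob 0 s]_x cos (x + c) = cos c * expR (- (s ^+ 2 / 2)).
Proof.
rewrite (@Rintegral_density _ _ _ leb _ p) => //.
- have := F_exp 1; rewrite expr1n mulr1 => <-.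
  by apply: eq_Rintegral => x _; rewrite mul1r.
- apply/(@integrable_density _ _ _ leb _ p) => //.
    by have := mcos 1; under eq_fun do rewrite mul1r.
  by have := iF 1; under eq_fun do rewrite mul1r.
Qed.

Lemma normal_prob_integrable_sqr :
  (normal_prob 0 s).-integrable [set: R] (EFin \o (fun x => x ^+ 2)).
Proof.
by apply/(@integrable_density _ _ _ leb _ p) => //; exact: exprn_measurable.
Qed.

End normal_charf.

(** * Approximation by trigonometric polynomials *)

Section lazy_walk.
Context {R : realType} {n : nat}.
Variables (y : 'I_n -> R) (h : R).
Hypothesis y01 : forall i, 0 <= y i <= 1.
Implicit Types (l : seq 'I_n) (g : 'rV[R]_n -> R) (a c : 'rV[R]_n).

(** The expectation of [g] at the end point of a random walk started at [a]:
    for each entry [i] of [l] the walk moves by [h] along coordinate [i] with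
    probability [y i]. With [N] moves of length [1 / N] along every coordinate
    this is the Bernstein polynomial of [g] at [y]. *)
Fixpoint walk l g a : R :=
  if l is i :: l' then
    y i * walk l' g (a + h *: delta_mx 0 i) + (1 - y i) * walk l' g a
  else g a.

Let y0 i : 0 <= y i. Proof. by have /andP[] := y01 i. Qed.
Let y1 i : 0 <= 1 - y i. Proof. by rewrite subr_ge0; have /andP[] := y01 i. Qed.

Lemma walk_le l g g' a : (forall b, g b <= g' b) -> walk l g a <= walk l g' a.
Proof.
by move=> gg; elim: l a => [|i l IH] a //=; rewrite lerD// ler_wpM2l.
Qed.

Lemma walk_lin l (b b' : R) g g' a :
  walk l (fun x => b * g x + b' * g' x) a = b * walk l g a + b' * walk l g' a.
Proof. by elim: l a => [|i l IH] a //=; rewrite !IH; ring. Qed.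

Lemma walk_cst l (b : R) a : walk l (fun=> b) a = b.
Proof. by elim: l a => [|i l IH] a //=; rewrite !IH; ring. Qed.

Lemma walk_norm l g a (b : R) : `|walk l g a - b| <= walk l (fun x => `|g x - b|) a.
Proof.
have e : walk l g a - b = walk l (fun x => g x - b) a.
  have := walk_lin l 1 (- 1) g (fun=> b) a; rewrite walk_cst mul1r mulN1r => <-.
  by congr walk; apply/funext => x; rewrite mul1r.
rewrite e ler_norml; apply/andP; split.
  have := walk_lin l (- 1) 0 (fun x => `|g x - b|) (fun=> 0) a.
  rewrite walk_cst mulr0 addr0 mulN1r => <-; apply: walk_le => x.
  by rewrite addr0 mulN1r lerNl ler_normr lexx orbT.
by apply: walk_le => x; exact: ler_norm.
Qed.

Lemma walk_sqr l i c a : walk l (fun x => (x 0 i - c 0 i) ^+ 2) a =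
  (a 0 i + (count_mem i l)%:R * h * y i - c 0 i) ^+ 2 +
  (count_mem i l)%:R * h ^+ 2 * (y i * (1 - y i)).
Proof.
elim: l a => [|j l IH] a /=; first by rewrite !mul0r !addr0.
rewrite !IH natrD !mxE eqxx andTb eq_sym; have [->|ji] := eqVneq j i.
  by rewrite /=; ring.
by rewrite /= mulr0 !addr0 !add0r; ring.
Qed.

Lemma walk_sum (I : Type) (r : seq I) l (q : I -> 'rV[R]_n -> R) a :
  walk l (fun x => \sum_(i <- r) q i x) a = \sum_(i <- r) walk l (q i) a.
Proof.
elim: r => [|i r IH].
  by rewrite big_nil -[RHS](walk_cst l 0 a); congr walk; apply/funext => x; rewrite big_nil.
rewrite big_cons -IH; have := walk_lin l 1 1 (q i) (fun x => \sum_(i <- r) q i x) a.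
rewrite !mul1r => <-; congr walk; apply/funext => x.
by rewrite big_cons !mul1r.
Qed.

End lazy_walk.

Section trigonometric_polynomials.
Context {R : realType} {n : nat}.
Implicit Types (v a : 'rV[R]_n) (f g : 'rV[R]_n -> R).

Inductive trigpoly : ('rV[R]_n -> R) -> Prop :=
| trig_cos a c : trigpoly (fun v => cos ((v *m a^T) 0 0 + c))
| trig_lin r s f g : trigpoly f -> trigpoly g ->
    trigpoly (fun v => r * f v + s * g v).

Lemma trig_cst (r : R) : trigpoly (fun=> r).
Proof.
have := trig_lin r 0 (trig_cos 0 0) (trig_cos 0 0).
by congr trigpoly; apply/funext => v; rewrite linear0 mulmx0 mxE addr0 cos0 mulr1 mul0r addr0.
Qed.

Lemma trigM f g : trigpoly f -> trigpoly g -> trigpoly (fun v => f v * g v).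
Proof.
move=> tf tg; elim: tf => {f} [a c|r s f f' tf tfg tf' tfg'].
  elim: tg => {g} [b e|r s g g' tg tcg tg' tcg'].
    have := trig_lin 2^-1 2^-1 (trig_cos (a - b) (c - e)) (trig_cos (a + b) (c + e)).
    congr trigpoly; apply/funext => v; rewrite !linearB !linearD /= !mxE.
    set x := \sum_j _; set z := \sum_j _.
    have -> : x - z + (c - e) = (x + c) - (z + e) by ring.
    have -> : x + z + (c + e) = (x + c) + (z + e) by ring.
    by rewrite (cosB (x + c)) (cosD (x + c) (z + e)); field.
  have := trig_lin r s tcg tcg'; congr trigpoly; apply/funext => v; ring.
have := trig_lin r s tfg tfg'; congr trigpoly; apply/funext => v; ring.
Qed.

Lemma trig_sin i (L : R) : trigpoly (fun v => sin (v 0 i / L)).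
Proof.
have := trig_cos (L^-1 *: delta_mx 0 i) (- (pi / 2)).
congr trigpoly; apply/funext => v.
rewrite cosD sinN cosN cos_pihalf sin_pihalf mulr0 add0r mulrN1 opprK; congr sin.
rewrite mxE (bigD1 i)//= !mxE !eqxx mulr1 big1 ?addr0// => j ji.
by rewrite !mxE (negbTE ji) mulr0 mulr0.
Qed.

Lemma trig_walk (y : 'rV[R]_n -> 'I_n -> R) h l g a :
  (forall i, trigpoly (fun v => y v i)) -> trigpoly (fun v => walk (y v) h l g a).
Proof.
move=> ty; elim: l a => [|i l IH] a /=; first exact: trig_cst.
have := trig_lin 1 1 (trigM (ty i) (IH (a + h *: delta_mx 0 i)))
  (trigM (trig_lin 1 (-1) (trig_cst 1) (ty i)) (IH a)).
by congr trigpoly; apply/funext => v; ring.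
Qed.

Lemma trig_bounded f : trigpoly f -> exists M, forall v, `|f v| <= M.
Proof.
elim => {f} [a c|r s f g _ [M fM] _ [N gN]]; first by exists 1 => v; exact: cos_max.
exists (`|r| * M + `|s| * N) => v.
by rewrite (le_trans (ler_normD _ _))// !normrM lerD// ler_wpM2l.
Qed.

Section approximation.
Variables (phi : 'rV[R]_n -> R) (K : R).
Hypothesis phi_cont : continuous phi.
Hypothesis phiK : forall v, `|phi v| <= K.

Let K0 : 0 <= K. Proof. exact: le_trans (phiK 0). Qed.

Lemma uniformly_continuous_on_cube (A e : R) : 0 < e -> exists2 r : R, 0 < r &
  forall a b : 'rV[R]_n, (forall i, `|a 0 i| <= A) ->
  (forall i, `|a 0 i - b 0 i| < r) -> `|phi a - phi b| <= e.
Proof.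
move=> e0.
have : compact [set a : 'rV[R]_n | forall i, `[- A, A]%classic (a ord0 i)].
  by apply: (@rV_compact _ _ (fun=> `[(- A), A]%classic)) => i; exact: segment_compact.
move=> /compact_near_coveringP /(_ R 0^'+ (fun r a => forall b : 'rV[R]_n,
  (forall i, `|a 0 i - b 0 i| < r) -> `|phi a - phi b| <= e)).
case.
  move=> x _; have /cvgrPdist_le /(_ (e / 2)) := @phi_cont x.
  rewrite divr_gt0// => /(_ isT) /nbhs_ballP[r /= r0 xr].
  exists (ball x (r / 2), [set s : R | 0 < s <= r / 2]) => /=.
    split; first by apply/nbhs_ballP; exists (r / 2) => //=; rewrite divr_gt0.
    near=> s; rewrite /=; apply/andP; split; near: s; first exact: nbhs_right_gt.
    by apply: nbhs_right_le; rewrite divr_gt0.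
  move=> [x' s] /= [xx' /andP[s0 sr]] b x'b.
  have e2 : e = e / 2 + e / 2 by field.
  rewrite (_ : phi x' - phi b = (phi x - phi b) - (phi x - phi x')); last by ring.
  rewrite (le_trans (ler_normB _ _))// e2 lerD//; apply: xr.
    split=> // i j; rewrite ord1; have := xx'.2 ord0 j; have := x'b j.
    rewrite /ball /= => x'bj xx'j.
    rewrite (_ : x 0 j - b 0 j = (x 0 j - x' 0 j) + (x' 0 j - b 0 j)); last by ring.
    rewrite (le_lt_trans (ler_normD _ _))// (_ : r = r / 2 + r / 2); last by field.
    by rewrite ltrD// (lt_le_trans x'bj).
  by apply: le_ball xx'; rewrite ler_pdivrMr// ler_peMr// ?ler1n// ltW.
move=> r /= r0 rP.
exists (r / 2); first by rewrite divr_gt0.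
move=> a b aA ab; apply: (rP (r / 2)) => //=.
- by rewrite sub0r normrN gtr0_norm ?divr_gt0// ltr_pdivrMr// ltr_pMr// ltr1n.
- by rewrite divr_gt0.
- by move=> i; rewrite /= in_itv /= -ler_norml.
Unshelve. all: by end_near. Qed.

(** Beyond the modulus of continuity, the square of the distance pays for the
    bound on [phi]. *)
Lemma quadratic_modulus (A e : R) : 0 < e -> exists2 M : R, 0 <= M &
  forall a b : 'rV[R]_n, (forall i, `|a 0 i| <= A) ->
  `|phi a - phi b| <= e + M * \sum_i (a 0 i - b 0 i) ^+ 2.
Proof.
move=> e0; have [r r0 rP] := uniformly_continuous_on_cube A e0.
have M0 : 0 <= 2 * K / r ^+ 2 by nonneg.
exists (2 * K / r ^+ 2) => // a b aA.
have S0 : 0 <= \sum_i (a 0 i - b 0 i) ^+ 2 by apply: sumr_ge0 => i _; exact: sqr_ge0.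
have [ab|/existsNP [i /negP]] := pselect (forall i, `|a 0 i - b 0 i| < r).
  by rewrite (le_trans (rP _ _ aA ab))// lerDl mulr_ge0.
rewrite -leNgt => ri.
rewrite -[leLHS]add0r lerD ?(ltW e0)//.
apply: (@le_trans _ _ (2 * K)).
  by rewrite (le_trans (ler_normB _ _))// mulr_natl mulr2n lerD.
rewrite -[leLHS]mulr1 -[X in _ * X](@mulVf _ (r ^+ 2)) ?gt_eqF ?exprn_gt0//.
rewrite mulrA ler_wpM2l// (bigD1 i)//= -[leLHS]addr0 lerD//.
  by rewrite -(real_normK (num_real (a 0 i - b 0 i))) lerXn2r ?nnegrE// ltW.
by apply: sumr_ge0 => j _; exact: sqr_ge0.
Qed.

(** The periodic truncation [L * sin (v / L)] is close to [v] on large cubes, and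
    on its range [phi] is a uniform limit of Bernstein polynomials in the sines.
    The quadratic term on the right pays for the complement of the cube. *)
Lemma trig_approx (e : R) : 0 < e -> exists2 f, trigpoly f &
  forall v, `|phi v - f v| <= e * (1 + \sum_i (v 0 i) ^+ 2).
Proof.
move=> e0.
have e40 : 0 < e / 4 by rewrite divr_gt0.
pose A := Num.sqrt (2 * K / e + 1).
have A2 : A ^+ 2 = 2 * K / e + 1.
  by rewrite sqr_sqrtr//; nonneg.
have A2gt0 : 0 < A ^+ 2.
  by rewrite A2 ltr_wpDl//; nonneg.
have A0 : 0 <= A by exact: sqrtr_ge0.
have [M M0 MP] := quadratic_modulus A e40.
(* makes the error of the truncation on the cube of radius [A] at most e/4 *)
pose L := Num.max 1 (M * n%:R * A ^+ 4 / (e / 4)).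
have L1 : 1 <= L by rewrite le_max lexx.
have L0 : 0 < L by exact: lt_le_trans L1.
have LM : M * n%:R * A ^+ 4 / L <= e / 4.
  rewrite ler_pdivrMr// [leRHS]mulrC -ler_pdivrMr//.
  by rewrite le_max lexx orbT.
pose tr v : 'rV[R]_n := \row_i (L * sin (v 0 i / L)).
have tr_le v i : `|v 0 i - tr v 0 i| <= `|v 0 i| ^+ 2 / L.
  rewrite mxE; have -> : v 0 i - L * sin (v 0 i / L) =
      - (L * (sin (v 0 i / L) - v 0 i / L)) by field; rewrite gt_eqF.
  rewrite normrN normrM (gtr0_norm L0).
  have -> : `|v 0 i| ^+ 2 / L = L * `|v 0 i / L| ^+ 2.
    by rewrite normrM normfV (gtr0_norm L0); field; rewrite gt_eqF.
  by rewrite ler_wpM2l ?(ltW L0)// sin_sub_le_sqr.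
have step1 v : `|phi v - phi (tr v)| <= e / 2 + e * \sum_i (v 0 i) ^+ 2.
  have S0 : 0 <= \sum_i (v 0 i) ^+ 2 by apply: sumr_ge0 => i _; exact: sqr_ge0.
  have [vA|/existsNP [i /negP]] := pselect (forall i, `|v 0 i| <= A).
    rewrite (le_trans (MP v (tr v) vA))//.
    apply: (@le_trans _ _ (e / 2)); last by rewrite lerDl mulr_ge0// ltW.
    have -> : e / 2 = e / 4 + e / 4 by field.
    rewrite lerD2l (le_trans _ LM)//.
    have -> : M * n%:R * A ^+ 4 / L = M * (n%:R * (A ^+ 4 / L)) by rewrite !mulrA.
    rewrite ler_wpM2l//.
    apply: (@le_trans _ _ (\sum_(i < n) A ^+ 4 / L)); last first.
      by rewrite sumr_const card_ord mulr_natl.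
    apply: ler_sum => i _.
    rewrite -(real_normK (num_real (v 0 i - tr v 0 i))).
    apply: (@le_trans _ _ ((A ^+ 2 / L) ^+ 2)).
      rewrite lerXn2r ?nnegrE// ?divr_ge0 ?sqr_ge0 ?(ltW L0)//.
      rewrite (le_trans (tr_le v i))// ler_wpM2r ?invr_ge0 ?(ltW L0)//.
      by rewrite lerXn2r ?nnegrE// (vA i).
    rewrite expr_div_n -exprM ler_wpM2l ?exprn_ge0// lef_pV2 ?posrE ?exprn_gt0//.
    by rewrite expr2 ler_peMr// ltW.
  rewrite -ltNge => Av.
  apply: (@le_trans _ _ (2 * K)).
    by rewrite (le_trans (ler_normB _ _))// mulr_natl mulr2n lerD.
  rewrite -[leLHS]add0r lerD// ?divr_ge0// ?(ltW e0)//.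
  rewrite [leRHS]mulrC -ler_pdivrMr//; apply: (@le_trans _ _ (A ^+ 2)).
    by rewrite A2 lerDl.
  rewrite (bigD1 i)//= -[leLHS]addr0 lerD//; last first.
    by apply: sumr_ge0 => j _; exact: sqr_ge0.
  by rewrite -(real_normK (num_real (v 0 i))) lerXn2r ?nnegrE// ltW.
have [M' M'0 M'P] := quadratic_modulus L e40.
pose y v i : R := (1 + sin (v 0 i / L)) / 2.
have y01 v i : 0 <= y v i <= 1.
  rewrite /y divr_ge0//= -?lerBlDl ?sub0r ?sin_geN1//.
  by rewrite ler_pdivrMr// mul1r [2]mulr2n lerD2l sin_le1.
pose unscale (a : 'rV[R]_n) : 'rV[R]_n := \row_i (L * (2 * a 0 i - 1)).
pose g a := phi (unscale a).
have gy v : g (\row_i y v i) = phi (tr v).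
  by congr phi; apply/rowP => i; rewrite !mxE /y; field.
pose N := (Num.truncn (M' * (2 * L) ^+ 2 * n%:R / (e / 4))).+1.
pose l := flatten (nseq N (enum 'I_n)).
have lN i : count_mem i l = N.
  rewrite /l; elim: (N) => //= k IH.
  by rewrite count_cat IH count_uniq_mem ?enum_uniq// mem_enum.
exists (fun v => walk (y v) N%:R^-1 l g 0).
  apply: trig_walk => i.
  have := trig_lin 2^-1 2^-1 (trig_cst 1) (trig_sin i L).
  by congr trigpoly; apply/funext => v; rewrite /y mulr1; field.
move=> v.
have step2 : `|phi (tr v) - walk (y v) N%:R^-1 l g 0| <= e / 2.
  rewrite distrC (le_trans (walk_norm _ (y01 v) _ _ _ _))//.
  pose q i (a : 'rV[R]_n) := (a 0 i - (\row_j y v j) 0 i) ^+ 2.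
  apply: (@le_trans _ _ (walk (y v) N%:R^-1 l (fun a =>
      1 * (e / 4) + (M' * (2 * L) ^+ 2) * \sum_i q i a) 0)).
    apply: (@walk_le _ _ (y v) N%:R^-1 (y01 v)) => a; rewrite mul1r -gy distrC /g.
    apply: (le_trans (M'P _ _ _)) => [i|].
      rewrite !mxE normrM (gtr0_norm L0) ler_piMr ?(ltW L0)//.
      have -> : 2 * y v i - 1 = sin (v 0 i / L) by rewrite /y; field.
      exact: sin_max.
    rewrite lerD2l -mulrA ler_wpM2l// mulr_sumr ler_sum// => i _.
    rewrite /q !mxE.
    by have -> : (L * (2 * y v i - 1) - L * (2 * a 0 i - 1)) ^+ 2 =
      (2 * L) ^+ 2 * (a 0 i - y v i) ^+ 2 by ring.
  rewrite walk_lin walk_cst mul1r walk_sum.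
  have -> : e / 2 = e / 4 + e / 4 by field.
  rewrite lerD2l.
  apply: (@le_trans _ _ (M' * (2 * L) ^+ 2 * \sum_(i < n) N%:R^-1)).
    have ML0 : 0 <= M' * (2 * L) ^+ 2 by nonneg.
    apply: ler_wpM2l => //; apply: ler_sum => i _.
    rewrite /q walk_sqr lN !mxE add0r mulfV ?pnatr_eq0// mul1r subrr expr0n add0r.
    have -> : N%:R * N%:R^-1 ^+ 2 = N%:R^-1 :> R by rewrite expr2 mulVKf ?pnatr_eq0.
    rewrite ler_piMr ?invr_ge0//.
    have /andP[y0 y1] := y01 v i.
    by rewrite mulr_ile1// ?subr_ge0// lerBlDr lerDl.
  rewrite sumr_const card_ord -[X in _ * X]mulr_natl mulrA ler_pdivrMr ?ltr0n//.
  by rewrite [leRHS]mulrC -ler_pdivrMr// ltW// truncnS_gt.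
have -> : phi v - walk (y v) N%:R^-1 l g 0 = (phi v - phi (tr v)) +
  (phi (tr v) - walk (y v) N%:R^-1 l g 0) by ring.
rewrite (le_trans (ler_normD _ _))// mulrDr mulr1.
have -> : e + e * \sum_i (v 0 i) ^+ 2 =
  (e / 2 + e * \sum_i (v 0 i) ^+ 2) + e / 2 by field.
by rewrite lerD.
Qed.

End approximation.

End trigonometric_polynomials.

(** * A criterion for weak convergence *)

Section trigonometric_integrals.
Context {R : realType} {n : nat} {d : measure_display} {X : measurableType d}.
Variables (mu : probability X R) (Z : X -> 'rV[R]_n).
Hypothesis mZ : forall i, measurable_fun [set: X] (fun x => Z x 0 i).

Lemma measurable_dot (a : 'rV[R]_n) :
  measurable_fun [set: X] (fun x => (Z x *m a^T) 0 0).
Proof.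
under eq_fun do rewrite mxE; apply: measurable_sum => i.
by apply: measurable_funM => //; exact: measurable_cst.
Qed.

Lemma measurable_trig f : trigpoly f -> measurable_fun [set: X] (f \o Z).
Proof.
elim => {f} [a c|r s f g _ mf _ mg].
  have mD : measurable_fun [set: X] (fun x => (Z x *m a^T) 0 0 + c).
    by apply: measurable_funD => //; exact: measurable_dot.
  exact: (cmeasurable_expi mD).1.
by apply: measurable_funD; apply: measurable_funM.
Qed.

Lemma integrable_trig f : trigpoly f -> mu.-integrable [set: X] (EFin \o (f \o Z)).
Proof.
move=> tf; have [M fM] := trig_bounded tf.
apply: (@integrable_ae_bounded _ _ _ _ _ M); first exact: measurable_trig.
by apply: aeW => x; exact: fM.
Qed.

Section continuous_bounded.
Variables (phi : 'rV[R]_n -> R) (K : R).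
Hypothesis phi_cont : continuous phi.
Hypothesis phiK : forall v, `|phi v| <= K.

(** [phi \o Z] is a pointwise limit of trigonometric polynomials in the
    coordinates of [Z]. *)
Lemma measurable_continuous_comp : measurable_fun [set: X] (phi \o Z).
Proof.
have e0 k : (0 : R) < k.+1%:R^-1 by rewrite invr_gt0.
pose f k := sval (cid2 (trig_approx phi_cont phiK (e0 k))).
have tf k : trigpoly (f k) by rewrite /f; case: cid2.
have fP k v : `|phi v - f k v| <= k.+1%:R^-1 * (1 + \sum_i (v 0 i) ^+ 2).
  by rewrite /f; case: cid2.
apply: (measurable_fun_cvg (fun k => measurable_trig (tf k))) => x _ /=.
pose c := 1 + \sum_i (Z x 0 i) ^+ 2.
have ub : k.+1%:R^-1 * c @[k --> \oo] --> (0 : R).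
  by rewrite -[X in _ --> X](mul0r c); apply: cvgMl; exact: cvg_harmonic.
have d0 : phi (Z x) - f k (Z x) @[k --> \oo] --> (0 : R).
  apply: norm_cvg0; apply: (squeeze_cvgr _ (cvg_cst 0) ub).
  by apply: nearW => k; rewrite normr_ge0 fP.
have -> : (fun k => f k (Z x)) = (fun k => phi (Z x) - (phi (Z x) - f k (Z x))).
  by apply/funext => k; rewrite opprB addrC subrK.
by rewrite -[X in _ --> X]subr0; apply: cvgB => //; exact: cvg_cst.
Qed.

Lemma integrable_continuous_comp : mu.-integrable [set: X] (EFin \o (phi \o Z)).
Proof.
apply: (@integrable_ae_bounded _ _ _ _ _ K); first exact: measurable_continuous_comp.
by apply: aeW => x; exact: phiK.
Qed.

Lemma integral_trig_approx f (e C : R) : trigpoly f -> 0 <= e ->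
  (forall v, `|phi v - f v| <= e * (1 + \sum_i (v 0 i) ^+ 2)) ->
  (forall i, mu.-integrable [set: X] (EFin \o (fun x => Z x 0 i ^+ 2))) ->
  (forall i, \int[mu]_x (Z x 0 i ^+ 2) <= C) ->
  `|\int[mu]_x phi (Z x) - \int[mu]_x f (Z x)| <= e * (1 + n%:R * C).
Proof.
move=> tf e0 phif iZ ZC.
have iphi := integrable_continuous_comp; have iff := integrable_trig tf.
have [iS ES] := Rintegral_sum (index_enum 'I_n) iZ.
have i1 : mu.-integrable [set: X] (EFin \o (fun=> 1 : R)).
  exact: finite_measure_integrable_cst.
have iB : mu.-integrable [set: X] (EFin \o (fun x => phi (Z x) - f (Z x))).
  by have := integrableB measurableT iphi iff.
rewrite -RintegralB//; apply: (le_trans (le_normr_Rintegral _ _)) => //.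
apply: (@le_trans _ _ (\int[mu]_x (e * (1 + \sum_i (Z x 0 i) ^+ 2)))).
  apply: le_Rintegral => //; first exact: integrable_norm.
    exact/integrable_mull/integrable_addr.
rewrite RintegralZl//; last exact: integrable_addr.
rewrite ler_wpM2l// RintegralD// ES Rintegral_cst//.
have -> : fine (mu [set: X]) = 1 by rewrite (probability_setT mu).
rewrite mul1r lerD2l (_ : n%:R * C = \sum_(i < n) C); last first.
  by rewrite sumr_const card_ord mulr_natl.
by apply: ler_sum => i _.
Qed.

End continuous_bounded.

End trigonometric_integrals.

Section weak_convergence.
Context {R : realType} {n : nat} {dX dY : measure_display}
  {X : measurableType dX} {Y : measurableType dY}.
Variables (mu : probability X R) (nu : probability Y R).
Variables (Z : nat -> X -> 'rV[R]_n) (W : Y -> 'rV[R]_n) (C : R).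
Hypothesis mZ : forall k i, measurable_fun [set: X] (fun x => Z k x 0 i).
Hypothesis mW : forall i, measurable_fun [set: Y] (fun y => W y 0 i).
Hypothesis iZ : forall k i, mu.-integrable [set: X] (EFin \o (fun x => Z k x 0 i ^+ 2)).
Hypothesis iW : forall i, nu.-integrable [set: Y] (EFin \o (fun y => W y 0 i ^+ 2)).
Hypothesis ZC : forall k i, \int[mu]_x (Z k x 0 i ^+ 2) <= C.
Hypothesis cosZ : forall (a : 'rV[R]_n) (c : R),
  \int[mu]_x cos ((Z k x *m a^T) 0 0 + c) @[k --> \oo] -->
  \int[nu]_y cos ((W y *m a^T) 0 0 + c).

Lemma trig_weak_convergence f : trigpoly f ->
  \int[mu]_x f (Z k x) @[k --> \oo] --> \int[nu]_y f (W y).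
Proof.
elim => {f} [a c|r s f g tf cf tg cg]; first exact: cosZ.
have iZf k h t : trigpoly h -> mu.-integrable [set: X] (EFin \o (fun x => t * h (Z k x))).
  by move=> th; apply: integrable_mull; exact: (integrable_trig mu (mZ k) th).
have iWf h t : trigpoly h -> nu.-integrable [set: Y] (EFin \o (fun y => t * h (W y))).
  by move=> th; apply: integrable_mull; exact: (integrable_trig nu mW th).
rewrite RintegralD//; try exact: iWf.
rewrite !RintegralZl//; try exact: (integrable_trig nu mW).
have -> : (fun k => \int[mu]_x (r * f (Z k x) + s * g (Z k x))) =
    (fun k => r * \int[mu]_x f (Z k x) + s * \int[mu]_x g (Z k x)).
  apply/funext => k; rewrite RintegralD//; try exact: iZf.
  by rewrite !RintegralZl//; exact: (integrable_trig mu (mZ k)).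
by apply: cvgD; apply: cvgMr.
Qed.

(** Bounded second moments turn the quadratic error of [trig_approx] into a small
    error of the integrals, uniformly in [k]. *)
Theorem weak_convergence_of_cos (phi : 'rV[R]_n -> R) (K : R) :
  continuous phi -> (forall v, `|phi v| <= K) ->
  \int[mu]_x phi (Z k x) @[k --> \oo] --> \int[nu]_y phi (W y).
Proof.
move=> phi_cont phiK.
pose C' := Num.max C (\sum_i \int[nu]_y (W y 0 i ^+ 2)).
have WC i : \int[nu]_y (W y 0 i ^+ 2) <= C'.
  rewrite le_max; apply/orP; right; rewrite (bigD1 i)//= lerDl.
  by apply: sumr_ge0 => j _; apply: Rintegral_ge0 => y _; exact: sqr_ge0.
have ZC' k i : \int[mu]_x (Z k x 0 i ^+ 2) <= C' by rewrite le_max ZC.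
pose B := 1 + n%:R * `|C'|.
have B0 : 0 < B by rewrite ltr_pwDl// mulr_ge0.
have C'B : 1 + n%:R * C' <= B by rewrite lerD2l ler_wpM2l// ler_norm.
apply/cvgrPdist_le => e e0.
pose e' := e / (3 * B).
have e'0 : 0 < e' by rewrite divr_gt0// mulr_gt0.
have [f tf phif] := trig_approx phi_cont phiK e'0.
have e'B : e' * (1 + n%:R * C') <= e / 3.
  apply: (@le_trans _ _ (e' * B)); first by rewrite ler_wpM2l// ltW.
  by rewrite /e' invfM mulrA mulfVK// gt_eqF.
have bW := integral_trig_approx mW phi_cont phiK tf (ltW e'0) phif iW WC.
have := trig_weak_convergence tf => /cvgrPdist_le /(_ (e / 3)).
rewrite divr_gt0// => /(_ isT); apply: filterS => k fk.
have bZ := integral_trig_approx (mZ k) phi_cont phiK tf (ltW e'0) phif (iZ k) (ZC' k).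
have -> : \int[nu]_y phi (W y) - \int[mu]_x phi (Z k x) =
  (\int[nu]_y phi (W y) - \int[nu]_y f (W y)) +
  (\int[nu]_y f (W y) - \int[mu]_x f (Z k x)) -
  (\int[mu]_x phi (Z k x) - \int[mu]_x f (Z k x)) by ring.
rewrite (le_trans (ler_normB _ _))// (_ : e = e / 3 + e / 3 + e / 3); last by field.
rewrite lerD// ?(le_trans bZ)// (le_trans (ler_normD _ _))// lerD//.
exact: le_trans bW _.
Qed.

End weak_convergence.

(** * The variation of a function of a linear form *)

Section linear_form.
Context {R : realType} {n : nat}.
Implicit Types (a v q : 'rV[R]_n).

Definition dotv a q : R := (q *m a^T) 0 0.

Lemma dotvE a q : dotv a q = \sum_i q 0 i * a 0 i.
Proof. by rewrite /dotv mxE; apply: eq_bigr => i _; rewrite mxE. Qed.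

Lemma dotv_is_linear a : linear (dotv a).
Proof. by move=> r u v; rewrite /dotv mulmxDl -scalemxAl !mxE. Qed.

HB.instance Definition _ a := GRing.isLinear.Build R 'rV[R]_n R *:%R (dotv a)
  (dotv_is_linear a).

Lemma dotv_continuous a : continuous (dotv a).
Proof.
have -> : dotv a = fun q => \sum_(i <- index_enum 'I_n) q 0 i * a 0 i.
  by apply/funext => q; exact: dotvE.
elim: (index_enum _) => [|i r IH].
  have -> : (fun q : 'rV[R]_n => \sum_(i <- [::]) q 0 i * a 0 i) = fun=> 0.
    by apply/funext => p; rewrite big_nil.
  exact: cst_continuous.
have -> : (fun q : 'rV[R]_n => \sum_(j <- i :: r) q 0 j * a 0 j) =
    (fun q => q 0 i * a 0 i + \sum_(j <- r) q 0 j * a 0 j).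
  by apply/funext => p; rewrite big_cons.
have ci : continuous (fun q : 'rV[R]_n => q 0 i * a 0 i).
  move=> q; apply: (cvg_comp (fun q : 'rV[R]_n => q 0 i) (fun z => z * a 0 i)).
    exact: coord_continuous.
  exact: mulrr_continuous.
by move=> q; exact: (continuousD (ci q) (IH q)).
Qed.

Lemma comp_dotv_continuous (D : R -> R) a (r : R) : continuous D ->
  continuous (fun q => D (dotv a q) * r).
Proof.
move=> cD q; apply: (cvg_comp (fun q : 'rV[R]_n => dotv a q) (fun z => D z * r)).
  exact: dotv_continuous.
apply: (cvg_comp D (fun z => z * r)); first exact: cD.
exact: mulrr_continuous.
Qed.

(** The norm on linear forms dual to the sup norm of R^n. *)
Definition norm1 a : R := \sum_i `|a 0 i|.

Lemma norm1_ge0 a : 0 <= norm1 a.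
Proof. by apply: sumr_ge0 => i _. Qed.

Lemma coord_le q i : `|q 0 i| <= `|q|.
Proof.
rewrite [leRHS]/Num.Def.normr /= mx_normrE.
exact: (le_bigmax _ (fun ij : 'I_1 * 'I_n => `|q ij.1 ij.2|) (0, i)).
Qed.

Lemma dotv_le a q (M : R) : `|q| <= M -> `|dotv a q| <= norm1 a * M.
Proof.
move=> qM; rewrite dotvE (le_trans (ler_norm_sum _ _ _))// /norm1 mulr_suml.
apply: ler_sum => i _; rewrite normrM mulrC ler_wpM2l// (le_trans _ qM)//.
exact: coord_le.
Qed.

Lemma dotv_diff (F F' : R -> R) a q : (forall y : R, is_derive y (1 : R) F (F' y)) ->
  differentiable (fun p => F (dotv a p)) q /\
  forall v, 'd (fun p => F (dotv a p)) q v = F' (dotv a q) * dotv a v.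
Proof.
move=> dF.
have dl : differentiable (dotv a) q.
  exact/linear_differentiable/dotv_continuous.
have dFy : differentiable F (dotv a q).
  by apply/derivable1_diffP; have [] := dF (dotv a q).
split; first exact: differentiable_comp.
move=> v; have := diff_comp dl dFy => /(congr1 (fun f => f v)) /= ->.
rewrite (diff_lin _ (@dotv_continuous a)).
have dFr (r : R) : 'd F (dotv a q) r = F' (dotv a q) * r.
  have {1}-> : r = r *: (1 : R) by rewrite /GRing.scale /= mulr1.
  rewrite linearZ /= -deriveE//; have [_ ->] := dF (dotv a q).
  by rewrite /GRing.scale /= mulrC.
exact: dFr.
Qed.

End linear_form.

Section variation_linear_form.
Context {R : realType} {d : measure_display} {X : measurableType d} {n : nat}.
Variables (m : probability X R) (var : (X -> R[i]) -> \bar R).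
Hypothesis V : is_variation m var n.
Local Notation Bbound := (Bbound m var).
Variables (f : X -> 'rV[R]_n) (a : 'rV[R]_n) (M Vf : R).
Hypothesis M0 : 0 < M.
Hypothesis mf : forall i, measurable_fun [set: X] (fun x => f x 0 i).
Hypothesis fM : forall x, `|f x| <= M.
Hypothesis fV : (var_vec var f <= Vf%:E)%E.

Lemma var_linear_form (F1 F2 D1 D2 : R -> R) (c : R) :
  (forall y : R, is_derive y (1 : R) F1 (D1 y)) ->
  (forall y : R, is_derive y (1 : R) F2 (D2 y)) ->
  continuous D1 -> continuous D2 -> 0 <= c ->
  (forall y, `|y| <= norm1 a * M -> `|D1 y| <= c) ->
  (forall y, `|y| <= norm1 a * M -> `|D2 y| <= c) ->
  (var (fun x => F1 (dotv a (f x)) +i* F2 (dotv a (f x))) <=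
   (2 * c * norm1 a * Vf)%:E)%E.
Proof.
move=> dF1 dF2 cD1 cD2 c0 D1c D2c.
pose h (q : 'rV[R]_n) := F1 (dotv a q) +i* F2 (dotv a q).
have hC1 : C1_on_ball M h.
  exists [set: 'rV[R]_n]; split => //; first exact: openT.
  move=> p _; have [d1 e1] := dotv_diff a p dF1; have [d2 e2] := dotv_diff a p dF2.
  split=> // v; split.
    have -> : (fun q => 'd (fun r => Re (h r)) q v) = (fun q => D1 (dotv a q) * dotv a v).
      by apply/funext => q; have [_ ->] := dotv_diff a q dF1.
      exact: comp_dotv_continuous.
  have -> : (fun q => 'd (fun r => Im (h r)) q v) = (fun q => D2 (dotv a q) * dotv a v).
    by apply/funext => q; have [_ ->] := dotv_diff a q dF2.
  exact: comp_dotv_continuous.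
have n1 := norm1_ge0 a.
have Dn p : origin_ball M p -> (Dnorm h p <= (2 * c * norm1 a)%:E)%E.
  move=> pM; apply: ge_ereal_sup => _ [v v1 <-]; rewrite lee_fin.
  have [_ ->] := dotv_diff a p dF1; have [_ ->] := dotv_diff a p dF2.
  rewrite (le_trans (normc_le _))//= !normrM -mulrDl.
  have va : `|dotv a v| <= norm1 a by have := dotv_le a v1; rewrite mulr1.
  have pa := dotv_le a pM.
  by rewrite ler_pM ?addr_ge0// mulr_natl mulr2n lerD// ?D1c ?D2c.
have vv0 : (0 <= var_vec var f)%E.
  by rewrite /var_vec; elim/big_rec : _ => // i x _ x0; rewrite le_max x0 orbT.
apply: (le_trans (var_comp V M0 mf fM hC1)).
apply: (@le_trans _ _ ((2 * c * norm1 a)%:E * var_vec var f)%E).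
  by apply: lee_wpmul2r => //; apply: ge_ereal_sup => _ [p pM <-]; exact: Dn.
by rewrite [leRHS]EFinM lee_wpmul2l// lee_fin !mulr_ge0.
Qed.

Lemma Bbound_bounded (h : X -> R[i]) (b c : R) : cmeasurable h ->
  (forall x, normc (h x) <= b) -> (var h <= c%:E)%E -> Bbound (b + c) h.
Proof.
move=> mh hb hc.
have ib : m.-integrable [set: X] (EFin \o (fun=> b)).
  by apply: finite_measure_integrable_cst.
apply: Bbound_intro => //.
  by apply: (ae_le_cintegrable mh ib); exact: aeW.
rewrite (le_trans (ae_le_L1norm mh ib _))//; first exact: aeW.
by rewrite Rintegral_cst// [X in _ * fine X](probability_setT m) mulr1.
Qed.

Let u (x : X) : R := dotv a (f x).
Let A := norm1 a.

Let mu : measurable_fun [set: X] u.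
Proof. exact: measurable_dot. Qed.

Let uM x : `|u x| <= A * M. Proof. exact: dotv_le. Qed.

Let mcomp (F : R -> R) : continuous F -> measurable_fun [set: X] (F \o u).
Proof. by move=> cF; apply: measurableT_comp => //; exact: continuous_measurable_fun. Qed.

Let derB (t y : R) : is_derive y (1 : R) (fun y => cos (t * y) - 1) (- sin (t * y) * t).
Proof.
apply: is_derive_eq; rewrite /GRing.scale /=; ring.
Qed.

Let derS (t y : R) : is_derive y (1 : R) (fun y => sin (t * y)) (cos (t * y) * t).
Proof. apply: is_derive_eq; rewrite /GRing.scale /=; ring. Qed.

Let derT (t y : R) :
  is_derive y (1 : R) (fun y => sin (t * y) - t * y) ((cos (t * y) - 1) * t).
Proof. apply: is_derive_eq; rewrite /GRing.scale /=; ring. Qed.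

Let cont_der (F F' : R -> R) :
  (forall y : R, is_derive y (1 : R) F (F' y)) -> continuous F.
Proof.
move=> dF y; apply/differentiable_continuous/derivable1_diffP.
by have [] := dF y.
Qed.

Let derS' (t y : R) :
  is_derive y (1 : R) (fun y => - sin (t * y) * t) (- cos (t * y) * t * t).
Proof. apply: is_derive_eq; rewrite /GRing.scale /=; ring. Qed.

Let derC' (t y : R) :
  is_derive y (1 : R) (fun y => cos (t * y) * t) (- sin (t * y) * t * t).
Proof. apply: is_derive_eq; rewrite /GRing.scale /=; ring. Qed.

Let derB' (t y : R) :
  is_derive y (1 : R) (fun y => (cos (t * y) - 1) * t) (- sin (t * y) * t * t).
Proof. apply: is_derive_eq; rewrite /GRing.scale /=; ring. Qed.

Let A0 : 0 <= A. Proof. exact: norm1_ge0. Qed.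

Let mpair (F G : R -> R) : continuous F -> continuous G ->
  cmeasurable (fun x => F (u x) +i* G (u x)).
Proof. by move=> cF cG; split; exact: mcomp. Qed.

Lemma Bbound_linear_form : Bbound (A * M + 2 * A * Vf) (of_real u).
Proof.
have -> : of_real u = (fun x => id (u x) +i* (fun=> 0) (u x)) by [].
apply: Bbound_bounded.
- exact: cmeasurable_real.
- by move=> x; rewrite /= expr0n addr0 sqrtr_sqr uM.
- rewrite -[2 in X in (_ <= X)%E]mulr1.
  apply: (@var_linear_form id (fun=> 0) (fun=> 1) (fun=> 0)) => //.
  + by move=> y; exact: cst_continuous.
  + by move=> y; exact: cst_continuous.
  + by move=> y _; rewrite normr1.
  + by move=> y _; rewrite normr0.
Qed.

Lemma Bbound_expi1_linear_form (t : R) : 0 <= t ->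
  Bbound (2 * (A * M + A * Vf) * t) (fun x => expi1 (t * u x)).
Proof.
move=> t0.
have E : (fun x => expi1 (t * u x)) =
    (fun x => (fun y => cos (t * y) - 1) (u x) +i* (fun y => sin (t * y)) (u x)).
  by apply/funext => x; rewrite /expi1 /expi /=; apply/eqP; rewrite eq_complex /= subr0 !eqxx.
have -> : 2 * (A * M + A * Vf) * t = 2 * (t * (A * M)) + 2 * t * A * Vf by ring.
apply: Bbound_bounded.
- by rewrite E; exact: (@mpair _ _ (cont_der (derB t)) (cont_der (derS t))).
- move=> x; rewrite (le_trans (normc_expi1 _))// ler_wpM2l// normrM ger0_norm//.
  by rewrite ler_wpM2l.
- rewrite E; apply: (var_linear_form (derB t) (derS t)) => //.
  + exact: (cont_der (derS' t)).
  + exact: (cont_der (derC' t)).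
  + by move=> y _; rewrite normrM normrN (ger0_norm t0) ler_piMl// sin_max.
  + by move=> y _; rewrite normrM (ger0_norm t0) ler_piMl// cos_max.
Qed.

Lemma Bbound_expi2_linear_form (t : R) : 0 <= t ->
  Bbound (2 * (A * M) * (A * M + A * Vf) * t ^+ 2) (fun x => expi2 (t * u x)).
Proof.
move=> t0.
have E : (fun x => expi2 (t * u x)) =
    (fun x => (fun y => cos (t * y) - 1) (u x) +i* (fun y => sin (t * y) - t * y) (u x)).
  apply/funext => x; rewrite /expi2 /expi1 /expi /=; apply/eqP; rewrite eq_complex /=.
  by apply/andP; split; apply/eqP; ring.
have tu y : `|y| <= A * M -> `|t * y| <= t * (A * M).
  by move=> yA; rewrite normrM ger0_norm// ler_wpM2l.
have -> : 2 * (A * M) * (A * M + A * Vf) * t ^+ 2 =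
    2 * (t * (A * M)) ^+ 2 + 2 * (t * (A * M) * t) * A * Vf by ring.
apply: Bbound_bounded.
- by rewrite E; exact: (@mpair _ _ (cont_der (derB t)) (cont_der (derT t))).
- move=> x; rewrite (le_trans (normc_expi2 _))// ler_wpM2l// lerXn2r ?nnegrE ?tu//.
  by rewrite !mulr_ge0// ltW.
- rewrite E; apply: (var_linear_form (derB t) (derT t)) => //.
  + exact: (cont_der (derS' t)).
  + exact: (cont_der (derB' t)).
  + by rewrite !mulr_ge0// ltW.
  + move=> y yA; rewrite normrM normrN (ger0_norm t0) ler_wpM2r//.
    by rewrite (le_trans (normr_sin_le _))// tu.
  + move=> y yA; rewrite normrM (ger0_norm t0) ler_wpM2r//.
    by rewrite (le_trans (cos_sub1_le _))// tu.
Qed.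

End variation_linear_form.

Section clipping.
Context {R : realType} {d : measure_display} {X : measurableType d} {n : nat}.
Variables (m : probability X R) (var : (X -> R[i]) -> \bar R).
Hypothesis V : is_variation m var n.
Local Notation Bbound := (Bbound m var).

(** The rule for the variation of a composition asks for a bound at every point,
    whereas the observable is only essentially bounded. *)
Definition clip (M y : R) := Num.max (- M) (Num.min M y).

Lemma clip_id (M y : R) : `|y| <= M -> clip M y = y.
Proof.
by rewrite ler_norml => /andP[y1 y2]; rewrite /clip (min_idPr y2) (max_idPr y1).
Qed.

Lemma normr_clip (M y : R) : 0 <= M -> `|clip M y| <= M.
Proof.
move=> M0; rewrite ler_norml /clip le_max lexx /= ge_max ge_min lexx andbT.
by rewrite (le_trans _ M0)// oppr_le0.
Qed.

Lemma measurable_clip (M : R) (h : X -> R) : measurable_fun [set: X] h ->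
  measurable_fun [set: X] (fun x => clip M (h x)).
Proof. by move=> mh; apply: measurable_maxr => //; exact: measurable_minr. Qed.

(** The constants depend on the observable only through its bounds, hence they
    serve for all fibers at once. *)
Lemma Bbound_linear_form_ae (a : 'rV[R]_n) (M Vg : R) : 0 < M -> 0 <= Vg ->
  exists U E : R, forall g : X -> 'rV[R]_n,
    (forall i, measurable_fun [set: X] (fun x => g x 0 i)) ->
    (forall i, {ae m, forall x, `|g x 0 i| <= M}) ->
    (var_vec var g <= Vg%:E)%E ->
    [/\ Bbound U (of_real (fun x => dotv a (g x))),
        forall t, 0 <= t -> Bbound (E * t) (fun x => expi1 (t * dotv a (g x))) &
        forall t, 0 <= t ->
          Bbound (E * t ^+ 2) (fun x => expi2 (t * dotv a (g x)))].
Proof.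
move=> M0 Vg0; have A0 := norm1_ge0 a.
pose E1 := 2 * (norm1 a * M + norm1 a * Vg).
pose E2 := 2 * (norm1 a * M) * (norm1 a * M + norm1 a * Vg).
have E10 : 0 <= E1 by rewrite !mulr_ge0// addr_ge0// mulr_ge0// ltW.
have E20 : 0 <= E2.
  by rewrite !mulr_ge0// ?(ltW M0)// addr_ge0// mulr_ge0// ltW.
exists (norm1 a * M + 2 * norm1 a * Vg), (E1 + E2) => g mg gM gV.
pose f x : 'rV[R]_n := \row_i clip M (g x 0 i).
have mf i : measurable_fun [set: X] (fun x => f x 0 i).
  by under eq_fun do rewrite mxE; exact: measurable_clip.
have fM x : `|f x| <= M.
  rewrite [leLHS]/Num.Def.normr /= mx_normrE.
  apply/bigmax_leP; split; first exact: ltW.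
  by move=> [i j] _ /=; rewrite mxE normr_clip// ltW.
have gfi i : {ae m, forall x, g x 0 i = f x 0 i}.
  by apply: filterS (gM i) => x gx; rewrite mxE clip_id.
have fg : {ae m, forall x, f x = g x}.
  have gf : {ae m, forall x, forall i, g x 0 i = f x 0 i} by apply: filter_forall gfi.
  apply: filterS gf => x gx.
  by apply/matrixP => i j; rewrite ord1 -gx.
have fint i : m.-integrable [set: X] (EFin \o (fun x => f x 0 i)).
  apply: (@integrable_ae_bounded _ _ _ _ _ M) => //.
  by apply: aeW => x; rewrite (le_trans (coord_le _ _)).
have gint i : m.-integrable [set: X] (EFin \o (fun x => g x 0 i)).
  exact: (@integrable_ae_bounded _ _ _ _ _ M).
have creal (u : X -> R) : m.-integrable [set: X] (EFin \o u) -> cintegrable m (of_real u).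
  by move=> iu; split => //=; exact: integrable0.
have fV : (var_vec var f <= Vg%:E)%E.
  apply: le_trans gV; rewrite /var_vec le_eqVlt; apply/orP; left; apply/eqP.
  apply: eq_bigr => i _; apply: (var_ae V); try exact: creal.
  by apply: filterS fg => x; rewrite /of_real => ->.
have mgl : measurable_fun [set: X] (fun x => dotv a (g x)) by exact: measurable_dot.
have transfer c (F : X -> R[i]) (G : X -> R[i]) : cmeasurable G ->
    {ae m, forall x, F x = G x} -> Bbound c F -> Bbound c G.
  move=> mG FG FB; apply: (Bbound_ae V _ FG FB).
  apply: (ae_le_cintegrable mG (integrable_normc FB.1)).
  by apply: filterS FG => x ->.
have mexpi t : cmeasurable (fun x => expi (t * dotv a (g x))).
  by apply: cmeasurable_expi; exact: measurable_funM.
have mexpi1 t : cmeasurable (fun x => expi1 (t * dotv a (g x))).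
  by apply: cmeasurableB; [exact: mexpi|exact: cmeasurable_cst].
split.
- apply: (transfer _ _ _ _ _ (Bbound_linear_form V a M0 mf fM fV)).
    exact: cmeasurable_real.
  by apply: filterS fg => x fgx; rewrite /of_real fgx.
- move=> t t0; apply: (@Bbound_le _ _ _ _ _ (E1 * t)).
    by rewrite ler_wpM2r// lerDl.
  apply: (transfer _ _ _ _ _ (Bbound_expi1_linear_form V a M0 mf fM fV t0)).
    exact: mexpi1.
  by apply: filterS fg => x ->.
- move=> t t0; apply: (@Bbound_le _ _ _ _ _ (E2 * t ^+ 2)).
    by rewrite ler_wpM2r ?sqr_ge0// lerDr.
  apply: (transfer _ _ _ _ _ (Bbound_expi2_linear_form V a M0 mf fM fV t0)).
    apply: cmeasurableB; first exact: mexpi1.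
    apply: cmeasurableM; first exact: cmeasurable_cst.
    by apply: cmeasurable_real; exact: measurable_funM.
  by apply: filterS fg => x ->.
Qed.

End clipping.

(** * Gaussian integrals on R^d *)

Section gaussian.
Context {R : realType} {n : nat}.
Variables (S2 : 'M[R]_n) (nu : probability (@borelRV R n) R).
Hypothesis S2_pos : pos_definite S2.
Hypothesis nu_gauss : centered_gaussian S2 nu.
Local Notation quad a := ((a *m S2 *m a^T) 0 0).

Lemma measurable_borelRV (f : 'rV[R]_n -> R) : continuous f ->
  measurable_fun [set: @borelRV R n] (f : @borelRV R n -> R).
Proof.
move=> cf mT; apply: (measurability _ (RGenOInfty.measurableE R)) => //.
move=> /= _ [_ [a ->] <-]; rewrite setTI; apply: sub_sigma_algebra.
by move/continuousP : cf; apply; exact: interval_open.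
Qed.

Lemma measurable_dotv (a : 'rV[R]_n) :
  measurable_fun [set: @borelRV R n] (dotv a : @borelRV R n -> R).
Proof. by apply: measurable_borelRV; exact: dotv_continuous. Qed.

Lemma gaussian_image (a : 'rV[R]_n) (f : R -> R) : a != 0 ->
  (normal_prob 0 (Num.sqrt (quad a))).-integrable [set: R] (EFin \o f) ->
  nu.-integrable [set: @borelRV R n] (EFin \o (f \o dotv a)) /\
  \int[nu]_y f (dotv a y) = \int[normal_prob 0 (Num.sqrt (quad a))]_x f x.
Proof.
have md : measurable_fun [set: @borelRV R n]
    (dotv a : @borelRV R n -> measurableTypeR R) by exact: measurable_dotv.
move=> a0 fi.
have mf : measurable_fun [set: measurableTypeR R] (EFin \o f).
  exact: measurable_int fi.
pose image : {measure set (measurableTypeR R) -> \bar R} :=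
  measure_function_pushforward__canonical__measure_function_Measure nu md.
have E (h : R -> \bar R) : (\int[normal_prob 0 (Num.sqrt (quad a))]_x h x =
    \int[pushforward nu (dotv a : @borelRV R n -> measurableTypeR R)]_x h x)%E.
  pose N : {measure set (measurableTypeR R) -> \bar R} :=
    normal_prob 0 (Num.sqrt (quad a)).
  have := @eq_measure_integral _ (measurableTypeR R) _ [set: R] image N h.
  by apply => A mA _; apply/esym; exact: nu_gauss.
have inu : nu.-integrable [set: @borelRV R n] (EFin \o (f \o dotv a)).
  apply/integrableP; split; first exact: (measurableT_comp mf md).
  have /integrableP[_] := fi; apply: le_lt_trans; rewrite E.
  rewrite ge0_integral_pushforward//; exact: measurableT_comp.
split => //; rewrite /Rintegral; congr fine.
by rewrite E (integral_pushforward md mf).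
Qed.

Lemma gaussian_integral_cos (a : 'rV[R]_n) (c : R) :
  \int[nu]_y cos (dotv a y + c) = cos c * expR (- (quad a / 2)).
Proof.
have [->|a0] := eqVneq a 0.
  under eq_Rintegral do rewrite /dotv trmx0 mulmx0 mxE add0r.
  rewrite Rintegral_cst// [X in _ * fine X](probability_setT nu) mulr1.
  by rewrite mul0mx mul0mx mxE mul0r oppr0 expR0 mulr1.
have q0 := S2_pos.2 _ a0.
have s0 : Num.sqrt (quad a) != 0 by rewrite gt_eqF// sqrtr_gt0.
rewrite (gaussian_image (f := fun x => cos (x + c)) a0 _).2.
  by rewrite normal_prob_integral_cos// sqr_sqrtr// ltW.
apply: (@integrable_ae_bounded _ _ _ _ _ 1); last by apply: aeW => x; exact: cos_max.
exact: (cmeasurable_expi (measurable_funD _ _)).1.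
Qed.

Lemma gaussian_sqr_integrable (i : 'I_n) :
  nu.-integrable [set: @borelRV R n] (EFin \o (fun y => (y : 'rV[R]_n) 0 i ^+ 2)).
Proof.
pose e : 'rV[R]_n := delta_mx 0 i.
have e0 : e != 0.
  apply/eqP => /matrixP /(_ 0 i); rewrite !mxE !eqxx => /eqP.
  by rewrite oner_eq0.
have s0 : Num.sqrt (quad e) != 0 by rewrite gt_eqF// sqrtr_gt0; exact: S2_pos.2 _ e0.
have [+ _] := gaussian_image e0 (normal_prob_integrable_sqr s0).
have -> // : (fun x : R => x ^+ 2) \o dotv e = fun y => y 0 i ^+ 2.
apply/funext => y /=; congr (_ ^+ 2); rewrite dotvE (bigD1 i)//= big1.
  by rewrite mxE !eqxx mulr1 addr0.
by move=> j ji; rewrite mxE (negbTE ji) andbF mulr0.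
Qed.

End gaussian.

(** * The limit theorem along one trajectory *)

Section sequential_clt.
Context {R : realType} {d : measure_display} {X : measurableType d} {n : nat}.
Variables (m : probability X R) (var : (X -> R[i]) -> \bar R).
Hypothesis V : is_variation m var n.
Variables (T : nat -> X -> X) (L : nat -> (X -> R[i]) -> X -> R[i]).
Hypothesis T_nonsingular : forall j, nonsingular m (T j).
Hypothesis L_transfer : forall j, transfer_operator m (T j) (L j).
Variables K q : R.
Hypotheses (K1 : 1 <= K) (q0 : 0 <= q) (q1 : q < 1).
Local Notation Bbound := (Bbound m var).
Hypothesis L_bound : forall j c f, Bbound c f -> Bbound (K * c) (L j f).
Hypothesis L_decay : forall j k c f, Bbound c f -> cintegral m f = 0 ->
  Bbound (K * q ^+ k * c) (itL L k j f).
Variables (v : nat -> X -> R) (mu : nat -> probability X R).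
Hypothesis mv : forall j, measurable_fun [set: X] (v j).
Hypothesis v_ge0 : forall j x, 0 <= v j x.
Hypothesis vB : forall j, inB m var (of_real (v j)).
Hypothesis Lv : forall j,
  {ae m, forall x, L j (of_real (v j)) x = of_real (v j.+1) x}.
Hypothesis muE : forall j A, measurable A ->
  (mu j A = \int[m]_(x in A) (v j x)%:E)%E.
Variables (g : nat -> X -> 'rV[R]_n) (M Vg : R).
Hypotheses (M0 : 0 < M) (Vg0 : 0 <= Vg).
Hypothesis mg : forall j i, measurable_fun [set: X] (fun x => g j x 0 i).
Hypothesis gM : forall j i, {ae m, forall x, `|g j x 0 i| <= M}.
Hypothesis gV : forall j, (var_vec var (g j) <= Vg%:E)%E.
Hypothesis g0 : forall j i, \int[mu j]_x (g j x 0 i) = 0.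

Definition partial_sum k x : 'rV[R]_n := \sum_(i < k) g i (itT T i x).
Local Notation S := partial_sum.

Lemma ae_density j (Q : X -> Prop) : {ae m, forall x, Q x} -> {ae mu j, forall x, Q x}.
Proof.
move=> [N [mN N0 QN]]; exists N; split => //.
rewrite muE//; apply: null_set_integral => //.
by apply: measurable_funTS; exact/measurable_EFinP.
Qed.

Lemma partial_sumE k x i : S k x 0 i = \sum_(j < k) g j (itT T j x) 0 i.
Proof. by rewrite /partial_sum summxE. Qed.

Lemma measurable_partial_sum k i : measurable_fun [set: X] (fun x => S k x 0 i).
Proof.
under eq_fun do rewrite partial_sumE.
apply: measurable_sum => j.
exact: (measurableT_comp (mg j i) (itT_nonsingular T_nonsingular j).1).
Qed.

Lemma partial_sum_bounded k i : {ae mu 0, forall x, `|S k x 0 i| <= k%:R * M}.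
Proof.
apply: ae_density.
have H : {ae m, forall x, forall j : 'I_k, `|g j (itT T j x) 0 i| <= M}.
  apply: filter_forall => j.
  exact: (ae_preimage (itT_nonsingular T_nonsingular j) (gM j i)).
apply: filterS H => x gx; rewrite partial_sumE (le_trans (ler_norm_sum _ _ _))//.
have -> : k%:R * M = \sum_(j < k) M by rewrite sumr_const card_ord mulr_natl.
by apply: ler_sum => j _; exact: gx.
Qed.

Lemma partial_sum_integrable k i :
  (mu 0).-integrable [set: X] (EFin \o (fun x => S k x 0 i)).
Proof.
exact: (integrable_ae_bounded (measurable_partial_sum k i) (partial_sum_bounded k i)).
Qed.

Lemma partial_sumM_integrable k i j :
  (mu 0).-integrable [set: X] (EFin \o (fun x => S k x 0 i * S k x 0 j)).
Proof.
apply: (@integrable_ae_bounded _ _ _ _ _ (k%:R * M * (k%:R * M))).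
  by apply: measurable_funM; exact: measurable_partial_sum.
apply: filterS2 (partial_sum_bounded k i) (partial_sum_bounded k j) => x xi xj.
by rewrite normrM ler_pM.
Qed.

Let v1 j : cintegral m (of_real (v j)) = 1.
Proof.
rewrite /cintegral /= Rintegral_cst// mul0r; congr (_ +i* _).
rewrite /Rintegral -(muE j measurableT).
by rewrite [X in fine X](probability_setT (mu j)).
Qed.

Lemma image_density k (f : X -> R) (c : R) : measurable_fun [set: X] f ->
  {ae m, forall x, `|f x| <= c} ->
  \int[mu 0]_x f (itT T k x) = \int[mu k]_x f x.
Proof.
move=> mf fc; have nS := itT_nonsingular T_nonsingular k.
rewrite !(Rintegral_density (m := m) (mv _) (v_ge0 _) (muE _)); first last.
- by apply: (integrable_ae_bounded _ (ae_density _ (ae_preimage nS fc)));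
    exact: measurableT_comp nS.1.
- exact: (integrable_ae_bounded mf (ae_density _ fc)).
have [_ _ _ /(_ (of_real f) c (cmeasurable_real mf))] := transports_density
  T_nonsingular L_transfer (fun j => (vB j).1) Lv k.
have fc' : {ae m, forall x, normc (of_real f x) <= c}.
  by apply: filterS fc => x; rewrite normc_real.
move=> /(_ fc') /(congr1 (@complex.Re R)) /= E.
transitivity (\int[m]_x Re (of_real (v 0) x * 1 * of_real f (itT T k x))).
  by apply: eq_Rintegral => x _ /=; ring.
by rewrite -E; apply: eq_Rintegral => x _ /=; ring.
Qed.

Lemma partial_sum_centered k i : \int[mu 0]_x (S k x 0 i) = 0.
Proof.
elim: k => [|k IH].
  under eq_Rintegral do rewrite /partial_sum big_ord0 mxE.
  by rewrite Rintegral_cst// mul0r.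
under eq_Rintegral do rewrite /partial_sum big_ord_recr /= mxE.
have nS := itT_nonsingular T_nonsingular k.
rewrite RintegralD//; last 2 first.
- exact: partial_sum_integrable.
- apply: (integrable_ae_bounded _ (ae_density _ (ae_preimage nS (gM k i)))).
  exact: measurableT_comp (mg k i) nS.1.
by rewrite IH (image_density k (mg k i) (gM k i)) g0 addr0.
Qed.

Lemma covariance_partial_sum k i j :
  covariance (mu 0) (fun x => S k x 0 i) (fun x => S k x 0 j) =
  (\int[mu 0]_x (S k x 0 i * S k x 0 j))%:E.
Proof.
have E0 l : fine (expectation (mu 0) (fun x => S k x 0 l)) = 0.
  by rewrite expectation.unlock; exact: partial_sum_centered.
rewrite covariance.unlock !E0 expectation.unlock /Rintegral fineK; last first.
  by apply: integrable_fin_num => //; exact: partial_sumM_integrable.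
by apply: eq_integral => x _; rewrite [in LHS]/GRing.mul /= !subr0.
Qed.

Section linear_form.
Variable a : 'rV[R]_n.
Let u j x := dotv a (g j x).

Let bsum_dotv k x : bsum T u k x = dotv a (S k x).
Proof.
elim: k => [|k IH] /=; first by rewrite /partial_sum big_ord0 linear0.
by rewrite /partial_sum big_ord_recr /= linearD /= IH.
Qed.

Lemma dotv_sqr_integral k : \int[mu 0]_x (dotv a (S k x) ^+ 2) =
  \sum_i \sum_j a 0 i * a 0 j * \int[mu 0]_x (S k x 0 i * S k x 0 j).
Proof.
have iij i j : (mu 0).-integrable [set: X]
    (EFin \o (fun x => a 0 i * a 0 j * (S k x 0 i * S k x 0 j))).
  exact/integrable_mull/partial_sumM_integrable.
have ii i := Rintegral_sum (index_enum 'I_n) (iij i).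
transitivity (\int[mu 0]_x
    (\sum_i \sum_j a 0 i * a 0 j * (S k x 0 i * S k x 0 j))).
  apply: eq_Rintegral => x _; rewrite dotvE expr2 mulr_suml.
  apply: eq_bigr => i _; rewrite mulr_sumr; apply: eq_bigr => j _; ring.
rewrite (Rintegral_sum _ (fun i => (ii i).1)).2.
apply: eq_bigr => i _; rewrite (ii i).2; apply: eq_bigr => j _.
by rewrite RintegralZl//; exact: partial_sumM_integrable.
Qed.

Let mdotv k : measurable_fun [set: X] (fun x => dotv a (S k x)).
Proof. by apply: measurable_dot => i; exact: measurable_partial_sum. Qed.

Lemma dotv_sqr_integrable k :
  (mu 0).-integrable [set: X] (EFin \o (fun x => dotv a (S k x) ^+ 2)).
Proof.
have H : {ae mu 0, forall x, forall i, `|S k x 0 i| <= k%:R * M}.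
  by apply: filter_forall => i; exact: partial_sum_bounded.
apply: (@integrable_ae_bounded _ _ _ _ _ ((norm1 a * (k%:R * M)) ^+ 2)).
  exact: measurable_funX.
apply: filterS H => x Sx; rewrite normrX lerXn2r ?nnegrE//.
  by rewrite mulr_ge0 ?norm1_ge0// mulr_ge0// ltW.
apply: dotv_le; rewrite [leLHS]/Num.Def.normr /= mx_normrE.
apply/bigmax_leP; split; first by rewrite mulr_ge0// ltW.
by move=> [i j] _ /=; rewrite ord1.
Qed.

Lemma cos_partial_sum_cvg (s2 c : R) :
  k%:R^-1 * \int[mu 0]_x (dotv a (S k x) ^+ 2) @[k --> \oo] --> s2 ->
  \int[mu 0]_x cos (dotv a ((Num.sqrt k%:R)^-1 *: S k x) + c) @[k --> \oo] -->
  cos c * expR (- (s2 / 2)).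
Proof.
move=> s2P.
have [Cv Cv1 CvP] := var_Loo V.
have [b1 b1B] : exists c1, Bbound c1 (fun=> 1).
  apply: (inB_Bbound V); split; last exact: var_one V.
  by split; [exact: finite_measure_integrable_cst|exact: integrable0].
have [v0b v0B] := inB_Bbound V (vB 0).
have [Vb VB] := density_bounded V T_nonsingular L_transfer K1 q0 q1 L_bound L_decay
  v0B b1B (fun j => (vB j).1) v1 Lv.
have [U [E linB]] := Bbound_linear_form_ae V a M0 Vg0.
have uB j : Bbound U (of_real (u j)) by have [] := linB _ (mg j) (gM j) (gV j).
have e1B j (t : R) : 0 <= t <= 1 -> Bbound (E * t) (fun x => expi1 (t * u j x)).
  by move=> /andP[t0 _]; have [_ + _] := linB _ (mg j) (gM j) (gV j); exact.
have e2B j (t : R) : 0 <= t <= 1 -> Bbound (E * t ^+ 2) (fun x => expi2 (t * u j x)).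
  by move=> /andP[t0 _]; have [_ _ +] := linB _ (mg j) (gM j) (gV j); exact.
have mu_ j : measurable_fun [set: X] (u j) := (cintegrable_measurable (uB j).1).1.
have uv0 j : cintegral m (fun x => of_real (u j) x * of_real (v j) x) = 0.
  have iu i : (mu j).-integrable [set: X] (EFin \o (fun x => g j x 0 i)).
    exact: (integrable_ae_bounded (mg j i) (ae_density _ (gM j i))).
  have iua i : (mu j).-integrable [set: X] (EFin \o (fun x => a 0 i * g j x 0 i)).
    exact: integrable_mull.
  have [is_ Es] := Rintegral_sum (index_enum 'I_n) iua.
  have uE : u j = fun x => \sum_i a 0 i * g j x 0 i.
    by apply/funext => x; rewrite /u dotvE; apply: eq_bigr => i _; rewrite mulrC.
  have : \int[mu j]_x u j x = 0.
    rewrite uE Es big1// => i _; rewrite RintegralZl// g0 mulr0//.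
  have iuj : (mu j).-integrable [set: X] (EFin \o u j) by rewrite uE.
  rewrite (Rintegral_density (m := m) (mv j) (v_ge0 j) (muE j) iuj) => E0.
  rewrite /cintegral /=; under eq_Rintegral do rewrite mulr0 subr0.
  rewrite E0; under eq_Rintegral do rewrite mulr0 mul0r addr0.
  by rewrite Rintegral_cst// mul0r.
have tw t k := transports_twisted T_nonsingular L_transfer VB uB t k.
have cvg := charf_cvg V Cv1 CvP T_nonsingular L_transfer K1 q0 q1 L_bound L_decay
  (v_ge0 0) VB v1 Lv uB uv0 e1B e2B.
pose tau k : R := (Num.sqrt k%:R)^-1.
have cosE k : \int[mu 0]_x cos (dotv a (tau k *: S k x) + c) =
    Re (expi c * charf m L v u (tau k) k).
  have [_ mPhi _ _] := tw (tau k) k.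
  have bPhi : {ae m, forall x, normc (expi (tau k * bsum T u k x)) <= 1}.
    by apply: aeW => x; rewrite normc_expi.
  rewrite /charf (transports_integral (tw (tau k) k)) -cintegralZ; last first.
    exact: (cintegrable_bounded (vB 0).1 mPhi bPhi).
  rewrite (Rintegral_density (m := m) (mv 0) (v_ge0 0) (muE _)).
    apply: eq_Rintegral => x _; rewrite bsum_dotv linearZ /= cosD.
    by rewrite !(mul0r, subr0, add0r, addr0); ring.
  apply: (@integrable_ae_bounded _ _ _ _ _ 1); last by apply: aeW => x; exact: cos_max.
  have md : measurable_fun [set: X] (fun x => dotv a (tau k *: S k x) + c).
    apply: measurable_funD => //.
    by under eq_fun do rewrite linearZ /=; exact: measurable_funM.
  exact: (cmeasurable_expi md).1.
have -> : cos c * expR (- (s2 / 2)) = Re (expi c * (expR (- (s2 / 2)))%:C).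
  by rewrite /= mulr0 subr0.
rewrite -/tau; under eq_fun do rewrite cosE.
apply/cvgrPdist_le => e e0.
have := cvg s2; rewrite (_ : (fun k => _) = fun k => k%:R^-1 * \int[mu 0]_x (dotv a (S k x) ^+ 2)).
  move=> /(_ s2P) /cvgrPdist_le /(_ e e0); apply: filterS => k.
  rewrite sub0r normrN ger0_norm ?normc_ge0// => le_e.
  have -> (y z : R[i]) : Re y - Re z = Re (y - z) by case: y z => ? ? [].
  rewrite -mulrBr (le_trans (normRe_le _))// Normc.normcM normc_expi mul1r.
  by rewrite -normcN opprB.
apply/funext => k; congr (_ * _).
rewrite (Rintegral_density (m := m) (mv 0) (v_ge0 0) (muE _)) ?dotv_sqr_integrable//.
by apply: eq_Rintegral => x _; rewrite bsum_dotv mulrC.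
Qed.

End linear_form.

Section gaussian_limit.
Variables (S2 : 'M[R]_n) (nu : probability (@borelRV R n) R).
Hypothesis S2_pos : pos_definite S2.
Hypothesis nu_gauss : centered_gaussian S2 nu.
Hypothesis cov_cvg : forall i j, ((k%:R^-1)%:E *
    covariance (mu 0) (fun x => S k x 0%R i) (fun x => S k x 0%R j))%E
  @[k --> \oo] --> ((S2 i j)%:E)%E.

Let second_moment i j k := \int[mu 0]_x (S k x 0 i * S k x 0 j).

Let second_moment_cvg i j :
  k%:R^-1 * second_moment i j k @[k --> \oo] --> S2 i j.
Proof.
have := @cov_cvg i j; under eq_fun do rewrite covariance_partial_sum -EFinM.
exact: fine_cvg.
Qed.

Lemma dotv_sqr_cvg (a : 'rV[R]_n) :
  k%:R^-1 * \int[mu 0]_x (dotv a (S k x) ^+ 2) @[k --> \oo] -->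
  (a *m S2 *m a^T) 0 0.
Proof.
have -> : (a *m S2 *m a^T) 0 0 = \sum_i \sum_j a 0 i * a 0 j * S2 i j.
  rewrite mxE; under eq_bigr do rewrite !mxE mulr_suml.
  rewrite exchange_big; apply: eq_bigr => i _; apply: eq_bigr => j _; ring.
under eq_fun do rewrite dotv_sqr_integral mulr_sumr.
apply: cvg_big => [|i _]; first exact: add_continuous.
under eq_fun do rewrite mulr_sumr.
apply: cvg_big => [|j _]; first exact: add_continuous.
under eq_fun do rewrite mulrCA.
by apply: cvgMr; exact: second_moment_cvg.
Qed.

Theorem trajectory_clt (phi : 'rV[R]_n -> R) (B : R) : continuous phi ->
  (forall y, `|phi y| <= B) ->
  \int[mu 0]_x phi ((Num.sqrt k%:R)^-1 *: S k x) @[k --> \oo] -->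
  \int[nu]_y phi (y : 'rV[R]_n).
Proof.
move=> cphi phiB.
have sqE k i x : (((Num.sqrt k%:R)^-1 *: S k x) 0 i) ^+ 2 =
    k%:R^-1 * (S k x 0 i * S k x 0 i).
  by rewrite mxE exprMn exprVn sqr_sqrtr ?ler0n// [S k x 0 i ^+ 2]expr2.
have intE k i : \int[mu 0]_x (((Num.sqrt k%:R)^-1 *: S k x) 0 i ^+ 2) =
    k%:R^-1 * second_moment i i k.
  under eq_Rintegral do rewrite sqE.
  by rewrite RintegralZl//; exact: partial_sumM_integrable.
have /choice[C CP] : forall i, exists c, forall k, k%:R^-1 * second_moment i i k <= c.
  move=> i; have : cvgn (fun k => k%:R^-1 * second_moment i i k).
    by apply/cvg_ex; exists (S2 i i).
  move=> /cvg_seq_bounded /pinfty_ex_gt0[c _ cP].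
  by exists c => k; rewrite (le_trans (ler_norm _))//; exact: cP.
apply: (weak_convergence_of_cos (mu := mu 0) (nu := nu)
  (Z := fun k x => (Num.sqrt k%:R)^-1 *: S k x) (W := id) (C := \sum_i `|C i|)
  _ _ _ _ _ _ cphi phiB).
- move=> k i; under eq_fun do rewrite mxE.
  by apply: measurable_funM => //; exact: measurable_partial_sum.
- by move=> i; apply: measurable_borelRV; exact: coord_continuous.
- move=> k i; under eq_fun do rewrite sqE.
  by apply: integrable_mull; exact: partial_sumM_integrable.
- exact: (gaussian_sqr_integrable S2_pos nu_gauss).
- move=> k i; rewrite intE (le_trans (CP i k))// (le_trans (ler_norm _))//.
  by rewrite (bigD1 i)//= lerDl sumr_ge0.
- move=> a c; rewrite [X in _ --> X](gaussian_integral_cos S2_pos nu_gauss).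
  by apply: cos_partial_sum_cvg; exact: dotv_sqr_cvg.
Qed.

End gaussian_limit.

End sequential_clt.

(** * From the cocycle to its trajectories *)

Section almost_everywhere.
Context {R : realType}.

Lemma ae_iter {d : measure_display} {O : measurableType d} (P : probability O R)
    (sigma : O -> O) (Q : O -> Prop) :
  nonsingular P sigma -> {ae P, forall w, Q w} ->
  {ae P, forall w, forall j, Q (iter j sigma w)}.
Proof.
move=> nS QP; apply/ae_foralln => j; elim: j => [|j IH]; first exact: QP.
by have := ae_preimage nS IH; apply: filterS => w; rewrite iterSr.
Qed.

Lemma ae_section {d1 d2 : measure_display} {X1 : measurableType d1}
    {X2 : measurableType d2} (P : probability X1 R) (m : probability X2 R)
    (Q : X1 * X2 -> Prop) :
  {ae (P \x m)%E, forall p, Q p} ->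
  {ae P, forall w, {ae m, forall x, Q (w, x)}}.
Proof.
move=> [N [mN N0 QN]].
have mx := measurable_fun_xsection m mN.
have : (\int[P]_w `|m (xsection N w)| = 0)%E.
  by rewrite -[RHS]N0; apply: eq_integral => w _; rewrite gee0_abs.
move/(ae_eq_integral_abs _ measurableT mx); apply: filterS => w /(_ I) Nw0.
exists (xsection N w); split => //; first exact: measurable_xsection.
by move=> x Qx; rewrite xsectionE /=; exact: QN.
Qed.

Lemma ereal_ub (x : \bar R) : (x < +oo)%E -> exists2 c : R, 0 < c & (x <= c%:E)%E.
Proof.
case: x => [r _|//|_]; last by exists 1; rewrite ?leNye.
by exists (Num.max 1 r); rewrite ?lt_max ?ltr01// lee_fin le_max lexx orbT.
Qed.

End almost_everywhere.

Section iterates.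
Context {F : Type}.

Lemma itLSr (L : nat -> F -> F) (k j : nat) (f : F) :
  itL L k.+1 j f = L (j + k)%N (itL L k j f).
Proof.
elim: k j f => [|k IH] j f; first by rewrite /= addn0.
by rewrite -[LHS]/(itL L k.+1 j.+1 (L j f)) IH addSnnS.
Qed.

End iterates.

Section orbit.
Context {R : realType} {dO dX : measure_display} {Omega : measurableType dO}
  {X : measurableType dX}.
Variables (sigma : Omega -> Omega) (T : Omega -> X -> X)
  (L : Omega -> (X -> R[i]) -> X -> R[i]) (w : Omega).

Lemma iterL_itL k j f :
  iterL sigma L k (iter j sigma w) f = itL (fun i => L (iter i sigma w)) k j f.
Proof.
by elim: k => // k IH; rewrite itLSr /= IH addnC iterD.
Qed.

Lemma iterT_itT k x : iterT sigma T k w x = itT (fun i => T (iter i sigma w)) k x.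
Proof. by elim: k => //= k ->. Qed.

Lemma birkhoff_sumE n (g : Omega * X -> 'rV[R]_n) k x :
  birkhoff_sum sigma T g k w x =
  partial_sum (fun i => T (iter i sigma w)) (fun j y => g (iter j sigma w, y)) k x.
Proof. by apply: eq_bigr => i _; rewrite iterT_itT. Qed.

End orbit.

Section operator_bounds.
Context {R : realType} {dO dX : measure_display} {Omega : measurableType dO}
  {X : measurableType dX} {n : nat}.
Variables (P : probability Omega R) (sigma : Omega -> Omega) (m : probability X R).
Variables (var : (X -> R[i]) -> \bar R) (T : Omega -> X -> X)
  (L : Omega -> (X -> R[i]) -> X -> R[i]).
Hypothesis V : is_variation m var n.
Hypothesis L_transfer : forall w, transfer_operator m (T w) (L w).
Local Notation Bbound := (Bbound m var).

Lemma cocycle_bounds : bounded_cocycle P m var L -> uniform_decay P sigma m var L ->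
  exists K q : R, [/\ 1 <= K, 0 <= q, q < 1 &
    {ae P, forall w,
      (forall c f, Bbound c f -> Bbound (K * c) (L w f)) /\
      (forall k c f, Bbound c f -> cintegral m f = 0 ->
         Bbound (K * q ^+ k * c) (iterL sigma L k w f))}].
Proof.
move=> [Kb Kb0 KbP] [Kd [lam [Kd0 lam0 decP]]].
pose K := Num.max 1 (Num.max Kb Kd).
exists K, (expR (- lam)); split.
- by rewrite le_max lexx.
- exact: expR_ge0.
- by rewrite expR_lt1 oppr_lt0.
have iterL_int k w f : cintegrable m f -> cintegrable m (iterL sigma L k w f).
  move=> fi; elim: k => //= k IH.
  exact: (transfer_integrable (L_transfer _) IH).
apply: filterS2 KbP decP => w KbP decP; split=> [c f fc|k c f fc f0].
  have fB := Bbound_inB fc; have c0 := Bbound_ge0 V fc.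
  split; first exact: (transfer_integrable (L_transfer w) fc.1).
  apply: (le_trans (KbP f fB)); apply: (@le_trans _ _ (Kb%:E * c%:E)%E).
    by rewrite lee_pmul2l// ?lte_fin//; exact: fc.2.
  by rewrite -EFinM lee_fin ler_wpM2r// !le_max lexx !orbT.
have fB := Bbound_inB fc; have c0 := Bbound_ge0 V fc.
split; first exact: iterL_int fc.1.
apply: (le_trans (decP k f fB f0)).
have -> : expR (- lam * k%:R) = expR (- lam) ^+ k by rewrite expRM_natr.
apply: (@le_trans _ _ ((Kd * expR (- lam) ^+ k)%:E * c%:E)%E).
  rewrite lee_pmul2l//; first exact: fc.2.
  by rewrite lte_fin mulr_gt0// exprn_gt0// expR_gt0.
rewrite -EFinM lee_fin ler_wpM2r// ler_wpM2r ?exprn_ge0 ?expR_ge0//.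
by rewrite !le_max lexx !orbT.
Qed.

Lemma observable_bounds (g : Omega * X -> 'rV[R]_n) : regular_observable P m var g ->
  exists M Vg : R, [/\ 0 < M, 0 <= Vg &
    {ae P, forall w,
      (forall i, {ae m, forall x, `|g (w, x) 0 i| <= M}) /\
      (var_vec var (fun x => g (w, x)) <= Vg%:E)%E}].
Proof.
move=> [_ gLoo gvar].
have [Vg Vg0 gVg] := ereal_ub gvar; move/ess_supP : gVg => gVg.
have PmT : ((P \x m) setT = 1)%E.
  rewrite -setXTT product_measure1E//.
  by rewrite [X in (X * _)%E](probability_setT P) [X in (_ * X)%E](probability_setT m) mule1.
move: gLoo; rewrite unlock ifT; last by rewrite [X in (_ < X)%E]PmT lte01.
move=> /ereal_ub[M M0] /ess_supP gM.
exists M, Vg; split => //; first exact: ltW.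
have gM' : {ae (P \x m)%E, forall p, `|g p| <= M}.
  by apply: filterS gM => p /=; rewrite lee_fin normr_id.
apply: filterS2 (ae_section gM') gVg => w gw vw; split => // i.
by apply: filterS gw => x; apply: le_trans; exact: coord_le.
Qed.

End operator_bounds.

Theorem theorem4p8 (R : realType) (Y : metricType R)
  (dO dX : measure_display) (Omega : measurableType dO) (X : measurableType dX)
  (P : probability Omega R) (iota : Omega -> Y) (sigma : Omega -> Omega)
  (m : probability X R) (var : (X -> R[i]) -> \bar R)
  (T : Omega -> X -> X) (L : Omega -> (X -> R[i]) -> X -> R[i])
  (v0 : Omega * X -> R) (mu : Omega -> probability X R)
  (d : nat) (g : Omega * X -> 'rV[R]_d) (Sigma2 : 'M[R]_d)
  (nu : probability (@borelRV R d) R) :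
  separable_complete Y ->
  borel_subset iota ->
  homeomorphism iota sigma ->
  invertible_ergodic P sigma ->
  is_variation m var d ->
  (forall w, nonsingular m (T w)) ->
  (forall w, transfer_operator m (T w) (L w)) ->
  admissible P iota sigma m var L ->
  invariant_density P sigma m var L v0 ->
  has_density P m v0 mu ->
  regular_observable P m var g ->
  fiberwise_centered P g mu ->
  asymptotic_covariance P sigma T g mu Sigma2 ->
  pos_definite Sigma2 ->
  centered_gaussian Sigma2 nu ->
  forall phi : 'rV[R]_d -> R,
    continuous phi -> (exists K : R, forall v, `|phi v| <= K) ->
    {ae P, forall w,
      (\int[mu w]_x
         (phi ((Num.sqrt n%:R)^-1 *: birkhoff_sum sigma T g n w x))%:E)%E
        @[n --> \oo] --> (\int[nu]_y (phi y)%:E)%E}.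

Proof.
move=> _ _ _ [msigma _ Psigma _] V Tn Lt [_ bdd _ dec _] [mv v0_ge0 inv] dens reg
  cent cov S2pos nug phi cphi [B phiB].
have nsigma : nonsingular P sigma.
  split => //; apply/null_content_dominatesP => A mA A0.
  by rewrite /pushforward Psigma.
have [K [q [K1 q0 q1 LP]]] := cocycle_bounds V Lt bdd dec.
have [M [Vg [M0 Vg0 gP]]] := observable_bounds reg.
have [mg _ _] := reg.
have LP' := ae_iter nsigma LP; have gP' := ae_iter nsigma gP.
have inv' := ae_iter nsigma inv; have dens' := ae_iter nsigma dens.
have cent' := ae_iter nsigma cent.
apply: filterS2 (filterI LP' (filterI gP' (filterI inv' dens'))) (filterI cent' cov).
move=> w [Lw [gw [invw densw]]] [centw covw].
pose o j := iter j sigma w.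
have mgo j i : measurable_fun [set: X] (fun x => g (o j, x) 0 i).
  exact: (measurableT_comp (mg i) (pair1_measurable (o j))).
have mvo j : measurable_fun [set: X] (fun x => v0 (o j, x)).
  exact: (measurableT_comp mv (pair1_measurable (o j))).
pose S k (x : X) := birkhoff_sum sigma T g k w x.
have SE : S = partial_sum (fun j => T (o j)) (fun j x => g (o j, x)).
  by apply/funext => k; apply/funext => x; exact: birkhoff_sumE.
have clt : \int[mu w]_x phi ((Num.sqrt k%:R)^-1 *: S k x) @[k --> \oo] -->
    \int[nu]_y phi (y : 'rV[R]_d).
  rewrite SE.
  apply: (@trajectory_clt R dX X d m var V (fun j => T (o j)) (fun j => L (o j))
    (fun j => Tn (o j)) (fun j => Lt (o j)) K q K1 q0 q1
    (fun j => (Lw j).1) _ (fun j x => v0 (o j, x)) (fun j => mu (o j))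
    mvo (fun j x => v0_ge0 (o j, x)) _ _ (fun j => densw j)
    (fun j x => g (o j, x)) M Vg M0 Vg0 mgo
    (fun j => (gw j).1) (fun j => (gw j).2) _ Sigma2 nu S2pos nug _ phi B cphi phiB).
  - by move=> j k c f fc f0; rewrite -iterL_itL; exact: (Lw j).2.
  - by move=> j; have [] := invw j.
  - by move=> j; have [] := invw j.
  - by move=> j i; rewrite /Rintegral (centw j i).
  - by rewrite -SE.
have iphi k : (mu w).-integrable [set: X]
    (fun x => (phi ((Num.sqrt k%:R)^-1 *: S k x))%:E).
  apply: (integrable_continuous_comp _ _ cphi phiB) => i.
  under eq_fun do rewrite SE mxE.
  by apply: measurable_funM => //; exact: measurable_partial_sum.
have inu : nu.-integrable [set: @borelRV R d] (fun y => (phi y)%:E).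
  apply: (@integrable_continuous_comp _ _ _ _ nu (fun y => y) _ phi B cphi phiB) => i.
  by apply: measurable_borelRV; exact: coord_continuous.
have -> : (\int[nu]_y (phi y)%:E = (\int[nu]_y phi (y : 'rV[R]_d))%:E)%E.
  by rewrite /Rintegral fineK//; exact: integrable_fin_num.
apply/fine_cvgP; split; last exact: clt.
by apply: nearW => k; apply: integrable_fin_num => //; exact: iphi.
Qed.
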